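(* Let $d\ge 2$, $\alpha>-1$, $r\in\mathbb{N}$, and let $U^d$ be either $\mathbb{R}^d$ or $\mathbb{R}^d_+$. Then there are constants $C_1,C_2>0$ independent of $n$ such that for all integers $n\ge2$ \[ C_1\, n^{-3r/4}(\log n)^{3r(d-1)/4}\;\le\;\mathrm{Int}_n\big(\mathbf{W}^r_{1,\mathbf{w}_r}(U^d)\big)\;\le\;C_2\, n^{-r/2}(\log n)^{(r/2+1)(d-1)}. \]
   Context: For $r\in\mathbb{N}_0$ let $w_r(x)=|x|^{\alpha+r/2}e^{-|x|}$ ($x\in U$, where $U=\mathbb{R}$ or $U=\mathbb{R}_+$ correspondingly) and $\mathbf{w}_r(\mathbf{x})=\prod_{i=1}^d w_r(x_i)$ for $\mathbf{x}\in U^d$; $\mathbf{w}:=\mathbf{w}_0$. The space $L_{1,\mathbf{w}_r}(U^d)$ consists of measurable $f$ with $\|f\|_{L_{1,\mathbf{w}_r}}=\int_{U^d}|f(\mathbf{x})\mathbf{w}_r(\mathbf{x})|\,d\mathbf{x}<\infty$. The weighted Sobolev space of mixed smoothness $W^r_{1,\mathbf{w}_r}(U^d)$ consists of $f\in L_{1,\mathbf{w}_r}(U^d)$ such that the weak partial derivatives $D^{\mathbf{k}}f$ belong to $L_{1,\mathbf{w}_r}(U^d)$ for all $\mathbf{k}\in\mathbb{N}_0^d$ with $|\mathbf{k}|_\infty\le r$, with norm $\sum_{|\mathbf{k}|_\infty\le r}\|D^{\mathbf{k}}f\|_{L_{1,\mathbf{w}_r}}$; its elements are identified with their continuous representatives,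 and $\mathbf{W}^r_{1,\mathbf{w}_r}(U^d)$ is its closed unit ball. For a set $\mathbf{F}$ of continuous functions on $U^d$, $\mathrm{Int}_n(\mathbf{F})=\inf_Q\sup_{f\in\mathbf{F}}\big|\int_{U^d}f(\mathbf{x})\mathbf{w}(\mathbf{x})\,d\mathbf{x}-Qf\big|$, the infimum over all quadratures $Qf=\sum_{i=1}^k\lambda_if(\mathbf{x}_i)$ with $k\le n$, arbitrary nodes $\mathbf{x}_i\in U^d$ (possibly repeated) and real weights $\lambda_i$. *)

(* Defs.v *)
From HB Require Import structures.
From mathcomp Require Import all_boot all_order all_algebra.
From mathcomp Require Import all_classical all_reals all_analysis.
Set Implicit Arguments. Unset Strict Implicit. Unset Printing Implicit Defensive.
Import Order.TTheory GRing.Theory Num.Theory.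
Import numFieldNormedType.Exports.
Local Open Scope classical_set_scope.
Local Open Scope ring_scope.

(** Points of R^d are d-tuples of reals; (d.-tuple R) carries the product
    (Borel) sigma-algebra provided by MathComp-Analysis. *)

Definition cube (R : realType) (d : nat) (U : set R) : set (d.-tuple R) :=
  [set t | forall i : 'I_d, U (tnth t i)].
Arguments cube {R} d U.

(** Iterated Lebesgue integral over D^n of a function of n real variables
    (given as a function on sequences); by Fubini--Tonelli this is the
    integral w.r.t. n-dimensional Lebesgue measure for measurable
    nonnegative or integrable functions. *)
Fixpoint iint (R : realType) (D : set R) (n : nat) (F : seq R -> \bar R) : \bar R :=
  match n with
  | 0 => F [::]
  | n'.+1 => (\int[@lebesgue_measure R]_(x in D) iint D n' (fun s => F (x :: s)))%E
  end.

Definition intD (R : realType) (d : nat) (D : set R) (F : d.-tuple R -> \bar R) : \bar R :=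
  iint D d (fun s => F (insubd [tuple of nseq d 0] s)).

Definition w1 (R : realType) (alpha : R) (r : nat) (x : R) : R :=
  (`|x| `^ (alpha + r%:R / 2)) * expR (- `|x|).

Definition wd (R : realType) (d : nat) (alpha : R) (r : nat) (t : d.-tuple R) : R :=
  \prod_(i < d) w1 alpha r (tnth t i).

Definition shift (R : realType) (d : nat) (t : d.-tuple R) (i : 'I_d) (h : R) : d.-tuple R :=
  [tuple tnth t j + (if j == i then h else 0) | j < d].

Definition pd (R : realType) (d : nat) (g : d.-tuple R -> R) (i : 'I_d) : d.-tuple R -> R :=
  fun t => derive1 (fun h => g (shift t i h)) 0.

Definition contOn (R : realType) (d : nat) (A : set (d.-tuple R)) (g : d.-tuple R -> R) :=
  forall t, A t -> forall e : R, 0 < e -> exists2 del : R, 0 < del &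
    forall s, A s -> (forall i, `|tnth s i - tnth t i| < del) -> `|g s - g t| < e.

Definition smooth (R : realType) (d : nat) (g : d.-tuple R -> R) :=
  forall s : seq 'I_d, let h := foldr (fun i h => pd h i) g s in
    (forall (i : 'I_d) (t : d.-tuple R), derivable (fun x => h (shift t i x)) 0 1)
    /\ contOn setT h.

(** test functions: C^infinity with compact support contained in U^d
    (for an interval U, a compact subset of U^d lies in a box [a,b]^d in U^d) *)
Definition test_fun (R : realType) (d : nat) (U : set R) (phi : d.-tuple R -> R) :=
  smooth phi /\ exists a b : R, `[a, b] `<=` U /\
    forall t, (exists i : 'I_d, ~ (a <= tnth t i <= b)) -> phi t = 0.

Definition Dk (R : realType) (d : nat) (k : 'I_d -> nat) (phi : d.-tuple R -> R) :=
  foldr (fun i g => iter (k i) (fun g => pd g i) g) phi (enum 'I_d).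

Definition weak_deriv (R : realType) (d : nat) (U : set R) (k : 'I_d -> nat)
    (f g : d.-tuple R -> R) :=
  measurable_fun (cube d U) g /\
  (forall a b : R, `[a, b] `<=` U ->
     (intD `[a, b] (fun t => (`|g t|)%:E) < +oo)%E) /\
  forall phi, test_fun U phi ->
    intD U (fun t => (f t * Dk k phi t)%:E) =
    ((-1) ^+ (\sum_(i < d) k i) * intD U (fun t => (g t * phi t)%:E))%E.

(** unit ball of W^r_{1,w_r}(U^d), elements identified with their continuous
    representatives: f continuous on U^d and weak derivatives D^k f,
    |k|_oo <= r, with sum_k ||D^k f||_{L_{1,w_r}} <= 1 *)
Definition sobolev_ball (R : realType) (d : nat) (U : set R) (alpha : R) (r : nat)
    (f : d.-tuple R -> R) :=
  contOn (cube d U) f /\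
  exists g : {ffun 'I_d -> 'I_r.+1} -> d.-tuple R -> R,
    (forall k : {ffun 'I_d -> 'I_r.+1}, weak_deriv U (fun i => nat_of_ord (k i)) f (g k)) /\
    (\sum_(k : {ffun 'I_d -> 'I_r.+1})
        intD U (fun t => (`|g k t| * wd alpha r t)%:E) <= 1)%E.

Definition quad_err (R : realType) (d : nat) (U : set R) (alpha : R)
    (F : set (d.-tuple R -> R)) (Q : seq (R * d.-tuple R)) : \bar R :=
  ereal_sup [set (`| intD U (fun t => (f t * wd alpha 0 t)%:E)
                     - (\sum_(p <- Q) p.1 * f p.2)%:E |)%E | f in F].

Definition Int_n (R : realType) (d : nat) (U : set R) (alpha : R) (n : nat)
    (F : set (d.-tuple R -> R)) : \bar R :=
  ereal_inf [set quad_err U alpha F Q | Q in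
    [set Q : seq (R * d.-tuple R) | (size Q <= n)%N /\
       forall p, p \in Q -> cube d U p.2]].
Arguments sobolev_ball {R} d U alpha r f.
Arguments Int_n {R} d U alpha n F.

(* Main.v *)
(** The upper bound comes from a Smolyak quadrature. On the half-line, level k
    interpolates by polynomials of degree less than r on the 2^(k-1) cells
    [j^2/N, (j+1)^2/N), N = 2^(k-1), and by 0 beyond N; on the line the nodes are
    reflected. Cells of that shape turn the local error, an integral of the r-th
    derivative against a kernel of size (cell width)^(r-1), into one whose
    w_0-integral in the evaluation point is at most C 2^(-kr/2) w_r. Mollifying
    the evaluation functionals makes this a statement about weak derivatives and
    tensorises it: the error of a tensor product of one-dimensional errors is
    bounded by the mixed derivatives integrated against the product of the
    kernels. Telescoping the levels in each variable writes the Smolyak error as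
    O(m^(d-1)) such tensor terms, each O(2^(-mr/2)), with O(m^(d-1) 2^m) nodes.

    For the lower bound, among the n+1 unit boxes (j, j+1) x (1, 2)^(d-1) one
    contains no node, and a normalised bump there has w_0-integral at least
    c n^(-r/2), which dominates n^(-3r/4) times any power of log n. *)
From HB Require Import structures.
From mathcomp Require Import all_boot all_order all_algebra.
From mathcomp Require Import all_classical all_reals all_analysis.
From mathcomp Require Import measurable_realfun.
From mathcomp Require Import ring lra zify.
Require Import Defs.
Set Implicit Arguments. Unset Strict Implicit. Unset Printing Implicit Defensive.
Import Order.TTheory GRing.Theory Num.Theory.
Import numFieldNormedType.Exports.
Local Open Scope classical_set_scope.
Local Open Scope ring_scope.

(** A function of the ball has only weak derivatives, so no pointwise Taylor formula is available:
    the upper bound differentiates test functions only, and derivatives of [f] enter through the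
    defining identity of weak derivatives. The kernels that dominate the test functions do not
    depend on the width of the mollifier, so continuity of [f] alone removes the mollification.

    The ratio [w_r / w_0 = y^(r/2)] shapes the one-dimensional kernels. Near [0] the [w_0]-integral
    of a kernel in [x] has to be [O(y^(alpha + r/2))]. This is the reason for the quadratic cells,
    for nodes at a fixed fraction of a cell, and for a separate treatment of level [0], whose error
    is plain evaluation: the unit-interval kernel of an evaluation violates the requirement when
    [r > 2]. Beyond [N] the ratio is at least [N^(r/2)], so giving up interpolation there costs
    nothing. The assumption [alpha > -1] enters through integrals of [x^alpha] near [0].

    The integrals of the statement are iterated ones. A sigma-finite measure on tuples is put behind
    them, so that Fubini and Tonelli apply. *)

Section tuple_measure.
Context {R : realType}.
Local Open Scope ereal_scope.
Local Notation mR := (measurableTypeR R).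

(** * Lebesgue measure on tuples and its agreement with iterated integrals *)

Definition leb : {sigma_finite_measure set mR -> \bar R} := @lebesgue_measure R.

Definition uncons d (t : d.+1.-tuple mR) : mR * d.-tuple mR :=
  (thead t, [tuple of behead t]).
Definition tcons d (p : mR * d.-tuple mR) : d.+1.-tuple mR := [tuple of p.1 :: p.2].

Lemma tconsK d : cancel (@tcons d) (@uncons d).
Proof.
case=> x t; rewrite /uncons /tcons /= theadE; congr (_, _).
by apply/val_inj.
Qed.

Lemma unconsK d : cancel (@uncons d) (@tcons d).
Proof. by move=> t; rewrite /uncons /tcons /= -tuple_eta. Qed.

Lemma measurable_tcons d : measurable_fun setT (@tcons d).
Proof. by apply: measurable_cons. Qed.

Lemma measurable_uncons d : measurable_fun setT (@uncons d).
Proof.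
apply/measurable_fun_pairP; split.
  exact: (measurable_tnth ord0).
exact: measurable_behead.
Qed.

Section cons_measure.
Variables (d : nat) (mu : {sigma_finite_measure set (d.-tuple mR) -> \bar R}).

Definition mucons := pushforward (leb \x mu) (@tcons d).

HB.instance Definition _ := Measure.copy mucons
  (measure_function_pushforward__canonical__measure_function_Measure (leb \x mu) (@measurable_tcons d)).

Let mucons_sf : sigma_finite setT mucons.
Proof.
have /sigma_finiteP[F [TF ndF Foo]] := sigma_finiteT leb.
have /sigma_finiteP[G [TG ndG Goo]] := sigma_finiteT mu.
exists (fun n => @uncons d @^-1` (F n `*` G n)).
  rewrite predeqE => t; split=> // _.
  have [n _ Fn] : (\bigcup_n F n) (uncons t).1 by rewrite -TF.
  have [k _ Gk] : (\bigcup_n G n) (uncons t).2 by rewrite -TG.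
  exists (maxn n k) => //; split.
    by move: (uncons t).1 Fn; exact/subsetPset/ndF/leq_maxl.
  by move: (uncons t).2 Gk; exact/subsetPset/ndG/leq_maxr.
move=> k; have [? ?] := Foo k; have [? ?] := Goo k; split.
  by rewrite -[X in measurable X]setTI; apply: measurable_uncons => //; exact: measurableX.
rewrite /mucons /pushforward -comp_preimage (_ : _ \o _ = id); last first.
  by apply/funext => x /=; rewrite tconsK.
by rewrite preimage_id product_measure1E// lte_mul_pinfty// ge0_fin_numE.
Qed.
HB.instance Definition _ := Measure_isSigmaFinite.Build _ _ _ mucons mucons_sf.

Lemma ge0_integral_mucons (F : d.+1.-tuple mR -> \bar R) :
  measurable_fun [set: d.+1.-tuple mR] F -> (forall t, 0 <= F t) ->
  \int[mucons]_t F t = \int[leb]_x \int[mu]_t F (tcons (x, t)).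
Proof.
move=> mF F0; rewrite /mucons.
rewrite ge0_integral_pushforward//; last exact: measurable_tcons.
rewrite preimage_setT fubini_tonelli1//; last by move=> x; exact: F0.
exact: (measurableT_comp mF (@measurable_tcons d)).
Qed.

Lemma integrable_mucons (F : d.+1.-tuple mR -> \bar R) :
  mucons.-integrable setT F -> (leb \x mu).-integrable setT (F \o @tcons d).
Proof.
move=> /integrableP[mF iF]; apply/integrableP; split.
  exact: (measurableT_comp mF (@measurable_tcons d)).
rewrite ge0_integral_mucons// in iF; last exact: measurableT_comp.
rewrite fubini_tonelli1//.
by apply: measurableT_comp => //; exact: (measurableT_comp mF (@measurable_tcons d)).
Qed.

Lemma integral_mucons (F : d.+1.-tuple mR -> \bar R) :
  mucons.-integrable setT F ->
  \int[mucons]_t F t = \int[leb]_x \int[mu]_t F (tcons (x, t)).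
Proof.
move=> iF; rewrite /mucons integral_pushforward//; last first.
- by rewrite preimage_setT; exact: integrable_mucons.
- exact: measurable_int iF.
- exact: measurable_tcons.
by rewrite preimage_setT -integral12_prod_meas1//; exact: integrable_mucons.
Qed.

End cons_measure.

(** The recursion is that of [iint]: in an induction on [d], one use of Fubini or Tonelli matches
    one unfolding of the iterated integral. *)
Fixpoint muT d : {sigma_finite_measure set (d.-tuple mR) -> \bar R} :=
  match d with
  | 0 => @dirac _ (0.-tuple mR) [tuple] R
  | d'.+1 => mucons (muT d')
  end.

(** Measurability is not assumed: the integral is a difference of suprema over simple functions
    below the positive and the negative part, and both suprema are monotone. Inner integrals of
    [intD] can therefore be compared freely. *)
Lemma integral_mono dd (T : measurableType dd) (nu : {measure set T -> \bar R})
    (D : set T) (F G : T -> \bar R) :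
  (forall x, D x -> F x <= G x) -> \int[nu]_(x in D) F x <= \int[nu]_(x in D) G x.
Proof.
move=> FG; have FG' x : (F \_ D) x <= (G \_ D) x by exact: lee_restrict.
rewrite /integral; apply: leeB.
  apply: ereal_sup_le => _ [h /= hF <-]; exists h => //= x.
  apply: le_trans (hF x) _; apply: (@funepos_le _ _ setT (F \_ D)); last exact: in_setT.
  by move=> ? _.
apply: ereal_sup_le => _ [h /= hF <-]; exists h => //= x.
apply: le_trans (hF x) _; apply: (@funeneg_le _ _ setT (F \_ D)); last exact: in_setT.
by move=> ? _.
Qed.

(** [F] may fail to be measurable on the null set [N]. It is squeezed between the modifications of
    [G] by [-oo] and [+oo] on [N], which are measurable and have the same integral as [G]. *)
Lemma integral_ae_eq dd (T : measurableType dd) (nu : {measure set T -> \bar R})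
    (F G : T -> \bar R) (N : set T) : measurable N -> nu N = 0 -> measurable_fun [set: T] G ->
  (forall x, ~ N x -> F x = G x) -> \int[nu]_x F x = \int[nu]_x G x.
Proof.
move=> mN N0 mG FG.
pose P (y : \bar R) x := if x \in N then y else G x.
have mP y : measurable_fun setT (P y).
  apply: measurable_fun_ifT => //; apply: (measurable_fun_bool true).
  by rewrite setTI (_ : _ @^-1` _ = N)//; apply/seteqP; split=> x /=; [exact: set_mem|exact: mem_set].
have PG y : \int[nu]_x P y x = \int[nu]_x G x.
  apply: ae_eq_integral => //; exists N; split=> // x /= Hx.
  apply: contrapT => Nx; apply: Hx => _; rewrite /P memNset//.
apply/eqP; rewrite eq_le -{1}(PG +oo) -(PG -oo); apply/andP; split.
  apply: integral_mono => x _; rewrite /P; case: ifPn => [_|]; first by rewrite leey.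
  by rewrite notin_setE => /FG ->.
apply: integral_mono => x _; rewrite /P; case: ifPn => [_|]; first by rewrite leNye.
by rewrite notin_setE => /FG ->.
Qed.

Lemma iint_ext (D : set R) n (F G : seq R -> \bar R) :
  (forall s, size s = n -> (forall x, x \in s -> D x) -> F s = G s) -> iint D n F = iint D n G.
Proof.
elim: n F G => [|n IH] F G FG /=; first exact: FG.
apply: eq_integral => x /[!inE] Dx; apply: IH => s sn sD; apply: FG => /=; first by rewrite sn.
by move=> y; rewrite inE => /predU1P[->//|]; exact: sD.
Qed.

Lemma intD_ext d (D : set R) (F G : d.-tuple R -> \bar R) :
  (forall t, cube d D t -> F t = G t) -> intD D F = intD D G.
Proof.
move=> FG; apply: iint_ext => s sd sD; apply: FG => i.
apply: sD; rewrite (tnth_nth 0%R) val_insubd sd eqxx; apply: mem_nth.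
by rewrite sd.
Qed.

Lemma intD0 (D : set R) (F : 0.-tuple R -> \bar R) : intD D F = F [tuple].
Proof. by rewrite /intD /=; congr F; rewrite tuple0. Qed.

Lemma intDS d (D : set R) (F : d.+1.-tuple R -> \bar R) :
  intD D F = \int[leb]_(x in D) intD D (fun t => F (tcons (x, t))).
Proof.
rewrite /intD /=; apply: eq_integral => x _; apply: iint_ext => s sd _.
congr F; apply/val_inj => /=.
by rewrite !val_insubd /= sd !eqxx.
Qed.

Lemma intD_mono d (D : set R) (F G : d.-tuple R -> \bar R) :
  (forall t, cube d D t -> F t <= G t) -> intD D F <= intD D G.
Proof.
elim: d F G => [|d IH] F G FG.
  by rewrite !intD0; apply: FG; case.
rewrite !intDS; apply: integral_mono => x Dx; apply: IH => t Dt; apply: FG => i.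
by case: (unliftP ord0 i) => [j ->|->]; rewrite /tcons ?tnth0 // tnthS.
Qed.

Lemma cube_tcons d (D : set R) x (t : d.-tuple R) :
  cube d.+1 D (tcons (x, t)) <-> D x /\ cube d D t.
Proof.
split=> [H|[Dx Dt] i].
  split; first by have := H ord0; rewrite /tcons tnth0.
  by move=> i; have := H (lift ord0 i); rewrite /tcons tnthS.
by case: (unliftP ord0 i) => [j ->|->]; rewrite /tcons ?tnth0 // tnthS.
Qed.

Lemma intD_mkcond d (D : set R) (F : d.-tuple R -> \bar R) :
  intD D F = intD setT (F \_ (cube d D)).
Proof.
elim: d F => [|d IH] F.
  by rewrite !intD0 /patch mem_set//; case.
rewrite !intDS integral_mkcond; apply: eq_integral => x _.
rewrite {1}/patch; case: ifPn => [/set_mem Dx|Dx].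
  rewrite IH; apply: intD_ext => t _; rewrite /patch.
  congr (if _ then _ else _); apply/idP/idP => /set_mem H; apply/mem_set.
    by apply/cube_tcons.
  by move/cube_tcons : H => [].
transitivity (intD setT (fun _ : d.-tuple R => 0 : \bar R)).
  elim: d {IH F} => [|d IH]; first by rewrite intD0.
  by rewrite intDS integral0_eq// => y _; rewrite -IH.
apply: intD_ext => t _; rewrite /patch memNset// => /cube_tcons[/mem_set Dx'].
by rewrite Dx' in Dx.
Qed.

Lemma measurable_slice d (F : d.+1.-tuple mR -> \bar R) x :
  measurable_fun setT F -> measurable_fun [set: d.-tuple mR] (fun t => F (tcons (x, t))).
Proof.
move=> mF; apply: (measurableT_comp mF).
exact: (measurableT_comp (@measurable_tcons d) (measurable_pair1 _)).
Qed.

Lemma intDT_ge0E d (F : d.-tuple mR -> \bar R) : measurable_fun setT F ->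
  (forall t, 0 <= F t) -> intD setT F = \int[muT d]_t F t.
Proof.
elim: d F => [|d IH] F mF F0.
  by rewrite intD0 /= integral_dirac// diracE in_setT mul1e.
rewrite intDS /= ge0_integral_mucons//; apply: eq_integral => x _.
by rewrite IH//; exact: measurable_slice.
Qed.

(** Slices are integrable only for almost every [x], so the induction hypothesis holds off a null
    set. On that set the iterated integral has an uncontrolled value, which [integral_ae_eq]
    tolerates. *)
Lemma intDT_integrableE d (F : d.-tuple mR -> \bar R) : (muT d).-integrable setT F ->
  intD setT F = \int[muT d]_t F t.
Proof.
elim: d F => [|d IH] F iF.
  by rewrite intD0 /= integral_dirac ?diracE ?in_setT ?mul1e//; exact: measurable_int iF.
rewrite intDS /= integral_mucons//.
have iF2 := integrable_mucons iF.
have [N [mN N0 NF]] := ae_integrable1 iF2.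
apply: (integral_ae_eq mN N0); first exact: (measurable_fubini_F iF2).
by move=> x Nx; apply: IH; apply: contrapT => H; apply/Nx/NF.
Qed.

Lemma measurable_cube d (D : set mR) : measurable D -> measurable (cube d D : set (d.-tuple mR)).
Proof.
move=> mD; rewrite (_ : cube d D = \bigcap_(i : 'I_d) ((@tnth _ _ ^~ i) @^-1` D)); last first.
  by apply/seteqP; split=> t H i => [_|]; apply: H.
apply: fin_bigcap_measurable; first exact: finite_finset.
by move=> i _; rewrite -[X in measurable X]setTI; exact: measurable_tnth.
Qed.

Lemma intD_ge0E d (D : set mR) (F : d.-tuple mR -> \bar R) : measurable D ->
  measurable_fun (cube d D) F -> (forall t, cube d D t -> 0 <= F t) ->
  intD D F = \int[muT d]_(t in cube d D) F t.
Proof.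
move=> mD mF F0; rewrite intD_mkcond intDT_ge0E//.
- by rewrite [RHS]integral_mkcond.
- by apply/(measurable_restrictT _ _).1 => //; exact: measurable_cube.
- exact: erestrict_ge0.
Qed.

Lemma intD_integrableE d (D : set mR) (F : d.-tuple mR -> \bar R) : measurable D ->
  (muT d).-integrable (cube d D) F ->
  intD D F = \int[muT d]_(t in cube d D) F t.
Proof.
move=> mD iF; rewrite intD_mkcond intDT_integrableE//.
  by rewrite [RHS]integral_mkcond.
by apply/(integrable_mkcond _ _).1 => //; exact: measurable_cube.
Qed.

Lemma measurable_abse_comp dd (T : measurableType dd) (D : set T) (f : T -> \bar R) :
  measurable_fun D f -> measurable_fun D (fun x => `|f x|).
Proof. by move=> mf; apply: measurableT_comp mf. Qed.

Lemma measurable_tprod d (F : 'I_d -> mR -> R) :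
  (forall i, measurable_fun [set: mR] (F i)) ->
  measurable_fun [set: d.-tuple mR] (fun t : d.-tuple mR => \prod_(i < d) F i (tnth t i))%R.
Proof.
move=> mF; apply: measurable_prod => i _.
exact: (measurableT_comp (mF i) (measurable_tnth i)).
Qed.

Lemma integral_tprodT d (F : 'I_d -> mR -> R) :
  (forall i, leb.-integrable setT (EFin \o F i)) ->
  (muT d).-integrable setT (fun t => (\prod_(i < d) F i (tnth t i))%:E) /\
  \int[muT d]_t (\prod_(i < d) F i (tnth t i))%:E =
  (\prod_(i < d) \int[leb]_x F i x)%:E.
Proof.
elim: d F => [|d IH] F iF.
  have mF : measurable_fun [set: 0.-tuple mR]
      (fun t : 0.-tuple mR => (\prod_(i < 0) F i (tnth t i))%:E).
    by under eq_fun do rewrite big_ord0; exact: measurable_cst.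
  split; last by rewrite /= integral_dirac// diracE in_setT mul1e !big_ord0.
  apply/integrableP; split=> //.
  rewrite /= integral_dirac//; first by rewrite diracE in_setT mul1e ltry.
  exact: (measurableT_comp (@abse_measurable _ _) mF).
have mF i : measurable_fun setT (F i) by apply/measurable_EFinP; exact: measurable_int (iF i).
have [iG EG] := IH (fun i => F (lift ord0 i)) (fun i => iF _).
have FE (x : mR) (t : d.-tuple mR) : (\prod_(i < d.+1) F i (tnth (tcons (x, t)) i) =
    F ord0 x * \prod_(i < d) F (lift ord0 i) (tnth t i))%R.
  by rewrite big_ord_recl /tcons tnth0; under eq_bigr do rewrite tnthS.
have iP : (muT d.+1).-integrable setT (fun t => (\prod_(i < d.+1) F i (tnth t i))%:E).
  have mP := measurable_tprod mF.
  apply/integrableP; split; first exact/measurable_EFinP.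
  rewrite (@ge0_integral_mucons d (muT d))//; last exact/measurable_abse_comp/measurable_EFinP.
  under eq_integral => x _.
    under eq_integral => t _ do rewrite FE EFinM abseM.
    rewrite ge0_integralZl//; last first.
      exact: measurable_abse_comp (measurable_int _ iG).
    over.
  rewrite ge0_integralZr//; last 2 first.
  - exact/measurable_abse_comp/measurable_EFinP.
  - exact: integral_ge0.
  apply: lte_mul_pinfty; first exact: integral_ge0.
    by apply/fin_numPlt/andP; split; [apply: lt_le_trans (integral_ge0 _ _) => // | have /integrableP[] := iF ord0].
  by have /integrableP[] := iG.
split=> //; rewrite /= integral_mucons//.
under eq_integral => x _.
  under eq_integral => t _ do rewrite FE EFinM.
  rewrite integralZl// EG.
  over.
rewrite integralZr//; last exact: iF.
rewrite big_ord_recl EFinM; congr *%E.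
by rewrite /Rintegral fineK//; exact: (integrable_fin_num measurableT (iF ord0)).
Qed.

Lemma integral_tprod d (D : set mR) (F : 'I_d -> mR -> R) : measurable D ->
  (forall i, leb.-integrable D (EFin \o F i)) ->
  (muT d).-integrable (cube d D) (fun t => (\prod_(i < d) F i (tnth t i))%:E) /\
  \int[muT d]_(t in cube d D) (\prod_(i < d) F i (tnth t i))%:E =
  (\prod_(i < d) \int[leb]_(x in D) F i x)%:E.
Proof.
move=> mD iF.
have E : (fun t : d.-tuple mR => (\prod_(i < d) F i (tnth t i))%:E) \_ (cube d D) =
   (fun t => (\prod_(i < d) (F i \_ D) (tnth t i))%:E).
  apply/funext => t; rewrite /patch; case: ifPn => [/set_mem Dt|].
    by congr EFin; apply: eq_bigr => i _; rewrite mem_set.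
  rewrite notin_setE => /existsNP[i Di].
  by rewrite (bigD1 i)//= memNset// mul0r.
have iF' i : leb.-integrable setT (EFin \o (F i \_ D)).
  by have := iF i; rewrite (integrable_mkcond _ mD) restrict_EFin.
have [iP EP] := integral_tprodT iF'.
split.
  by rewrite (integrable_mkcond _ (measurable_cube mD)) E.
rewrite integral_mkcond E EP; congr EFin; apply: eq_bigr => i _.
by rewrite [RHS]Rintegral_mkcond.
Qed.
End tuple_measure.

(** * Smooth functions of one real variable *)

Section coo.
Context {R : realType}.
Implicit Types (f g h : R -> R) (x y : R).

Definition Coo f := forall n x, derivable (iter n (@derive1 R R) f) x 1.

Lemma is_derive1E f x : derivable f x 1 -> is_derive x 1 f (f^`()%classic x).
Proof. by move=> df; rewrite derive1E; exact: derivableP. Qed.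

Lemma derive1_eq f g : (forall x, is_derive x 1 f (g x)) -> f^`()%classic = g.
Proof. by move=> fg; apply/funext => x; rewrite derive1E; exact: derive_val. Qed.

(** Coinduction: to get smoothness without a formula for the [n]-th derivative, it is enough to find
    a class of functions that is closed under derivation. *)
Lemma Coo_coind (S : (R -> R) -> Prop) :
  (forall g, S g -> exists2 g', S g' & forall x, is_derive x 1 g (g' x)) ->
  forall f, S f -> Coo f.
Proof.
move=> HS f Sf n; suff : S (iter n (@derive1 R R) f).
  by move=> /HS[g' _ H] x; apply: ex_derive.
elim: n => //= n /HS[g' Sg' H].
by rewrite (derive1_eq H).
Qed.

Lemma Coo_deriv f : Coo f -> Coo f^`()%classic.
Proof. by move=> cf n x; have := cf n.+1 x; rewrite iterSr. Qed.

Lemma Coo_iter f n : Coo f -> Coo (iter n (@derive1 R R) f).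
Proof. by move=> cf; elim: n => //= n; exact: Coo_deriv. Qed.

Lemma Coo_is_derive f x : Coo f -> is_derive x 1 f (f^`()%classic x).
Proof. by move=> cf; apply: is_derive1E; exact: (cf 0). Qed.

Lemma Coo_continuous f : Coo f -> continuous f.
Proof. by move=> cf x; apply/differentiable_continuous/derivable1_diffP; exact: (cf 0). Qed.

Lemma Coo_prim f g : Coo g -> (forall x, is_derive x 1 f (g x)) -> Coo f.
Proof.
move=> cg fg [|n] x; first by apply: ex_derive.
by rewrite iterSr (derive1_eq fg); exact: cg.
Qed.

Lemma Coo_cst c : Coo (fun=> c).
Proof.
apply: (@Coo_coind (fun g => exists c, g = fun=> c)); last by exists c.
by move=> _ [k ->]; exists (fun=> 0); [exists 0|move=> x; exact: is_derive_cst].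
Qed.

Lemma CooD f g : Coo f -> Coo g -> Coo (fun x => f x + g x).
Proof.
move=> cf cg; apply: (@Coo_coind (fun h => exists f g, [/\ Coo f, Coo g & h = f \+ g])); last by exists f, g.
move=> _ [f1 [g1 [cf1 cg1 ->]]]; exists (f1^`()%classic \+ g1^`()%classic).
  by exists f1^`()%classic, g1^`()%classic; split=> //; exact: Coo_deriv.
by move=> x; apply: is_deriveD; exact: Coo_is_derive.
Qed.

Lemma CooM f g : Coo f -> Coo g -> Coo (fun x => f x * g x).
Proof.
(* By the Leibniz rule finite sums of products of smooth functions are closed under derivation;
   single products are not. *)
pose S h := exists s : seq ((R -> R) * (R -> R)),
  (forall p, List.In p s -> Coo p.1 /\ Coo p.2) /\ h = fun x => \sum_(p <- s) p.1 x * p.2 x.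
move=> cf cg; apply: (@Coo_coind S); last first.
  by exists [:: (f, g)]; split; [move=> p /= [<-|//]|apply/funext => x; rewrite big_seq1].
move=> _ [s [Hs ->]].
exists (fun x => \sum_(p <- s) (p.1^`()%classic x * p.2 x + p.1 x * p.2^`()%classic x)); last first.
  move=> x; elim: s Hs => [|p s IH] Hs.
    under eq_fun do rewrite big_nil; rewrite big_nil; exact: is_derive_cst.
  under eq_fun do rewrite big_cons; rewrite big_cons.
  have [c1 c2] := Hs p (or_introl erefl).
  apply: is_deriveD; last by apply: IH => q qs; apply: Hs; right.
  apply: (is_derive_eq (is_deriveM (Coo_is_derive x c1) (Coo_is_derive x c2))).
  by rewrite addrC /GRing.scale /= mulrC.
elim: s Hs => [|p s IH] Hs.
  by exists [::]; split=> //; apply/funext => x; rewrite !big_nil.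
have [q qs|t [Ht Et]] := IH; first by apply: Hs; right.
have [c1 c2] := Hs p (or_introl erefl).
exists [:: (p.1^`()%classic, p.2), (p.1, p.2^`()%classic) & t]; split.
  by move=> q /= [<-|[<-|/Ht//]] /=; split=> //; exact: Coo_deriv.
by apply/funext => x; rewrite !big_cons addrA; congr (_ + _); have /(congr1 (@^~ x)) := Et.
Qed.

Lemma is_derive_affine f a b x df : is_derive (a * x + b) 1 f df ->
  is_derive x 1 (fun x => f (a * x + b)) (a * df).
Proof.
move=> H; have A : is_derive x 1 (fun x => a * x + b) a.
  apply: (is_derive_eq (is_deriveD (is_deriveZ a (is_derive_id x 1)) (is_derive_cst b x 1))).
  by rewrite addr0 /GRing.scale /= mulr1.
by have := @is_derive1_comp _ f (fun x => a * x + b) x _ _ H A; rewrite mulrC.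
Qed.

Lemma Coo_affine f a b : Coo f -> Coo (fun x => f (a * x + b)).
Proof.
move=> cf; apply: (@Coo_coind (fun h => exists c f, Coo f /\ h = fun x => c * f (a * x + b))); last first.
  by exists 1, f; split=> //; apply/funext => x; rewrite mul1r.
move=> _ [c [g [cg ->]]]; exists (fun x => (c * a) * g^`()%classic (a * x + b)).
  by exists (c * a), g^`()%classic; split=> //; exact: Coo_deriv.
move=> x; rewrite -mulrA.
apply: is_deriveZ; exact/is_derive_affine/Coo_is_derive.
Qed.

Lemma CooZ c f : Coo f -> Coo (fun x => c * f x).
Proof. by move=> cf; apply: CooM => //; exact: Coo_cst. Qed.

Lemma Coo_sum (I : Type) (s : seq I) (F : I -> R -> R) : (forall i, Coo (F i)) ->
  Coo (fun x => \sum_(i <- s) F i x).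
Proof.
move=> cF; elim: s => [|i s IH].
  under eq_fun do rewrite big_nil; exact: Coo_cst.
by under eq_fun do rewrite big_cons; exact: CooD.
Qed.

Lemma iter_deriveD f g n : Coo f -> Coo g ->
  iter n (@derive1 R R) (fun x => f x + g x) = fun x => iter n (@derive1 R R) f x + iter n (@derive1 R R) g x.
Proof.
move=> cf cg; elim: n => //= n ->; apply: derive1_eq => x.
by apply: is_deriveD; apply: Coo_is_derive; exact: Coo_iter.
Qed.

Lemma iter_deriveZ c f n : Coo f ->
  iter n (@derive1 R R) (fun x => c * f x) = fun x => c * iter n (@derive1 R R) f x.
Proof.
move=> cf; elim: n => //= n ->; apply: derive1_eq => x.
by apply: is_deriveZ; apply: Coo_is_derive; exact: Coo_iter.
Qed.

Lemma iter_derive_affine f a b n : Coo f ->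
  iter n (@derive1 R R) (fun x => f (a * x + b)) = fun x => a ^+ n * iter n (@derive1 R R) f (a * x + b).
Proof.
move=> cf; elim: n => [|n IH] /=; first by apply/funext => x; rewrite mul1r.
rewrite IH; apply: derive1_eq => x; rewrite exprSr -mulrA.
apply: is_deriveZ; apply: is_derive_affine; apply: Coo_is_derive; exact: Coo_iter.
Qed.

Lemma iter_derive_sum (I : Type) (s : seq I) (c : I -> R) (F : I -> R -> R) n : (forall i, Coo (F i)) ->
  iter n (@derive1 R R) (fun x => \sum_(i <- s) c i * F i x) =
  fun x => \sum_(i <- s) c i * iter n (@derive1 R R) (F i) x.
Proof.
move=> cF; elim: s => [|i s IH].
  under eq_fun do rewrite big_nil; under [RHS]eq_fun do rewrite big_nil.
  by elim: n => //= n ->; apply: derive1_eq => x; exact: is_derive_cst.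
under eq_fun do rewrite big_cons.
rewrite (@iter_deriveD (fun x => c i * F i x)) ?iter_deriveZ ?IH; [|by []|exact: CooZ|].
  by under [RHS]eq_fun do rewrite big_cons.
by apply: Coo_sum => j; exact: CooZ.
Qed.

End coo.

(** * The flat function at the origin *)

Section bump.
Context {R : realType}.
Implicit Types (f g h : R -> R) (x y : R).

Lemma is_derive_horner (p : {poly R}) x : is_derive x 1 (horner p) p^`().[x].
Proof.
elim/poly_ind: p => [|p c IH].
  rewrite (_ : horner 0 = fun=> 0); last by apply/funext => y; rewrite horner0.
  by rewrite deriv0 horner0; exact: is_derive_cst.
rewrite (_ : horner _ = (horner p \* id) \+ (fun=> c)); last first.
  by apply/funext => y; rewrite hornerD hornerM hornerX hornerC.
have D := is_deriveD (is_deriveM IH (is_derive_id x 1)) (is_derive_cst c x 1).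
apply: (is_derive_eq D).
rewrite derivD derivM derivX derivC !hornerE /GRing.scale /=; ring.
Qed.

(* The derivatives of [exp (- 1 / x)] are the functions [p (1 / x) exp (- 1 / x)],
   with [p] iterated through [flat_step]. *)
Definition flat (p : {poly R}) x := if 0 < x then p.[x^-1] * expR (- x^-1) else 0.
Definition flat_step (p : {poly R}) : {poly R} := 'X^2 * (p - p^`()).

Lemma is_derive_quadratic f C : (forall x, `|x| <= 1 -> `|f x| <= C * x ^+ 2) ->
  is_derive (0 : R) 1 f 0.
Proof.
move=> fC.
have f0 : f 0 = 0.
  by apply/normr0_eq0/le_anti; rewrite normr_ge0 (le_trans (fC 0 _))// ?normr0// expr0n mulr0.
have C0 : 0 <= C by have := fC 1; rewrite normr1 expr1n mulr1 => /(_ (lexx _)); exact: le_trans.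
have lim : (fun h : R => h^-1 *: (f (h *: 1 + 0) - f 0)) @ 0^' --> (0 : R).
  apply: (@cvg_to_0_linear _ _ C 1) => // h /andP[hN h1].
  rewrite /= f0 subr0 addr0 /GRing.scale /= mulr1 normrM normfV.
  rewrite ler_pdivrMl//; apply: le_trans (fC _ (ltW h1)) _.
  by rewrite -real_normK ?num_real// expr2 mulrCA.
by apply: DeriveDef; [apply: cvgP lim | exact: cvg_lim lim].
Qed.

(** The exponential beats every polynomial: with [u = 1/x >= 1] and [n] the size of [p],
    [|p(u)| <= A u^n] while [exp u >= u^(n+2) / (n+2)!], which leaves [A (n+2)! / u^2]. *)
Lemma flat_bound p : exists C, forall x, `|x| <= 1 -> `|flat p x| <= C * x ^+ 2.
Proof.
pose n := size p.
pose A := \sum_(i < n) `|p`_i|.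
have A0 : 0 <= A by apply: sumr_ge0.
exists (A * (n.+2)`!%:R) => x x1; rewrite /flat; case: ifPn => [x0|_]; last first.
  by rewrite normr0 mulr_ge0 ?sqr_ge0 // mulr_ge0.
have [u uE] : {u | u = x^-1} by exists x^-1.
rewrite -uE; have u1 : 1 <= u.
  by rewrite uE -invr1 lef_pV2 ?posrE// (le_trans (ler_norm x)).
have u0 : 0 < u by exact: lt_le_trans u1.
have pu : `|p.[u]| <= A * u ^+ n.
  rewrite horner_coef (le_trans (ler_norm_sum _ _ _))// mulr_suml ler_sum// => i _.
  rewrite normrM ler_wpM2l// normrX (ger0_norm (ltW u0)).
  by apply: ler_weXn2l => //; exact: ltnW (ltn_ord i).
have eu : u ^+ n.+2 / (n.+2)`!%:R <= expR u.
  by apply: le_trans (expR_ge1Dxn n.+1 (ltW u0)); rewrite lerDr.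
have f0 : 0 < (n.+2)`!%:R :> R by rewrite ltr0n fact_gt0.
rewrite normrM (ger0_norm (expR_ge0 _)) expRN.
rewrite ler_pdivrMr ?expR_gt0//; apply: le_trans pu _.
have -> : x = u^-1 by rewrite uE invrK.
rewrite -!mulrA ler_wpM2l//.
move: eu; rewrite ler_pdivrMr// [expR u * _]mulrC => eu.
by rewrite mulrCA ler_pdivlMl// mulrCA ler_pdivlMl// -!exprS.
Qed.

Lemma is_derive_flat p x : is_derive x 1 (flat p) (flat (flat_step p) x).
Proof.
have [x0|x0|->] := ltgtP x 0.
- rewrite {2}/flat ltNge (ltW x0)/=.
  apply: (@near_eq_is_derive _ _ _ (fun=> 0)).
  near=> y; rewrite /flat ifF//; apply/negbTE; rewrite -leNgt ltW//.
  by near: y; exact: lt_nbhsl.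
- rewrite {2}/flat x0.
  apply: (@near_eq_is_derive _ _ _ (fun y => p.[y^-1] * expR (- y^-1))).
    near=> y; rewrite /flat ifT//.
    by near: y; exact: lt_nbhsr.
  have xn0 : x != 0 by rewrite gt_eqF.
  have dV : is_derive x 1 (fun y => y^-1) (- x ^- 2).
    apply: (is_derive_eq (@is_deriveV R id x 1 1 xn0 (is_derive_id x 1))).
    by rewrite /GRing.scale /= mulr1.
  have dP := @is_derive1_comp _ (horner p) (fun y => y^-1) x _ _ (is_derive_horner p _) dV.
  have dN := is_deriveN dV.
  have dE := @is_derive1_comp _ expR (fun y => - y^-1) x _ _ (is_derive_expR _) dN.
  apply: (is_derive_eq (is_deriveM dP dE)).
  rewrite /flat_step /GRing.scale /= !hornerE /= -exprVn; ring.
- rewrite {2}/flat ltxx.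
  have [C HC] := flat_bound p.
  exact: is_derive_quadratic HC.
Unshelve. all: by end_near.
Qed.
End bump.

(** * Primitives and a normalised bump *)

Section primitives.
Context {R : realType}.
Implicit Types (f g h : R -> R) (x y : R).
Local Notation leb := (@lebesgue_measure R).

Lemma Rintegral_eq0 (D : set R) f : (forall x, D x -> f x = 0) -> \int[leb]_(x in D) f x = 0.
Proof.
move=> f0; rewrite /Rintegral (eq_integral (fun=> 0%E)) ?integral0//.
by move=> x /[!inE] /f0 ->.
Qed.

Lemma antideriv f : continuous f -> (forall y, y <= 0 -> f y = 0) ->
  exists F, (forall x, is_derive x 1 F (f x)) /\ (forall y, y <= 0 -> F y = 0).
Proof.
move=> cf f0; exists (fun y => \int[leb]_(t in `[-1, y]) f t).
have F0 y : y <= 0 -> \int[leb]_(t in `[-1, y]) f t = 0.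
  move=> y0; apply: Rintegral_eq0 => x /=; rewrite in_itv/= => /andP[_ xy].
  by apply: f0; exact: le_trans y0.
split=> // x; have [x0|x0] := ltP x 0.
  rewrite f0 ?ltW//; apply: (@near_eq_is_derive _ _ _ (fun=> 0)).
  by near=> y; rewrite F0// ltW//; near: y; exact: lt_nbhsl.
have xu : x < x + 1 by rewrite ltrDl.
have fi : leb.-integrable `[-1, x + 1] (EFin \o f).
  apply: continuous_compact_integrable; first exact: segment_compact.
  exact: continuous_subspaceT.
have ax : -1 < x by rewrite (lt_le_trans _ x0)// ltrN10.
have [dF EF] := continuous_FTC1_closed xu fi ax (cf x).
by rewrite -EF; exact: is_derive1E.
Unshelve. all: by end_near.
Qed.

Lemma is_derive_derivable f x df : is_derive x 1 f df -> derivable f x 1.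
Proof. by case. Qed.

Lemma is_derive_continuous f g : (forall x, is_derive x 1 f (g x)) -> continuous f.
Proof.
move=> fg x; apply/differentiable_continuous/derivable1_diffP.
exact: is_derive_derivable (fg x).
Qed.

Lemma le_derive f g x y : (forall x, is_derive x 1 f (g x)) ->
  (forall z, x < z < y -> 0 <= g z) -> x <= y -> f x <= f y.
Proof.
move=> fg g0 xy.
apply: (@ger0_derive1_le_cc _ f x y) => //.
- by move=> z; rewrite (derive1_eq fg) in_itv; exact: g0.
- exact/continuous_subspaceT/(is_derive_continuous fg).
- by rewrite in_itv/= lexx.
- by rewrite in_itv/= lexx xy.
Qed.

Lemma cst_derive f g x y : (forall x, is_derive x 1 f (g x)) ->
  (forall z, x < z < y -> g z = 0) -> x <= y -> f x = f y.
Proof.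
move=> fg g0 xy; apply/le_anti/andP; split.
  by apply: (le_derive fg) => // z /g0 ->.
rewrite -lerN2; apply: (@le_derive (fun x => - f x) (fun x => - g x)) => //.
by move=> z /g0 ->; rewrite oppr0.
Qed.

Lemma integral_primitive f F (D : set R) a b : a <= b -> continuous f ->
  (forall x, is_derive x 1 F (f x)) -> `[a, b] `<=` D -> (forall x, ~~ (a <= x <= b) -> f x = 0) ->
  (\int[leb]_(x in D) (f x)%:E = (F b - F a)%:E)%E.
Proof.
move=> ab cf fF abD f0.
have -> : (\int[leb]_(x in D) (f x)%:E = \int[leb]_(x in `[a, b]) (f x)%:E)%E.
  rewrite integral_mkcond [RHS]integral_mkcond; apply: eq_integral => x _.
  rewrite /patch; case: ifPn => xD; case: ifPn => xab => //.
    by rewrite f0//; move: xab; rewrite notin_setE /= in_itv/= => /negP.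
  by move: xab xD; rewrite inE notin_setE => /abD.
move: ab; rewrite le_eqVlt => /predU1P[->|ab].
  by rewrite set_itv1 integral_set1 subrr.
rewrite (@continuous_FTC2 _ f F _ _ ab)//.
- exact: continuous_subspaceT.
- split.
  + by move=> z _; exact: is_derive_derivable (fF z).
  + exact/cvg_at_right_filter/(is_derive_continuous fF).
  + exact/cvg_at_left_filter/(is_derive_continuous fF).
- by move=> z _; rewrite (derive1_eq fF).
Qed.

Lemma exists_bump : exists rho P : R -> R,
  [/\ Coo rho, forall x, is_derive x 1 P (rho x), forall x, 0 <= rho x,
    forall x, ~~ (0 < x < 1) -> rho x = 0 &
    (forall x, x <= 0 -> P x = 0) /\ (forall x, 1 <= x -> P x = 1)].
Proof.
have Cflat : Coo (@flat R 1).
  apply: (@Coo_coind _ (fun g => exists p, g = flat p)); last by exists 1.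
  move=> _ [p ->]; exists (flat (flat_step p)); first by eexists.
  exact: is_derive_flat.
pose b x := @flat R 1 x * flat 1 (-1 * x + 1).
have Cb : Coo b by apply: CooM => //; exact: Coo_affine.
have fl0 x : 0 <= @flat R 1 x.
  by rewrite /flat; case: ifP => // _; rewrite hornerC mul1r expR_ge0.
have b0 x : 0 <= b x by exact: mulr_ge0.
have bz x : ~~ (0 < x < 1) -> b x = 0.
  rewrite negb_and -!leNgt /b /flat => /orP[x0|x1]; first by rewrite ltNge x0/= mul0r.
  by rewrite [X in _ * X]ifF ?mulr0//; apply/negbTE; rewrite -leNgt; lra.
have [P [dP P0]] : exists F, (forall x, is_derive x 1 F (b x)) /\ (forall y, y <= 0 -> F y = 0).
  apply: antideriv; first exact: Coo_continuous.
  by move=> y y0; apply: bz; rewrite ltNge y0.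
have P1 x : 1 <= x -> P x = P 1.
  by move=> x1; apply/esym/(cst_derive dP) => // z /andP[z1 _]; apply: bz; rewrite [z < 1]ltNge ltW// andbF.
(* If [P 1 = 0], the monotone [P] is constant on [[0, 1]], so its derivative [b] vanishes on
   [(0, 1)], although [b] is positive at [1/2]. *)
have P1_gt0 : 0 < P 1.
  rewrite lt_neqAle -{2}(P0 0 (lexx _)) (le_derive dP)// andbT; apply/eqP => P10.
  have /(_ 2^-1) : forall x, 0 < x < 1 -> b x = 0.
    move=> x /andP[x0 x1].
    have PE : forall y, 0 <= y <= 1 -> P y = 0.
      move=> y /andP[y0 y1]; apply/le_anti; rewrite {1}P10 (le_derive dP)//=.
      by rewrite -{1}(P0 0 (lexx _)) (le_derive dP).
    have d0 : is_derive x 1 P 0.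
      apply: (@near_eq_is_derive _ _ _ (fun=> 0)).
      near=> y; rewrite PE//; apply/andP; split; apply/ltW; near: y.
        exact: lt_nbhsr.
      exact: lt_nbhsl.
    by have := dP x => -[_ <-]; case: d0.
  have h0 : (0 : R) < 2^-1 by rewrite invr_gt0.
  have h1 : (2^-1 : R) < 1 by rewrite invf_lt1 ?ltr1n.
  rewrite h0 h1 => /(_ isT)/eqP; rewrite /b /flat !hornerC !ifT//; last by lra.
  by rewrite !mul1r mulf_eq0 !gt_eqF ?expR_gt0.
exists (fun x => (P 1)^-1 * b x), (fun x => (P 1)^-1 * P x); split.
- exact: CooZ.
- by move=> x; have := is_deriveZ (P 1)^-1 (dP x).
- by move=> x; rewrite mulr_ge0// invr_ge0 ltW.
- by move=> x /bz ->; rewrite mulr0.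
- split=> x x1; first by rewrite (P0 x x1) mulr0.
  by rewrite (P1 x x1) mulVf ?gt_eqF.
Unshelve. all: by end_near.
Qed.

End primitives.

(** * Mollifiers and their iterated primitives *)

Section mollifiers.
Context {R : realType}.
Implicit Types (f g h : R -> R) (x y p e : R) (L : seq (R * R)) (U : set R).
Local Notation leb := (@lebesgue_measure R).
Local Notation D1 := (@derive1 R R).

Definition rho : R -> R := projT1 (cid (@exists_bump R)).
Definition step : R -> R := projT1 (cid (projT2 (cid (@exists_bump R)))).

Lemma rhoP : [/\ Coo rho, forall x, is_derive x 1 step (rho x), forall x, 0 <= rho x,
    forall x, ~~ (0 < x < 1) -> rho x = 0 &
    (forall x, x <= 0 -> step x = 0) /\ (forall x, 1 <= x -> step x = 1)].
Proof. exact: (projT2 (cid (projT2 (cid (@exists_bump R))))). Qed.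

Lemma rho_bounded : exists2 K, 0 < K & forall x, `|rho x| <= K.
Proof.
have [cr _ r0 rz _] := rhoP.
have [c _ Hc] := @EVT_max _ rho 0 1 ler01 (continuous_subspaceT (Coo_continuous cr)).
exists (rho c + 1); first by rewrite ltr_wpDl.
move=> x; rewrite ger0_norm//; have [x01|/rz ->] := boolP (0 < x < 1); last by rewrite addr_ge0.
rewrite ler_wpDr// Hc// in_itv/=.
by case/andP: x01 => /ltW -> /ltW ->.
Qed.

Lemma step01 x : 0 <= step x <= 1.
Proof.
have [_ ds r0 _ [s0 s1]] := rhoP; apply/andP; split.
  have [/s0 ->//|/ltW x0] := leP x 0.
  by rewrite -(s0 0 (lexx _)) (le_derive ds).
have [/s1 ->//|/ltW x1] := leP 1 x.
by rewrite -(s1 1 (lexx _)) (le_derive ds).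
Qed.

(* The mollifier at [p] sits on the side of [p] away from the origin, so its
   support stays in the half-line when [p] does. *)
Definition sgn p : R := if p < 0 then -1 else 1.
Definition moll e p y := e^-1 * rho (sgn p * (y - p) / e).

Lemma mollE e p y : moll e p y = e^-1 * rho ((sgn p / e) * y + (- (sgn p * p / e))).
Proof. rewrite /moll; congr (_ * rho _); ring. Qed.

Lemma Coo_moll e p : Coo (moll e p).
Proof.
have [cr _ _ _ _] := rhoP.
rewrite (funext (mollE e p)); apply: CooZ; exact: Coo_affine.
Qed.

Lemma moll_ge0 e p y : 0 < e -> 0 <= moll e p y.
Proof. by have [_ _ r0 _ _] := rhoP => e0; rewrite mulr_ge0// invr_ge0 ltW. Qed.

Lemma sgn_sq p : sgn p * sgn p = 1.
Proof. by rewrite /sgn; case: ifP => _; rewrite ?mulr1// mulrNN mulr1. Qed.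

Lemma moll_out e p y : 0 < e -> ~~ (0 < sgn p * (y - p) < e) -> moll e p y = 0.
Proof.
have [_ _ _ rz _] := rhoP => e0 H; rewrite /moll rz ?mulr0//.
by apply: contra H; rewrite ltr_pdivrMr// mul1r pmulr_lgt0 ?invr_gt0.
Qed.

Lemma integral_moll e p (D : set R) : 0 < e ->
  (forall y, 0 <= sgn p * (y - p) <= e -> D y) ->
  (\int[leb]_(y in D) (moll e p y)%:E = 1)%E.
Proof.
move=> e0 HD; have [_ ds _ _ [s0 s1]] := rhoP.
have dF x : is_derive x 1 (fun y => sgn p * step ((sgn p / e) * y + (- (sgn p * p / e)))) (moll e p x).
  have := is_deriveZ (sgn p) (is_derive_affine (ds ((sgn p / e) * x + (- (sgn p * p / e))))).
  by move=> H; apply: (is_derive_eq H); rewrite /GRing.scale /= mulrA mulrA sgn_sq mul1r mollE.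
have E y : (sgn p / e) * y + (- (sgn p * p / e)) = sgn p * (y - p) / e by ring.
have ee : e / e = 1 by rewrite divff// gt_eqF.
have sE : sgn p = -1 /\ p < 0 \/ sgn p = 1.
  by rewrite /sgn; case: ifP; [left|right].
case: sE => [[sE _]|sE].
  rewrite (integral_primitive (F := _) (a := p - e) (b := p) _ _ dF).
  - rewrite !E sE subrr mulr0 mul0r s0//.
    have -> : -1 * (p - e - p) / e = e / e by ring.
    by rewrite ee s1//; congr EFin; ring.
  - by rewrite gerBl ltW.
  - exact/Coo_continuous/Coo_moll.
  - by move=> y; rewrite /= in_itv/= => /andP[? ?]; apply: HD; rewrite sE; lra.
  - by move=> y H; apply: moll_out => //; apply: contra H; rewrite sE; lra.
rewrite (integral_primitive (F := _) (a := p) (b := p + e) _ _ dF).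
- rewrite !E sE.
  have -> : 1 * (p + e - p) / e = e / e by ring.
  by rewrite ee (s1 1)// subrr mulr0 mul0r s0//; congr EFin; ring.
- by rewrite lerDl ltW.
- exact/Coo_continuous/Coo_moll.
- by move=> y; rewrite /= in_itv/= => /andP[? ?]; apply: HD; rewrite sE; lra.
- by move=> y H; apply: moll_out => //; apply: contra H; rewrite sE; lra.
Qed.

Lemma poly_primitive (q : {poly R}) : exists Q : {poly R}, (size Q <= (size q).+1)%N /\ Q^`() = q.
Proof.
exists (\poly_(i < (size q).+1) (if i is j.+1 then q`_j / (j.+1)%:R else 0)).
split; first exact: size_poly.
apply/polyP => i; rewrite coef_deriv coef_poly ltnS /=; case: ltnP => iq.
  by rewrite -[LHS]mulr_natr divfK// pnatr_eq0.
by rewrite mul0rn nth_default.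
Qed.

(** Apart from [H 0], [H i] is a smoothed truncated power, a polynomial of degree less than [i] once
    past the mollifier. A functional that kills such polynomials cancels it to the right of all its
    points, so the resulting Peano kernel has compact support. *)
Lemma moll_primitives e : 0 < e -> exists H : nat -> R -> R,
  [/\ H 0%N = moll e 0, forall i, Coo (H i), forall i, D1 (H i.+1) = H i,
    forall i y, y <= 0 -> H i y = 0 &
    (forall i y, 0 <= y -> 0 <= H i.+1 y <= y ^+ i) /\
    (forall i, exists q : {poly R}, (size q <= i)%N /\ forall y, e <= y -> H i y = q.[y])].
Proof.
move=> e0; have [_ ds _ _ [s0 s1]] := rhoP.
have sg0 : sgn 0 = 1 by rewrite /sgn ltxx.
(* The default [f] is never reached: [antideriv] supplies a primitive for every smooth [f] that
   vanishes on the left half-line. *)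
pose nxt f := xget f [set F | (forall x, is_derive x 1 F (f x)) /\ forall y, y <= 0 -> F y = 0].
have nxtP f : Coo f -> (forall y, y <= 0 -> f y = 0) ->
   (forall x, is_derive x 1 (nxt f) (f x)) /\ forall y, y <= 0 -> nxt f y = 0.
  move=> cf f0; have [F HF] := antideriv (Coo_continuous cf) f0.
  have : [set F | (forall x, is_derive x 1 F (f x)) /\ forall y, y <= 0 -> F y = 0] (nxt f).
    by apply: xgetPex; exists F.
  by [].
pose S y := step (y / e).
pose H i := if i is j.+1 then iter j nxt S else moll e 0.
have dS x : is_derive x 1 S (moll e 0 x).
  have := is_derive_affine (a := e^-1) (b := 0) (ds (e^-1 * x + 0)).
  rewrite /moll sg0 subr0 mul1r addr0 [e^-1 * x]mulrC => K.
  rewrite (_ : S = fun x => step (e^-1 * x + 0))//.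
  by apply/funext => y; rewrite addr0 mulrC.
have b0 y : y <= 0 -> moll e 0 y = 0.
  by move=> y0; apply: moll_out => //; rewrite sg0 mul1r subr0 ltNge y0.
have S0 y : y <= 0 -> S y = 0.
  by move=> y0; apply: s0; rewrite pmulr_lle0// invr_gt0.
have main i : [/\ Coo (H i.+1), forall x, is_derive x 1 (H i.+1) (H i x), forall y, y <= 0 -> H i.+1 y = 0,
   forall y, 0 <= y -> 0 <= H i.+1 y <= y ^+ i &
   exists q : {poly R}, (size q <= i.+1)%N /\ forall y, e <= y -> H i.+1 y = q.[y]].
  elim: i => [|i [IC Id I0 Ib [q [qs Iq]]]].
    split=> //=.
    - exact: (@Coo_prim _ _ _ (@Coo_moll e 0) dS).
    - by move=> y _; rewrite expr0; exact: step01.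
    - exists 1; split; first by rewrite size_poly1.
      by move=> y ey; rewrite hornerC /S s1// ler_pdivlMr// mul1r.
  have [nd n0] := nxtP _ IC I0.
  have HE : H i.+2 = nxt (H i.+1) by [].
  have nd' : forall x, is_derive x 1 (H i.+2) (H i.+1 x) by rewrite HE.
  split=> //.
  - exact: (@Coo_prim _ _ _ IC nd').
  - move=> y y0; apply/andP; split.
      rewrite -(n0 0 (lexx _)) -HE; apply: (le_derive nd') => // z /andP[z0 _].
      by have /andP[] := Ib z (ltW z0).
    have dG x : is_derive x 1 (fun x => x ^+ i.+1 - H i.+2 x) (i.+1%:R * x ^+ i - H i.+1 x).
      have := is_deriveB (@is_derive_horner R ('X^(i.+1)) x) (nd' x).
      rewrite derivXn hornerMn hornerXn -mulr_natl => K.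
      rewrite (_ : (fun x => _) = horner 'X^(i.+1) - H i.+2)//.
      by apply/funext => t; rewrite /= !fctE hornerXn.
    rewrite -subr_ge0; have := @le_derive _ _ _ 0 y dG.
    rewrite HE (n0 0 (lexx _)) expr0n/= subr0; apply=> // z /andP[z0 _].
    rewrite subr_ge0; have /andP[_ /le_trans] := Ib z (ltW z0); apply.
    by rewrite ler_peMl ?exprn_ge0 ?(ltW z0)// ler1n.
  - have [Q [Qs QE]] := poly_primitive q.
    (* The constant of integration is fixed by matching values at [e], where the polynomial regime
       begins. *)
    exists (Q + (H i.+2 e - Q.[e])%:P); split.
      apply: leq_trans (size_polyD _ _) _; rewrite geq_max (leq_trans Qs) ?ltnS//=.
      by rewrite (leq_trans (size_polyC_leq1 _)).
    move=> y ey; rewrite hornerD hornerC.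
    have dG x : is_derive x 1 (fun x => H i.+2 x - Q.[x]) (H i.+1 x - q.[x]).
      by have := is_deriveB (nd' x) (@is_derive_horner R Q x); rewrite QE.
    have := cst_derive (x := e) (y := y) dG; rewrite /= => /(_ _ ey) K.
    have -> : H i.+2 e - Q.[e] = H i.+2 y - Q.[y].
      by apply: K => z /andP[/ltW ez _]; have /= -> := Iq z ez; rewrite subrr.
    by rewrite addrC subrK.
exists H; split=> //.
- by case=> [|i]; [exact: Coo_moll|case: (main i)].
- by move=> i; apply: derive1_eq; case: (main i).
- by case=> [|i] y y0; [exact: b0|case: (main i) => _ _ ->].
- split=> i; first by case: (main i).
  case: i => [|i]; last by case: (main i).
  exists 0; split; first by rewrite size_poly0.
  move=> y ey; rewrite horner0; apply: moll_out => //.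
  by rewrite sg0 mul1r subr0 ltNge negb_and negbK -leNgt ey orbT.
Qed.

End mollifiers.

(** * Point functionals as derivatives of test functions *)

Section rep.
Context {R : realType}.
Implicit Types (f g h : R -> R) (x y p e : R) (L : seq (R * R)) (U : set R).
Local Notation D1 := (@derive1 R R).

Definition bsum e L y := \sum_(q <- L) q.1 * moll e q.2 y.

(* [Rep U r L M]: mollifications of the point functional [L] are sums of
   derivatives of order at most [r] of test functions dominated by [M], so that
   the functional is controlled by weak derivatives integrated against [M]. *)
Definition Rep U r L (M : R -> R) := exists2 e0, 0 < e0 &
  forall e, 0 < e -> e <= e0 -> exists phi : nat -> R -> R,
  [/\ forall k, Coo (phi k), forall k y, `|phi k y| <= M y,
   exists a b, [/\ a <= b, `[a, b] `<=` U & forall k y, ~~ (a <= y <= b) -> phi k y = 0] &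
   forall y, bsum e L y = \sum_(k < r.+1) (-1) ^+ k * iter k D1 (phi k) y].

Lemma Rep_ext U r L L' M : (forall e y, bsum e L y = bsum e L' y) -> Rep U r L M -> Rep U r L' M.
Proof.
move=> LL [e0 e0p H]; exists e0 => // e ep ee; have [phi [H1 H2 H3 H4]] := H e ep ee.
by exists phi; split=> // y; rewrite -LL.
Qed.

Lemma Rep_mono U r L M M' : (forall y, M y <= M' y) -> Rep U r L M -> Rep U r L M'.
Proof.
move=> MM [e0 e0p H]; exists e0 => // e ep ee; have [phi [H1 H2 H3 H4]] := H e ep ee.
by exists phi; split=> // k y; exact: le_trans (MM y).
Qed.

Lemma Rep_add U r L1 L2 M1 M2 : (forall a b c, U a -> U b -> a <= c <= b -> U c) ->
  Rep U r L1 M1 -> Rep U r L2 M2 -> Rep U r (L1 ++ L2) (fun y => M1 y + M2 y).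
Proof.
move=> iU [e1 e1p H1] [e2 e2p H2]; exists (Num.min e1 e2); first by rewrite lt_min e1p.
move=> e ep; rewrite le_min => /andP[ee1 ee2].
have [phi [A1 A2 [a [b [ab abU A3]]] A4]] := H1 e ep ee1.
have [psi [B1 B2 [c [d [cd cdU B3]]] B4]] := H2 e ep ee2.
exists (fun k y => phi k y + psi k y); split.
- by move=> k; exact: CooD.
- by move=> k y; rewrite (le_trans (ler_normD _ _))// lerD.
- have Ua : U a by apply: abU; rewrite /= in_itv/= lexx.
  have Ub : U b by apply: abU; rewrite /= in_itv/= lexx andbT.
  have Uc : U c by apply: cdU; rewrite /= in_itv/= lexx.
  have Ud : U d by apply: cdU; rewrite /= in_itv/= lexx andbT.
  exists (Num.min a c), (Num.max b d); split.
  + by rewrite ge_min le_max ab.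
  + move=> y /=; rewrite in_itv/=; apply: iU.
      by rewrite /Order.min; case: ifP.
    by rewrite /Order.max; case: ifP.
  + move=> k y; rewrite ge_min le_max => H.
    rewrite A3 ?B3 ?addr0//; apply: contra H => /andP[-> ->]; rewrite ?orbT//.
- move=> y; rewrite /bsum big_cat /= -!/(bsum _ _ _) A4 B4 -big_split/=.
  by apply: eq_bigr => k _; rewrite iter_deriveD// mulrDr.
Qed.

Lemma Rep_opp U r L M : Rep U r L M -> Rep U r [seq (- q.1, q.2) | q <- L] M.
Proof.
move=> [e0 e0p H]; exists e0 => // e ep ee; have [phi [A1 A2 [a [b [ab abU A3]]] A4]] := H e ep ee.
exists (fun k y => -1 * phi k y); split.
- by move=> k; exact: CooZ.
- by move=> k y; rewrite mulN1r normrN.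
- by exists a, b; split=> // k y /A3 ->; rewrite mulr0.
- move=> y; rewrite /bsum big_map /=.
  under eq_bigr do rewrite mulNr -mulN1r.
  rewrite -mulr_sumr -/(bsum e L y) A4 mulr_sumr; apply: eq_bigr => k _.
  by rewrite iter_deriveZ// mulrCA.
Qed.

(** The signs produced by the chain rule are absorbed into the test functions. Positivity of the
    points matters: [sgn] changes under [p -> - p] except at [0], where the mollifier would stay on
    the right. *)
Lemma Rep_reflect U r L M : (forall q, q \in L -> 0 < q.2) -> Rep U r L M ->
  Rep [set x | U (- x)] r [seq (q.1, - q.2) | q <- L] (fun y => M (- y)).
Proof.
move=> L0 [e0 e0p H]; exists e0 => // e ep ee; have [phi [A1 A2 [a [b [ab abU A3]]] A4]] := H e ep ee.
exists (fun k y => (-1) ^+ k * phi k (-1 * y + 0)); split.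
- by move=> k; apply: CooZ; exact: Coo_affine.
- by move=> k y; rewrite normrM normrX normrN1 expr1n mul1r addr0 mulN1r.
- exists (- b), (- a); split; first by rewrite lerN2.
    by move=> y /=; rewrite in_itv/= => /andP[y1 y2]; apply: abU; rewrite /= in_itv/=; lra.
  by move=> k y H'; rewrite A3 ?mulr0// addr0 mulN1r; apply: contra H'; lra.
- move=> y; rewrite /bsum big_map /=.
  have -> : \sum_(q <- L) q.1 * moll e (- q.2) y = bsum e L (-1 * y + 0).
    rewrite /bsum big_seq [RHS]big_seq; apply: eq_bigr => q /L0 q0.
    rewrite /moll /sgn oppr_lt0 q0 ltNge (ltW q0)/=; congr (_ * (_ * rho (_ / _))); ring.
  rewrite A4; apply: eq_bigr => k _.
  rewrite iter_deriveZ; last exact: Coo_affine.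
  by rewrite iter_derive_affine// [(-1) ^+ k * (_ * _)]mulrA -expr2 -exprM mulnC exprM sqrrN expr1n expr1n mul1r.
Qed.

Lemma iter_derive0 n : iter n D1 (fun=> 0) = fun=> 0.
Proof. by elim: n => //= n ->; apply: derive1_eq => x; exact: is_derive_cst. Qed.

(** The narrow mollifier at [p] is the fixed bump [rho (y - p)] minus the derivative of
    [step (y - p) - step ((y - p) / e)]. Both pieces are bounded uniformly in [e], and only the
    orders [0] and [1] occur, whence [1 <= r]. *)
Lemma Rep_point : exists2 K, 0 < K & forall U r p, (1 <= r)%N -> 0 <= p ->
  `[p, p + 1] `<=` U -> Rep U r [:: (1, p)] (fun y => if p <= y <= p + 1 then K else 0).
Proof.
have [cr ds r0 rz [s0 s1]] := @rhoP R; have [K K0 rK] := @rho_bounded R.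
exists (K + 1); first by rewrite ltr_wpDl ?ltW.
move=> U r p r1 p0 pU; exists 1 => // e ep e1.
have sp : sgn p = 1 by rewrite /sgn ltNge p0.
have cS : Coo (@step R) by exact: Coo_prim cr ds.
pose phi k y := if k is 0%N then rho (1 * y + - p) else
  if k is 1%N then step (1 * y + - p) + -1 * step (e^-1 * y + - (p / e)) else 0.
have E y : e^-1 * y + - (p / e) = (y - p) / e by ring.
have E1 y : 1 * y + - p = y - p by ring.
have out k y : ~~ (p <= y <= p + 1) -> phi k y = 0.
  rewrite negb_and -!ltNge => /orP yp.
  case: k => [|[|k]] //=; rewrite ?E ?E1.
    by rewrite rz//; apply/negP => H; case: yp; lra.
  case: yp => yp.
    rewrite !s0 ?mulr0 ?addr0//; last by lra.
    by rewrite pmulr_lle0 ?invr_gt0//; lra.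
  rewrite !s1 ?mulr1 ?subrr//; last by lra.
  by rewrite ler_pdivlMr//; lra.
exists phi; split.
- case=> [|[|k]]; [exact: Coo_affine| |exact: Coo_cst].
  by apply: CooD; [exact: Coo_affine|apply: CooZ; exact: Coo_affine].
- move=> k y; case: ifPn => py; last by rewrite out// normr0.
  case: k => [|[|k]] /=; rewrite ?normr0 ?addr_ge0 ?(ltW K0)//.
    by rewrite (le_trans (rK _))// lerDl.
  have := step01 (1 * y + - p); have := step01 (e^-1 * y + - (p / e)).
  by move: K0; rewrite ler_norml; lra.
- by exists p, (p + 1); split=> //; rewrite lerDl.
- move=> y; rewrite /bsum big_seq1 /= mul1r.
  case: r r1 => // r _; rewrite big_ord_recl big_ord_recl /= big1 ?addr0 => [|i _]; last first.
    rewrite (_ : phi _ = fun=> 0)// iter_derive0 /=.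
    by have /= -> := iter_derive0 2; rewrite mulr0.
  rewrite expr0 mul1r /= expr1 mulN1r.
  have dphi1 x : is_derive x 1 (phi 1%N) (1 * rho (1 * x + - p) + -1 * (e^-1 * rho (e^-1 * x + - (p / e)))).
    apply: is_deriveD; first exact/is_derive_affine.
    by apply: is_deriveZ; exact/is_derive_affine.
  rewrite (derive1_eq dphi1) /phi /moll sp E !mul1r; ring.
Qed.

(* Taylor with integral remainder: a functional killing polynomials of degree
   less than [r] only sees the [r]-th derivative. *)
Lemma Rep_poly U r L (a b : R) : (1 <= r)%N -> 0 <= a -> a < b -> `[a, b] `<=` U ->
  (forall q, q \in L -> a <= q.2 < b) ->
  (forall P : {poly R}, (size P <= r)%N -> \sum_(q <- L) q.1 * P.[q.2] = 0) ->
  Rep U r L (fun y => if a <= y < b then (\sum_(q <- L) `|q.1|) * (y - a) ^+ r.-1 else 0).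
Proof.
move=> r1 a0 ab abU La LP.
(* Up to this width every mollifier of the functional is exhausted before [b]. *)
have [e0 e0p He0] : exists2 e0, 0 < e0 & forall q, q \in L -> e0 <= b - q.2.
  elim: L La {LP} => [|q L IH] La; first by exists 1.
  have [|e0 e0p He0] := IH; first by move=> t tL; apply: La; rewrite inE tL orbT.
  exists (Num.min e0 (b - q.2)).
    by rewrite lt_min e0p subr_gt0; have /andP[] := La q (mem_head _ _).
  move=> t; rewrite inE ge_min => /predU1P[->|/He0 ->//]; by rewrite lexx orbT.
exists e0 => // e ep ee; have [H [H0 HC HD Hz [Hb Hp]]] := moll_primitives ep.
have iH k : iter k D1 (H k) = H 0%N by elim: k => // k IH; rewrite iterSr HD.
(* The Peano kernel: the functional applied to [H r] instead of [H 0]. Its [r]-th derivative is the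
   mollified functional. *)
pose S y := \sum_(q <- L) q.1 * H r (1 * y + - q.2).
have CS : Coo S by apply: Coo_sum => q; apply: CooZ; exact: Coo_affine.
have Sout y : ~~ (a <= y < b) -> S y = 0.
  rewrite negb_and -ltNge -leNgt => /orP[ya|by_].
    rewrite /S big_seq big1// => q /La /andP[aq _].
    by rewrite Hz ?mulr0//; lra.
  (* To the right of [b] all the shifted [H r] follow the same polynomial [Q], so [S y] is the
     functional applied to [Q (y - .)] and vanishes. *)
  have [Q [sQ QE]] := Hp r.
  have sQ2 : (size (Q \Po (y%:P - 'X)) <= r)%N.
    rewrite size_comp_poly2// -(opprB 'X) size_polyN size_XsubC//.
  rewrite -(LP _ sQ2) /S big_seq [RHS]big_seq; apply: eq_bigr => q qL.
  rewrite horner_comp !hornerE QE ?mul1r//.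
  by have := He0 q qL; lra.
have Sin y : a <= y < b -> `|S y| <= (\sum_(q <- L) `|q.1|) * (y - a) ^+ r.-1.
  move=> /andP[ay yb]; rewrite mulr_suml (le_trans (ler_norm_sum _ _ _))//.
  rewrite big_seq [leRHS]big_seq ler_sum// => q /La /andP[aq qb].
  rewrite normrM ler_wpM2l//.
  have [yq|yq] := leP 0 (1 * y + - q.2); last first.
    by rewrite Hz ?(ltW yq)// normr0 exprn_ge0// subr_ge0.
  have /andP[h0 h1] := Hb r.-1 _ yq.
  rewrite prednK// in h0 h1; rewrite ger0_norm// (le_trans h1)//.
  by apply: lerXn2r; rewrite ?nnegrE//; lra.
exists (fun k y => if k == r then (-1) ^+ r * S y else 0); split.
- by move=> k; case: (k =P r) => _; [exact: CooZ|exact: Coo_cst].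
- move=> k y; have [yab|yab] := boolP (a <= y < b); last first.
    by case: (k =P r) => _ /=; rewrite ?(Sout _ yab) ?mulr0 normr0.
  case: (k =P r) => _ /=.
    by rewrite normrM normrX normrN1 expr1n mul1r Sin.
  rewrite normr0 mulr_ge0 ?sumr_ge0// exprn_ge0// subr_ge0.
  by case/andP: yab.
- exists a, b; split=> //; first exact: ltW.
  move=> k y yab; case: (k =P r) => // _; rewrite Sout ?mulr0//.
  by apply: contra yab => /andP[-> /ltW].
- move=> y; rewrite big_ord_recr /= big1 ?add0r => [|i _]; last first.
    by rewrite (ltn_eqF (ltn_ord i)) iter_derive0 /= mulr0.
  rewrite eqxx iter_deriveZ// mulrA -expr2 -exprM mulnC exprM sqrrN expr1n expr1n mul1r.
  rewrite /S iter_derive_sum => [|q]; last exact: Coo_affine.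
  rewrite /bsum big_seq [RHS]big_seq; apply: eq_bigr => q /La /andP[aq _].
  rewrite iter_derive_affine// iH H0 expr1n mul1r; congr (_ * _).
  rewrite /moll /sgn ltxx ifF; last by apply/negbTE; rewrite -leNgt (le_trans a0).
  by rewrite !mul1r subr0.
Qed.
End rep.

(** * Continuity on cubes: boundedness and measurability *)

Section cont.
Context {R : realType}.
Local Notation mR := (measurableTypeR R).

(** Row vectors carry a topology with a compactness theorem for boxes; [contOn], a bare
    epsilon-delta condition on tuples, is transferred to them. *)
Definition tupv d (v : 'rV[R]_d) : d.-tuple R := [tuple v ord0 i | i < d].
Definition rowv d (t : d.-tuple R) : 'rV[R]_d := \row_i tnth t i.

Lemma rowvK d : cancel (@rowv d) (@tupv d).
Proof. by move=> t; apply: eq_from_tnth => i; rewrite tnth_mktuple mxE. Qed.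

Lemma continuous_contOn d (g : d.-tuple R -> R) : continuous (g \o @tupv d) -> contOn setT g.
Proof.
move=> cg t _ e e0; have /cvgrPdist_lt/(_ e e0)/nbhs_ballP[del /= del0 H] := cg (rowv t).
exists del => // s _ st; have /= := H (rowv s).
rewrite !rowvK distrC; apply; split=> // i j.
by rewrite (ord1 i) !mxE /ball /= distrC; exact: st.
Qed.

Lemma contOnS d (A B : set (d.-tuple R)) (g : d.-tuple R -> R) : A `<=` B -> contOn B g -> contOn A g.
Proof.
move=> AB cg t At e e0; have [del d0 H] := cg t (AB _ At) e e0.
by exists del => // s As; apply: H; exact: AB.
Qed.

Lemma contOn_bounded_box d (a b : R) (g : d.-tuple R -> R) : contOn (cube d `[a, b]) g ->
  exists2 K, 0 < K & forall t, cube d `[a, b] t -> `|g t| <= K.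
Proof.
move=> cg.
pose K := [set v : 'rV[R]_d | forall i, `[a, b]%classic (v ord0 i)].
have cK : compact K by apply: (@rV_compact R d (fun=> `[a, b]%classic)) => i; exact: segment_compact.
have KE v : K v <-> cube d `[a, b] (tupv v).
  by split=> H i; have := H i; rewrite tnth_mktuple.
have cf : {within K, continuous (g \o @tupv d)}.
  apply/subspace_continuousP => v Kv; apply/cvgrPdist_lt => e e0.
  have [del d0 H] := cg _ ((KE v).1 Kv) e e0.
  rewrite near_withinE; apply/nbhs_ballP; exists del => // w /= [_ vw] Kw.
  rewrite distrC; apply: H; first exact/KE.
  by move=> i; rewrite !tnth_mktuple distrC; exact: vw.
have [M [_ HM]] := compact_bounded (continuous_compact cf cK).
exists (`|M| + 1); first by rewrite ltr_wpDl.
move=> t Ct; apply: (HM (`|M| + 1)); first by rewrite (le_lt_trans (ler_norm _))// ltrDl.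
exists (rowv t); last by rewrite /= rowvK.
by apply/KE; rewrite rowvK.
Qed.

(** The sigma-algebra on tuples is a product one, so the preimage of an open ray is written as a
    countable union of boxes with rational centres and radii [1/(n+1)], each cut with [U^d]. *)
Lemma contOn_measurable d (U : set R) (g : d.-tuple R -> R) :
  open U -> contOn (cube d U) g -> measurable_fun (cube d U : set (d.-tuple mR)) g.
Proof.
move=> oU cg.
have mU : measurable (U : set mR) by exact: open_measurable.
have mC : measurable (cube d U : set (d.-tuple mR)) by exact: measurable_cube.
apply: (measurability _ (RGenOInfty.measurableE R)).
move=> _ [_ [x ->] <-].
pose box (q : d.-tuple rat) (n : nat) : set (d.-tuple mR) := cube d U `&`
  [set s | forall i, `|tnth s i - ratr (tnth q i)| < n.+1%:R^-1].
pose good (qn : d.-tuple rat * nat) := box qn.1 qn.2 `<=` g @^-1` `]x, +oo[.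
have mbox q n : measurable (box q n).
  apply: measurableI => //=.
  rewrite (_ : [set s | _] = \bigcap_(i : 'I_d) ((@tnth _ _ ^~ i) @^-1` `](ratr (tnth q i) - n.+1%:R^-1), (ratr (tnth q i) + n.+1%:R^-1)[)).
    apply: fin_bigcap_measurable; first exact: finite_finset.
    move=> i _; rewrite -[X in measurable X]setTI; exact: measurable_tnth.
  by apply/seteqP; split=> s /= H i => [_|]; [have := H i|have := H i I]; rewrite /= in_itv/= ltr_distl.
rewrite (_ : _ `&` _ = \bigcup_qn if pselect (good qn) then box qn.1 qn.2 else set0).
  apply: countable_bigcupT_measurable; first exact: countableP.
  by move=> qn; case: (pselect (good qn)) => H /=; [exact: mbox|exact: measurable0].
apply/seteqP; split=> [s [Us gs]|s [qn _]]; last first.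
  by case: (pselect (good qn)) => //= G bs; split; [case: bs|exact: G bs].
have [e e0 He] : exists2 e, 0 < e & forall z, `|z - g s| < e -> `]x, +oo[%classic z.
  move: gs; rewrite /= in_itv/= andbT => xg.
  exists (g s - x); first by rewrite subr_gt0.
  by move=> z; rewrite /= in_itv/= andbT ltr_norml; lra.
have [del d0 Hd] := cg s Us e e0.
have [n _ nd] : exists2 n : nat, True & n.+1%:R^-1 < del / 2.
  have d2 : 0 < del / 2 by rewrite divr_gt0.
  by have [n Hn] := ltr_add_invr d2; exists n => //; rewrite add0r in Hn.
have [q Hq] : exists q : d.-tuple rat, forall i, `|tnth s i - ratr (tnth q i)| < n.+1%:R^-1.
  have n0 : 0 < n.+1%:R^-1 :> R by rewrite invr_gt0.
  have Hex i : exists q : rat, `|tnth s i - ratr q| < n.+1%:R^-1.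
    have [|q] := @rat_in_itvoo R (tnth s i - n.+1%:R^-1) (tnth s i + n.+1%:R^-1); first by rewrite ltrBlDr -addrA ltrDl addr_gt0.
    by rewrite in_itv/= => Hq; exists q; rewrite distrC ltr_distl.
  exists [tuple xchoose (Hex i) | i < d] => i.
  by rewrite tnth_mktuple; exact: (xchooseP (Hex i)).
have G : good (q, n).
  move=> u [Uu Hu]; apply: He; apply: Hd => // i.
  rewrite (le_lt_trans (ler_distD (ratr (tnth q i)) _ _))// [ltRHS]splitr ltrD//.
    exact: lt_trans (Hu i) nd.
  by rewrite distrC (lt_trans (Hq i) nd).
by exists (q, n) => //; case: (pselect (good (q, n))) => //=.
Qed.
End cont.

(** * Products of one-variable functions and their derivatives *)

Section tprod.
Context {R : realType}.
Local Notation mR := (measurableTypeR R).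
Local Notation D1 := (@derive1 R R).
Implicit Types (d : nat).

Definition tprod d (phi : 'I_d -> R -> R) (t : d.-tuple R) : R := \prod_(i < d) phi i (tnth t i).

Definition upd d (phi : 'I_d -> R -> R) i f : 'I_d -> R -> R := fun j => if j == i then f else phi j.

Lemma tnth_shift d (t : d.-tuple R) i h j : tnth (shift t i h) j = tnth t j + (if j == i then h else 0).
Proof. by rewrite tnth_mktuple. Qed.

Lemma tprod_upd d (phi : 'I_d -> R -> R) i f t :
  tprod (upd phi i f) t = f (tnth t i) * \prod_(j < d | j != i) phi j (tnth t j).
Proof.
rewrite /tprod (bigD1 i)//= /upd eqxx; congr (_ * _).
by apply: eq_bigr => j /negbTE ->.
Qed.

Lemma upd_id d (phi : 'I_d -> R -> R) i : upd phi i (phi i) = phi.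
Proof. by apply/funext => j; rewrite /upd; case: eqP => // ->. Qed.

Lemma tprod_shift d (phi : 'I_d -> R -> R) i t h :
  tprod phi (shift t i h) = (\prod_(j < d | j != i) phi j (tnth t j)) * phi i (1 * h + tnth t i).
Proof.
rewrite -{1}(upd_id phi i) tprod_upd mulrC; congr (_ * _).
  by apply: eq_bigr => j /negbTE ji; rewrite tnth_shift ji addr0.
by rewrite tnth_shift eqxx mul1r addrC.
Qed.

Lemma is_derive_tprod d (phi : 'I_d -> R -> R) i t : Coo (phi i) ->
  is_derive (0 : R) (1 : R) (fun h => tprod phi (shift t i h)) (tprod (upd phi i (D1 (phi i))) t).
Proof.
move=> cf; have := @is_derive_affine _ (phi i) 1 (tnth t i) 0 _ (Coo_is_derive _ cf).
rewrite mul1r => H; have := is_deriveZ (\prod_(j < d | j != i) phi j (tnth t j)) H.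
have -> : (fun h => tprod phi (shift t i h)) = (fun h => (\prod_(j < d | j != i) phi j (tnth t j)) * phi i (1 * h + tnth t i)).
  by apply/funext => h; rewrite tprod_shift.
move=> K; apply: (is_derive_eq K).
by rewrite tprod_upd mulr0 add0r /GRing.scale /= mulrC.
Qed.

Lemma pd_tprod d (phi : 'I_d -> R -> R) i : Coo (phi i) ->
  pd (tprod phi) i = tprod (upd phi i (D1 (phi i))).
Proof.
move=> cf; apply/funext => t; rewrite /pd derive1E.
by have := is_derive_tprod t cf => H; exact: derive_val.
Qed.

Lemma Coo_upd d (phi : 'I_d -> R -> R) i : (forall j, Coo (phi j)) ->
  forall j, Coo (upd phi i (D1 (phi i)) j).
Proof. by move=> cf j; rewrite /upd; case: eqP => // _; exact: Coo_deriv. Qed.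

Lemma continuous_bigprod d (s : seq 'I_d) (phi : 'I_d -> R -> R) : (forall i, continuous (phi i)) ->
  continuous (fun v : 'rV[R]_d => \prod_(i <- s) phi i (v ord0 i)).
Proof.
move=> cf; elim: s => [|i s IH].
  by under eq_fun do rewrite big_nil; exact: cst_continuous.
have c1 : continuous (fun v : 'rV[R]_d => phi i (v ord0 i)).
  move=> v; apply: (@continuous_comp _ _ _ (fun v : 'rV[R]_d => v ord0 i) (phi i) v); last exact: cf.
  exact: coord_continuous.
under eq_fun do rewrite big_cons; move=> v; exact: (cvgM (c1 v) (IH v)).
Qed.

Lemma contOn_tprod d (phi : 'I_d -> R -> R) : (forall i, continuous (phi i)) -> contOn setT (tprod phi).
Proof.
move=> cf; apply: continuous_contOn.
rewrite (_ : _ \o _ = fun v : 'rV[R]_d => \prod_(i < d) phi i (v ord0 i)).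
  exact: continuous_bigprod.
by apply/funext => v; apply: eq_bigr => i _; rewrite tnth_mktuple.
Qed.

Lemma smooth_tprod d (phi : 'I_d -> R -> R) : (forall i, Coo (phi i)) -> smooth (tprod phi).
Proof.
move=> cf s.
have [psi cpsi ->] : exists2 psi, (forall i, Coo (psi i)) & foldr (fun i h => pd h i) (tprod phi) s = tprod psi.
  elim: s => [|i s [psi cpsi /= ->]]; first by exists phi.
  by exists (upd psi i (D1 (psi i))); [exact: Coo_upd|rewrite pd_tprod].
split; last by apply: contOn_tprod => i; exact: Coo_continuous.
by move=> i t; have [] := is_derive_tprod t (cpsi i).
Qed.

Lemma iter_pd_tprod d (phi : 'I_d -> R -> R) i n : (forall i, Coo (phi i)) ->
  iter n (fun g => pd g i) (tprod phi) = tprod (upd phi i (iter n D1 (phi i))).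
Proof.
move=> cf; elim: n => [|n /= ->]; first by rewrite upd_id.
rewrite pd_tprod; last by rewrite /upd eqxx; exact: Coo_iter.
congr tprod; apply/funext => j; rewrite /upd eqxx; by case: eqP.
Qed.

Lemma Dk_tprod d (phi : 'I_d -> R -> R) (k : 'I_d -> nat) : (forall i, Coo (phi i)) ->
  Dk k (tprod phi) = tprod (fun i => iter (k i) D1 (phi i)).
Proof.
move=> cf; rewrite /Dk.
suff H s : uniq s -> foldr (fun i g => iter (k i) (fun g => pd g i) g) (tprod phi) s =
    tprod (fun i => if i \in s then iter (k i) D1 (phi i) else phi i).
  rewrite H ?enum_uniq//; congr tprod; apply/funext => i.
  by rewrite mem_enum.
elim: s => [|i s IH] //= /andP[si us].
rewrite IH// iter_pd_tprod; last by move=> j; case: ifP => // _; exact: Coo_iter.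
congr tprod; apply/funext => j; rewrite /upd in_cons.
by case: eqP => // ->; rewrite (negbTE si).
Qed.

Lemma test_fun_tprod d (U : set R) (phi : 'I_d -> R -> R) a b : (forall i, Coo (phi i)) ->
  `[a, b] `<=` U -> (forall i y, ~~ (a <= y <= b) -> phi i y = 0) -> test_fun U (tprod phi).
Proof.
move=> cf abU phi0; split; first exact: smooth_tprod.
exists a, b; split=> // t [i /negP ti].
by rewrite /tprod (bigD1 i)//= phi0// mul0r.
Qed.

End tprod.

(** * Tensor products of point functionals *)

Section tensor.
Context {R : realType}.
Local Notation mR := (measurableTypeR R).
Local Notation D1 := (@derive1 R R).

Fixpoint tensor d : ('I_d -> seq (R * R)) -> seq (R * d.-tuple R) :=
  match d with
  | 0 => fun=> [:: (1, [tuple])]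
  | d'.+1 => fun L => [seq (p.1 * q.1, tcons (p.2, q.2)) | p <- L ord0, q <- tensor (fun i => L (lift ord0 i))]
  end.

Lemma prod_tensor d (L : 'I_d -> seq (R * R)) (F : 'I_d -> R -> R) :
  \prod_(i < d) (\sum_(p <- L i) p.1 * F i p.2) =
  \sum_(q <- tensor L) q.1 * \prod_(i < d) F i (tnth q.2 i).
Proof.
elim: d L F => [|d IH] L F; first by rewrite big_ord0 /= big_seq1 big_ord0 mulr1.
rewrite big_ord_recl (IH (fun i => L (lift ord0 i)) (fun i => F (lift ord0 i))) /= big_allpairs_dep /= mulr_suml; apply: eq_bigr => p _.
rewrite mulr_sumr; apply: eq_bigr => q _.
rewrite big_ord_recl /tcons tnth0; under [in RHS]eq_bigr do rewrite tnthS.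
by rewrite mulrACA.
Qed.

Lemma mem_tensor d (L : 'I_d -> seq (R * R)) q i : q \in tensor L ->
  exists2 p, p \in L i & tnth q.2 i = p.2.
Proof.
elim: d L q i => [|d IH] L q i; first by case: i.
move=> /allpairsP[[p q'] /= [pL qL ->]] /=.
case: (unliftP ord0 i) => [j ->|->]; last by exists p; rewrite // /tcons tnth0.
by have [p' p'L E] := IH _ _ j qL; exists p'; rewrite // /tcons tnthS.
Qed.
End tensor.

Section intD_abs.
Context {R : realType}.
Local Notation mR := (measurableTypeR R).
Local Open Scope ereal_scope.

Lemma intD_ge0 d (D : set R) (F : d.-tuple R -> \bar R) : (forall t, cube d D t -> 0 <= F t) -> 0 <= intD D F.
Proof.
elim: d F => [|d IH] F F0; first by rewrite intD0; apply: F0; case.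
rewrite intDS; apply: integral_ge0 => x Dx; apply: IH => t Dt.
by apply: F0; apply/cube_tcons.
Qed.

Lemma intD_ge0N d (D : set R) (F : d.-tuple R -> \bar R) : (forall t, cube d D t -> 0 <= F t) ->
  intD D (fun t => - F t) = - intD D F.
Proof.
elim: d F => [|d IH] F F0; first by rewrite !intD0.
rewrite !intDS -integral_ge0N; last first.
  by move=> x Dx; apply: intD_ge0 => t Dt; apply: F0; apply/cube_tcons.
apply: eq_integral => x /[!inE] Dx; apply: (IH (fun t => F (tcons (x, t)))) => t Dt.
by apply: F0; apply/cube_tcons.
Qed.

(** No integrability is required: [F <= |F|] and [- |F| <= F] with monotonicity suffice, and the
    sign can be moved out of the iterated integral because [|F|] is nonnegative. *)
Lemma abse_intD d (D : set R) (F : d.-tuple R -> \bar R) : `|intD D F| <= intD D (fun t => `|F t|).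
Proof.
have [h|h] := leP 0 (intD D F).
  by rewrite gee0_abs//; apply: intD_mono => t _; exact: lee_abs.
rewrite lte0_abs// leeNl -intD_ge0N//; apply: intD_mono => t _.
by rewrite leeNl -abseN; exact: lee_abs.
Qed.

Lemma abse_sign (n : nat) (x : \bar R) : `|((-1) ^+ n * x)| = `|x|.
Proof.
elim: n x => [|n IH] x; first by rewrite expe0 mul1e.
by rewrite expeS -muleA abseM IH abseN abse1 mul1e.
Qed.
End intD_abs.

Section Rint.
Context d (T : measurableType d) (R : realType) (mu : {measure set T -> \bar R}) (D : set T).
Hypothesis mD : measurable D.

Lemma Rintegral_lin (I : eqType) (s : seq I) (c : I -> R) (F : I -> T -> R) :
  (forall i, i \in s -> mu.-integrable D (EFin \o F i)) ->
  mu.-integrable D (EFin \o (fun x => \sum_(i <- s) c i * F i x)) /\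
  \int[mu]_(x in D) (\sum_(i <- s) c i * F i x) = \sum_(i <- s) c i * \int[mu]_(x in D) F i x.
Proof.
elim: s => [|i s IH] iF.
  under eq_fun do rewrite big_nil; rewrite big_nil.
  by split; [exact: integrable0|rewrite /Rintegral integral0].
have iZ : mu.-integrable D (EFin \o (fun x => c i * F i x)).
  exact: (integrableZl mD (c i) (iF i (mem_head _ _))).
have [|IH1 IH2] := IH; first by move=> j js; apply: iF; rewrite inE js orbT.
split.
  under eq_fun do rewrite big_cons.
  exact: (integrableD mD iZ IH1).
rewrite big_cons -IH2 -(RintegralZl _ mD (iF i (mem_head _ _))) -RintegralD//.
by apply: eq_Rintegral => x _; rewrite big_cons.
Qed.
End Rint.

(** * Mollified evaluation of a continuous function *)

Section mollified_functionals.
Context {R : realType} (U : set R).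
Local Notation mR := (measurableTypeR R).
Local Notation D1 := (@derive1 R R).
Hypothesis oU : open U.
Hypothesis iU : forall a b c : R, U a -> U b -> a <= c <= b -> U c.

Let mU : measurable (U : set mR). Proof. exact: open_measurable. Qed.

Lemma integrable_tprod d (psi : 'I_d -> R -> R) :
  (forall i, leb.-integrable (U : set mR) (EFin \o psi i)) ->
  (muT d).-integrable (cube d U) (EFin \o tprod psi).
Proof. by move=> H; have [] := integral_tprod mU H. Qed.

Lemma integrable_cont_supp (psi : R -> R) a b : continuous psi -> 
  (forall y, ~~ (a <= y <= b) -> psi y = 0) -> leb.-integrable (U : set mR) (EFin \o psi).
Proof.
move=> cpsi psi0.
have iab : lebesgue_measure.-integrable `[a, b] (EFin \o psi).
  apply: continuous_compact_integrable; first exact: segment_compact.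
  exact: continuous_subspaceT.
suff iT : leb.-integrable [set: mR] (EFin \o psi) by exact: integrableS iT.
have E : (EFin \o psi) = (EFin \o psi) \_ `[a, b].
  apply/funext => y; rewrite /patch; case: ifPn => //; rewrite notin_setE /= in_itv/= => /negP yab.
  by rewrite psi0.
by rewrite E -(@integrable_mkcond _ _ _ leb).
Qed.

Lemma integrable_f_tprod d (f : d.-tuple R -> R) (psi : 'I_d -> R -> R) a b :
  contOn (cube d U) f -> (forall i, continuous (psi i)) -> `[a, b] `<=` U ->
  (forall i y, ~~ (a <= y <= b) -> psi i y = 0) ->
  (muT d).-integrable (cube d U) (EFin \o (fun t => f t * tprod psi t)).
Proof.
move=> cf cpsi abU psi0.
have cC : cube d `[a, b] `<=` cube d U by move=> t tab i; exact: abU.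
have [K K0 fK] := contOn_bounded_box (contOnS cC cf).
have mC := measurable_cube (d := d) mU.
have ip := integrable_tprod (fun i => integrable_cont_supp (cpsi i) (@psi0 i)).
apply: (le_integrable mC (g := EFin \o (fun t => K * tprod psi t))).
- apply/measurable_EFinP; apply: measurable_funM; first exact: contOn_measurable.
  by apply/measurable_EFinP; exact: measurable_int ip.
- move=> t _; rewrite /= lee_fin !normrM.
  have [tab|/existsNP[i /negP ti]] := pselect (cube d `[a, b] t).
    by rewrite ler_wpM2r// (le_trans (fK t tab))// ler_norm.
  by rewrite /tprod (bigD1 i)//= psi0 ?mul0r ?normr0 ?mulr0//; move: ti; rewrite /= in_itv.
- exact: (integrableZl mC K ip).
Qed.

Local Notation "'J' h" := (\int[muT _]_(t in cube _ U) h t) (at level 10, h at level 8).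

(** The product mollifier is a probability density concentrated within [e] of [p] in each
    coordinate, so the average of [f] deviates from [f p] by at most the oscillation of [f]
    there. *)
Lemma moll_approx d (f : d.-tuple R -> R) (p : d.-tuple R) eta : contOn (cube d U) f -> cube d U p -> 0 < eta ->
  exists2 e1, 0 < e1 & forall e, 0 < e -> e <= e1 ->
   (muT d).-integrable (cube d U) (EFin \o (fun t => f t * tprod (fun i => moll e (tnth p i)) t)) /\
   `|\int[muT d]_(t in cube d U) (f t * tprod (fun i => moll e (tnth p i)) t) - f p| <= eta.
Proof.
move=> cf Up eta0; have [del del0 Hd] := cf p Up eta eta0.
(* Openness of [U] leaves room for the mollifier around every coordinate of [p]. *)
have [e2 e20 He2] : exists2 e2, 0 < e2 & forall i y, `|tnth p i - y| <= e2 -> U y.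
  have : \forall e \near (0:R)^'+, forall i y, `|tnth p i - y| <= e -> U y.
    apply: filter_forall => i.
    have /nbhs_ballP[e /= e0 He] : nbhs (tnth p i) U by apply: open_nbhs_nbhs; split.
    near=> z => y Hy; apply: He; rewrite /ball/=; apply: le_lt_trans Hy _.
    by near: z; exact: nbhs_right_lt.
  move=> H; have : \forall e \near (0:R)^'+, 0 < e /\ forall i y, `|tnth p i - y| <= e -> U y.
    near=> z; split; first by near: z; exact: nbhs_right_gt.
    by near: z.
  by move=> /(@filter_ex _ _ _)[e [? ?]]; exists e.
exists (Num.min (del / 2) e2); first by rewrite lt_min e20 divr_gt0.
move=> e e0; rewrite le_min => /andP[ed ee2].
pose m i := moll e (tnth p i).
have Cm i : Coo (m i) by exact: Coo_moll.
have near i y : m i y != 0 -> `|tnth p i - y| < e.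
  apply: contraNT => H; rewrite /m moll_out//; apply: contra H => /andP[].
  by rewrite /sgn ltr_norml; case: ifP => _; lra.
have sup i y : `|tnth p i - y| <= e -> U y by move=> H; apply: (He2 i); exact: le_trans ee2.
have im i : leb.-integrable (U : set mR) (EFin \o m i).
  apply: (@integrable_cont_supp _ (tnth p i - e) (tnth p i + e)); first exact: Coo_continuous.
  move=> y H; apply/eqP; apply: contraNT H => /near; rewrite ltr_norml; lra.
have m0 i y : 0 <= m i y by exact: moll_ge0.
have mC := measurable_cube (d := d) mU.
have ip := integrable_tprod im.
have Ep : \int[muT d]_(t in cube d U) tprod m t = 1.
  have [_ E] := integral_tprod mU im.
  rewrite /Rintegral /tprod E /= big1// => i _.
  rewrite /Rintegral integral_moll// => y.
  by move=> H; apply: (sup i); move: H; rewrite /sgn ler_norml; case: ifP => _; lra.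
have cpos t : 0 <= tprod m t by apply: prodr_ge0.
have dif t : cube d U t -> `|(f t - f p) * tprod m t| <= eta * tprod m t.
  move=> Ut; rewrite normrM (ger0_norm (cpos t)).
  have [->|tn] := eqVneq (tprod m t) 0; first by rewrite !mulr0.
  rewrite ler_wpM2r// ltW// Hd// => i; rewrite distrC.
  apply: (@lt_le_trans _ _ e); last by move: del0 ed; lra.
  by apply: near; move: tn; rewrite /tprod; apply: contraNneq => m00; rewrite (bigD1 i)//= m00 mul0r.
have mf : measurable_fun (cube d U : set (d.-tuple mR)) f by exact: contOn_measurable.
have idif : (muT d).-integrable (cube d U) (EFin \o (fun t => (f t - f p) * tprod m t)).
  apply: (le_integrable mC (g := EFin \o (fun t => eta * tprod m t))).
  - apply/measurable_EFinP; apply: measurable_funM.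
      by apply: measurable_funB => //; exact: measurable_cst.
    by apply/measurable_EFinP; exact: measurable_int ip.
  - by move=> t Ut; rewrite /= lee_fin (le_trans (dif t Ut))// ler_norm.
  - exact: (integrableZl mC eta ip).
have icst : (muT d).-integrable (cube d U) (EFin \o (fun t => f p * tprod m t)).
  exact: (integrableZl mC (f p) ip).
have iE : (fun t => f t * tprod m t) = (fun t => (f t - f p) * tprod m t + f p * tprod m t).
  by apply/funext => t; ring.
split; first by rewrite iE; exact: (integrableD mC idif icst).
rewrite iE RintegralD// RintegralZl// Ep mulr1 addrK.
apply: le_trans (le_normr_Rintegral mC idif) _.
rewrite -[leRHS]mulr1 -Ep -RintegralZl//.
apply: le_Rintegral => //.
- exact: (integrable_norm idif).
- exact: (integrableZl mC eta ip).
Unshelve. all: by end_near.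
Qed.
End mollified_functionals.

Section support.
Context {R : realType}.

Lemma iter_derive_supp (h : R -> R) a b n : (forall y, ~~ (a <= y <= b) -> h y = 0) ->
  forall y, ~~ (a <= y <= b) -> iter n (@derive1 R R) h y = 0.
Proof.
elim: n h => [|n IH] h h0 y yab; first exact: h0.
rewrite iterSr; apply: IH yab => z zab.
have far : \forall w \near z, h w = 0.
  have : open [set w : R | ~~ (a <= w <= b)].
    rewrite (_ : [set w | _] = ~` `[a, b]); last first.
      by apply/seteqP; split=> w /=; rewrite in_itv/= => /negP.
    by rewrite openC; exact: itv_closed.
  rewrite openE => /(_ z zab); apply: filterS => w; exact: h0.
rewrite derive1E; have : is_derive z 1 h 0.
  by apply: (@near_eq_is_derive _ _ _ (fun=> 0)); apply: filterS far => w ->.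
by case.
Qed.
End support.

(** * Tensor functionals bounded by weak mixed derivatives *)

Section estimate.
Context {R : realType} (U : set R).
Local Notation mR := (measurableTypeR R).
Local Notation D1 := (@derive1 R R).
Hypothesis oU : open U.
Hypothesis iU : forall a b c : R, U a -> U b -> a <= c <= b -> U c.

Let mU : measurable (U : set mR). Proof. exact: open_measurable. Qed.

Lemma Rep_tensor_test d r (L : 'I_d -> seq (R * R)) (M : 'I_d -> R -> R) :
  (forall i, Rep U r (L i) (M i)) -> (0 < d)%N ->
  exists2 e0, 0 < e0 & forall e, 0 < e -> e <= e0 -> exists phi : 'I_d -> nat -> R -> R, exists a b,
   [/\ `[a, b] `<=` U, forall i k, Coo (phi i k), forall i k y, `|phi i k y| <= M i y,
   forall i k y, ~~ (a <= y <= b) -> phi i k y = 0 &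
   forall i y, bsum e (L i) y = \sum_(k < r.+1) (-1) ^+ k * iter k D1 (phi i k) y].
Proof.
move=> HR d0.
have HR' i : exists e0, 0 < e0 /\ forall e, 0 < e -> e <= e0 -> exists phi : nat -> R -> R,
  [/\ forall k, Coo (phi k), forall k y, `|phi k y| <= M i y,
   exists a b, [/\ a <= b, `[a, b] `<=` U & forall k y, ~~ (a <= y <= b) -> phi k y = 0] &
   forall y, bsum e (L i) y = \sum_(k < r.+1) (-1) ^+ k * iter k D1 (phi k) y].
  by have [e0 ? ?] := HR i; exists e0.
have [E HE] := boolp.choice HR'.
have [e0 e00 He0] : exists2 e0, 0 < e0 & forall i, e0 <= E i.
  exists (\big[Num.min/1]_i E i); first by apply: lt_bigmin => // i _; exact: (HE i).1.
  by move=> i; exact: bigmin_le_cond.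
exists e0 => // e ep ee.
have H i := (HE i).2 e ep (le_trans ee (He0 i)).
have [phi Hphi] := boolp.choice H.
have Hab i : exists ab : R * R, [/\ ab.1 <= ab.2, `[ab.1, ab.2] `<=` U & forall k y, ~~ (ab.1 <= y <= ab.2) -> phi i k y = 0].
  by have [_ _ [a [b H3]] _] := Hphi i; exists (a, b).
have [ab HAB] := boolp.choice Hab.
pose i0 : 'I_d := Ordinal d0.
pose a := \big[Num.min/(ab i0).1]_i (ab i).1.
pose b := \big[Num.max/(ab i0).2]_i (ab i).2.
have aUi i : U (ab i).1 /\ U (ab i).2.
  have [le sub _] := HAB i; split; apply: sub; rewrite /= in_itv/= lexx ?andbT//.
have Ua : U a.
  by apply: (big_ind U) => [|x y Ux Uy|i _]; [exact: (aUi i0).1|rewrite /Order.min; case: ifP|exact: (aUi i).1].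
have Ub : U b.
  by apply: (big_ind U) => [|x y Ux Uy|i _]; [exact: (aUi i0).2|rewrite /Order.max; case: ifP|exact: (aUi i).2].
exists phi, a, b; split.
- by move=> y; rewrite /= in_itv/=; exact: iU.
- by move=> i k; have [H1 _ _ _] := Hphi i.
- by move=> i k y; have [_ H2 _ _] := Hphi i.
- move=> i k y H'; have [_ _ H3] := HAB i; apply: H3; apply: contra H' => /andP[h1 h2].
  by rewrite (le_trans _ h1) ?(le_trans h2)//; [exact: le_bigmax_cond|exact: bigmin_le_cond].
- by move=> i; have [_ _ _ H4] := Hphi i.
Qed.

(** Mollified in every variable, the functional integrates [f] against a product of sums of
    derivatives. Expansion gives one test function per multi-index [k], on which the weak derivative
    [g k] takes over. The right-hand side does not involve the mollification width, so an error
    [eta] on the left is all that remains to be removed. *)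
Lemma tensor_estimate d r (f : d.-tuple R -> R) (g : {ffun 'I_d -> 'I_r.+1} -> d.-tuple R -> R)
  (L : 'I_d -> seq (R * R)) (M : 'I_d -> R -> R) :
  (0 < d)%N -> contOn (cube d U) f ->
  (forall k : {ffun 'I_d -> 'I_r.+1}, weak_deriv U (fun i => nat_of_ord (k i)) f (g k)) ->
  (forall i, Rep U r (L i) (M i)) -> (forall i p, p \in L i -> U p.2) ->
  (`|\sum_(q <- tensor L) q.1 * f q.2|%:E <=
    \sum_(k : {ffun 'I_d -> 'I_r.+1}) intD U (fun t => (`|g k t| * \prod_(i < d) M i (tnth t i))%:E))%E.
Proof.
move=> d0 cf wg HR LU; set B := (\sum_k _)%E.
have [e0 e00 He0] := Rep_tensor_test HR d0.
apply/lee_addgt0Pr => eta eta0.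
pose S := \sum_(q <- tensor L) `|q.1|.
have S0 : 0 <= S by apply: sumr_ge0.
pose eta' := eta / (S + 1).
have eta'0 : 0 < eta' by rewrite divr_gt0// ltr_wpDl.
have tU q : q \in tensor L -> cube d U q.2.
  by move=> qT i; have [p pL ->] := mem_tensor i qT; exact: LU pL.
have [e [ep ee Hap]] : exists e, [/\ 0 < e, e <= e0 & forall q, q \in tensor L ->
   (muT d).-integrable (cube d U) (EFin \o (fun t => f t * tprod (fun i => moll e (tnth q.2 i)) t)) /\
   `|\int[muT d]_(t in cube d U) (f t * tprod (fun i => moll e (tnth q.2 i)) t) - f q.2| <= eta'].
  suff [e1 [e10 e1e H]] : exists e1, [/\ 0 < e1, e1 <= e0 & forall e, 0 < e -> e <= e1 -> forall q, q \in tensor L ->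
   (muT d).-integrable (cube d U) (EFin \o (fun t => f t * tprod (fun i => moll e (tnth q.2 i)) t)) /\
   `|\int[muT d]_(t in cube d U) (f t * tprod (fun i => moll e (tnth q.2 i)) t) - f q.2| <= eta'].
    by exists e1; split=> // q; exact: H.
  elim: (tensor L) tU => [|q s IH] tU; first by exists e0.
  have [|e1 [e10 e1e H]] := IH; first by move=> q' q's; apply: tU; rewrite inE q's orbT.
  have [e2 e20 H2] := moll_approx oU cf (tU q (mem_head _ _)) eta'0.
  exists (Num.min e1 e2); split; [by rewrite lt_min e10|by rewrite ge_min e1e|].
  move=> e ep; rewrite le_min => /andP[ee1 ee2] q'; rewrite inE => /predU1P[->|q's]; first exact: H2.
  exact: H.
have [phi [a [b [abU Cphi phiM phi0 phiE]]]] := He0 e ep ee.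
have mC := measurable_cube (d := d) mU.
pose I q := \int[muT d]_(t in cube d U) (f t * tprod (fun i => moll e (tnth q i)) t).
pose psi (k : {ffun 'I_d -> 'I_r.+1}) i := iter (k i) D1 (phi i (k i)).
have ipsi k : (muT d).-integrable (cube d U) (EFin \o (fun t => f t * tprod (psi k) t)).
  apply: (integrable_f_tprod oU (a := a) (b := b)) => //.
    by move=> i; apply: Coo_continuous; exact: Coo_iter.
  move=> i y yab.
  by rewrite /psi (iter_derive_supp (a := a) (b := b))// => z zab; exact: phi0.
have sumE : \sum_(q <- tensor L) q.1 * I q.2 =
    \sum_(k : {ffun 'I_d -> 'I_r.+1}) (\prod_(i < d) (-1) ^+ (k i)) * \int[muT d]_(t in cube d U) (f t * tprod (psi k) t).
  have [_ <-] := @Rintegral_lin _ _ _ _ _ mC _ (index_enum _) (fun k : {ffun 'I_d -> 'I_r.+1} => \prod_(i < d) (-1) ^+ (k i)) (fun k t => f t * tprod (psi k) t) (fun k _ => ipsi k).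
  pose F q t := f t * tprod (fun i => moll e (tnth q i)) t.
  have -> : \sum_(q <- tensor L) q.1 * I q.2 = \int[muT d]_(t in cube d U) \sum_(q <- tensor L) q.1 * F q.2 t.
    have [_ ->] := @Rintegral_lin _ _ _ _ _ mC _ (tensor L) (fun q => q.1) (fun q => F q.2) (fun q qT => (Hap q qT).1).
    by [].
  apply: eq_Rintegral => t _.
  under eq_bigr do rewrite /F mulrCA.
  rewrite -mulr_sumr; have /= <- := prod_tensor L (fun i p => moll e p (tnth t i)).
  have -> : \prod_(i < d) \sum_(p <- L i) p.1 * moll e p.2 (tnth t i) = \prod_(i < d) \sum_(k < r.+1) (-1) ^+ k * iter k D1 (phi i k) (tnth t i).
    by apply: eq_bigr => i _; rewrite -phiE.
  (* The expanded product runs over all maps from coordinates to orders at most [r], exactly the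
     multi-indices of the Sobolev norm. *)
  rewrite bigA_distr_bigA mulr_sumr; apply: eq_bigr => k _.
  by rewrite big_split /= mulrCA.
have Ik k : (`|\int[muT d]_(t in cube d U) (f t * tprod (psi k) t)|%:E <= intD U (fun t => (`|g k t| * \prod_(i < d) M i (tnth t i))%:E))%E.
  pose ph i := phi i (k i).
  have [_ [_ wk]] := wg k.
  have Cph i : Coo (ph i) by exact: Cphi.
  have tph : test_fun U (tprod ph).
    by apply: (test_fun_tprod Cph abU) => i y; exact: phi0.
  have := wk _ tph; rewrite (Dk_tprod _ Cph) => E.
  have fin : (\int[muT d]_(t in cube d U) (f t * tprod (psi k) t)%:E)%E \is a fin_num.
    exact: (integrable_fin_num mC (ipsi k)).
  rewrite /Rintegral -[X in (X <= _)%E]abse_EFin fineK//.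
  rewrite -(intD_integrableE mU (ipsi k)) E abse_sign.
  apply: le_trans (abse_intD _ _) _; apply: intD_mono => t _.
  rewrite /= lee_fin normrM ler_wpM2l// /tprod normr_prod ler_prod// => i _.
  by rewrite normr_ge0 phiM.
have approx : `|\sum_(q <- tensor L) q.1 * f q.2 - \sum_(q <- tensor L) q.1 * I q.2| <= eta.
  rewrite -sumrB; apply: le_trans (ler_norm_sum _ _ _) _.
  apply: (@le_trans _ _ (S * eta')); last first.
    by rewrite /eta' mulrCA ler_piMr ?(ltW eta0)// ler_pdivrMr ?ltr_wpDl// mul1r lerDl.
  rewrite mulr_suml big_seq [leRHS]big_seq ler_sum// => q qT.
  by rewrite -mulrBr normrM ler_wpM2l// distrC; exact: (Hap q qT).2.
apply: (@le_trans _ _ ((`|\sum_(q <- tensor L) q.1 * I q.2| + eta)%:E)).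
  rewrite lee_fin -lerBlDl (le_trans _ approx)//.
  by rewrite (le_trans (lerB_dist _ _)).
rewrite EFinD leeD2r// sumE.
apply: (@le_trans _ _ (\sum_(k : {ffun 'I_d -> 'I_r.+1}) `|\int[muT d]_(t in cube d U) (f t * tprod (psi k) t)|%:E)%E); last first.
  by apply: lee_sum => k _; exact: Ik.
rewrite sumEFin lee_fin; apply: le_trans (ler_norm_sum _ _ _) _.
apply: ler_sum => k _; rewrite normrM normr_prod big1 ?mul1r// => i _.
by rewrite normrX normrN1 expr1n.
Qed.
End estimate.

(** * Comparison and integration of the weights *)

Section weights.
Context {R : realType}.
Local Notation mR := (measurableTypeR R).
Implicit Types x y c alpha : R.

Lemma powR_half x r : 0 <= x -> x `^ (r%:R / 2) = Num.sqrt x ^+ r.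
Proof.
move=> x0; rewrite -powR12_sqrt// -[RHS]powR_mulrn ?powR_ge0// -powRrM.
by rewrite mulrC.
Qed.

Lemma w1E alpha r x : 0 < x -> w1 alpha r x = x `^ alpha * Num.sqrt x ^+ r * expR (- x).
Proof.
move=> x0; rewrite /w1 gtr0_norm// powRD; last by rewrite (gt_eqF x0) implybT.
by rewrite powR_half// ltW.
Qed.

Lemma w1N alpha r x : w1 alpha r (- x) = w1 alpha r x.
Proof. by rewrite /w1 normrN. Qed.

Lemma w1_ge0 alpha r x : 0 <= w1 alpha r x.
Proof. by rewrite /w1 mulr_ge0 ?powR_ge0 ?expR_ge0. Qed.

Lemma w1_gt0 alpha r x : 0 < x -> 0 < w1 alpha r x.
Proof. by move=> x0; rewrite /w1 mulr_gt0 ?expR_gt0 ?powR_gt0// normr_gt0 gt_eqF. Qed.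

Lemma measurable_w1 alpha r : measurable_fun [set: mR] (w1 alpha r).
Proof.
apply: measurable_funM.
  exact: (measurableT_comp (measurable_powR _)).
apply: (measurableT_comp (@measurable_expR R)).
exact: (measurableT_comp (@oppr_measurable R setT) (@normr_measurable R setT)).
Qed.

(** Both [x / y] and [y / x] are at most [c]; the sign of [alpha] decides which of the two is raised
    to the power [|alpha|]. *)
Lemma powR_compare alpha c x y : 0 < x -> 0 < y -> x <= c * y -> y <= c * x ->
  x `^ alpha <= c `^ `|alpha| * y `^ alpha.
Proof.
move=> x0 y0 xy yx.
have c0 : 0 < c by rewrite -(pmulr_lgt0 c y0) (lt_le_trans x0).
have -> : x `^ alpha = (x / y) `^ alpha * y `^ alpha.
  by rewrite -powRM ?divr_ge0 ?(ltW x0) ?(ltW y0)// divfK// gt_eqF.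
rewrite ler_wpM2r ?powR_ge0//.
have [a0|a0] := leP 0 alpha.
  rewrite ger0_norm//; apply: ge0_ler_powR => //; rewrite ?nnegrE ?(ltW c0)//.
    by rewrite divr_ge0 ?ltW.
  by rewrite ler_pdivrMr.
have -> : x / y = (y / x)^-1 by rewrite invf_div.
rewrite -powR_inv1 ?divr_ge0 ?(ltW x0) ?(ltW y0)// -powRrM mulN1r.
rewrite ltr0_norm//; apply: ge0_ler_powR; rewrite ?nnegrE ?oppr_ge0 ?(ltW c0) ?(ltW a0)//.
  by rewrite divr_ge0 ?ltW.
by rewrite ler_pdivrMr.
Qed.

Lemma w1_compare alpha c e x y : 0 < x -> 0 < y -> x <= c * y -> y <= c * x -> y <= x + e ->
  w1 alpha 0 x <= c `^ `|alpha| * expR e * w1 alpha 0 y.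
Proof.
move=> x0 y0 xy yx ye; rewrite !w1E// !expr0 !mulr1.
rewrite (_ : _ * _ * (_ * _) = (c `^ `|alpha| * y `^ alpha) * (expR e * expR (- y))); last by ring.
rewrite ler_pM ?powR_ge0 ?expR_ge0//; first exact: powR_compare.
by rewrite -expRD ler_expR; lra.
Qed.

Lemma integral_powR alpha c : -1 < alpha -> 0 < c ->
  (\int[leb]_(x in `]0%R, c]) (x `^ alpha)%:E <= ((alpha + 1)^-1 * c `^ (alpha + 1))%:E)%E.
Proof.
move=> a1 c0.
have a10 : 0 < alpha + 1 by lra.
(* The power may be singular at [0], so the integral is a limit over intervals that avoid it. Their
   integrals stay bounded because [alpha + 1] is positive. *)
pose F (n : nat) : set mR := `[c / n.+1%:R, c]%classic.
have mf : measurable_fun [set: mR] (fun x : R => (x `^ alpha)%:E).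
  by apply/measurable_EFinP; exact: measurable_powR.
have -> : `]0%R, c]%classic = \bigcup_n F n.
  apply/seteqP; split=> [x|x [n _]]; rewrite /F /= !in_itv/= => /andP[x0 xc]; last first.
    by rewrite xc andbT (lt_le_trans _ x0)// divr_gt0// ltr0n.
  have [n Hn] := ltr_add_invr (divr_gt0 x0 c0); exists n => //.
  rewrite add0r in Hn; rewrite /F /= in_itv/= xc andbT.
  by move: (ltW Hn); rewrite ler_pdivlMr// mulrC.
have cv : (\int[leb]_(x in F i) (x `^ alpha)%:E)%E @[i --> \oo] --> (\int[leb]_(x in \bigcup_i F i) (x `^ alpha)%:E)%E.
  apply: ge0_nondecreasing_set_cvg_integral.
  - move=> m n mn; apply/subsetPset => x; rewrite /F /= !in_itv/= => /andP[h ->]; rewrite andbT (le_trans _ h)//.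
    by rewrite ler_pM2l// lef_pV2 ?posrE ?ltr0n// ler_nat.
  - by move=> n; exact: measurable_itv.
  - by move=> n; exact: measurable_funTS.
  - by move=> n x _; rewrite lee_fin powR_ge0.
rewrite -(cvg_lim _ cv)//.
apply: lime_le; first by apply/cvg_ex; eexists; exact: cv.
apply: nearW => n.
  have cn0 : 0 < c / n.+1%:R by rewrite divr_gt0// ltr0n.
  have cnc : c / n.+1%:R <= c by rewrite ler_pdivrMr ?ltr0n// ler_peMr ?(ltW c0)// ler1n.
  have dF x : 0 < x -> is_derive x 1 (fun x => (alpha + 1)^-1 * x `^ (alpha + 1)) (x `^ alpha).
    move=> x0; have := is_deriveZ (alpha + 1)^-1 (is_derive1_powR (alpha + 1) x0).
    move=> K; apply: (is_derive_eq K).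
    by rewrite /GRing.scale /= mulrA mulVf ?gt_eqF// mul1r addrK.
  move: cnc; rewrite le_eqVlt => /predU1P[E|cnc].
    by rewrite /F E set_itv1 integral_set1 lee_fin mulr_ge0 ?powR_ge0// invr_ge0 ltW.
  have ctn x : 0 < x -> {for x, continuous (fun x => (alpha + 1)^-1 * x `^ (alpha + 1))}.
    by move=> x0; apply/differentiable_continuous/derivable1_diffP; case: (dF x x0).
  rewrite (@continuous_FTC2 _ _ (fun x => (alpha + 1)^-1 * x `^ (alpha + 1)) _ _ cnc).
  + by rewrite lee_fin gerBl mulr_ge0 ?powR_ge0// invr_ge0 ltW.
  + apply: continuous_in_subspaceT => x /[!inE] /=; rewrite in_itv/= => /andP[cx _].
    have x0 : 0 < x by exact: lt_le_trans cx.
    apply/differentiable_continuous/derivable1_diffP.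
    by case: (is_derive1_powR alpha x0).
  + split.
    * move=> x /[!in_itv]/= /andP[cx _]; case: (dF x) => //; exact: lt_trans cx.
    * by apply: cvg_at_right_filter; exact: ctn.
    * by apply: cvg_at_left_filter; exact: ctn.
  + move=> x /[!in_itv]/= /andP[cx _]; rewrite derive1E; case: (dF x) => //; exact: lt_trans cx.
Qed.
End weights.

(** * The quadratic mesh and Lagrange interpolation on it *)

Section cells.
Context {R : realType} (r : nat).
Implicit Types (x y : R) (N j : nat).

(* The cell around [y] has width of order [sqrt (y / N)] for [y < N]: its [r]-th
   power is [N ^ (- r / 2)] times the ratio of the weights [w_r] and [w_0]. *)
Definition cella N j : R := j%:R ^+ 2 / N%:R.
Definition cell N j x := cella N j <= x < cella N j.+1.
(** These points divide the cell into [r + 1] equal parts. They are strictly interior, hence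
    positive, and far enough apart to bound the Lagrange polynomials independently of the cell. *)
Definition node N j l : R :=
  cella N j + (cella N j.+1 - cella N j) * (l.+1%:R / r.+1%:R).
Definition lag N j (l : 'I_r) x : R := (tnth (r.-lagrange (node N j)) l).[x].
Definition basis N j l x := if cell N j x then lag N j l x else 0.
Definition lev N : seq ((R -> R) * R) :=
  [seq (basis N j l, node N j l) | j <- iota 0 N, l <- enum 'I_r].
(** Bounds the total weight of an interpolation error: [1] for the evaluation point and [(r+1)^r]
    for each of the [r] Lagrange values. *)
Definition Lam : R := 1 + r%:R * r.+1%:R ^+ r.

Lemma size_lev N : size (lev N) = (N * r)%N.
Proof. by rewrite size_allpairs size_iota -cardE card_ord. Qed.

Section fixN.
Variable N : nat.
Hypothesis N0 : (0 < N)%N.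
Let NR : (0 : R) < N%:R. Proof. by rewrite ltr0n. Qed.

Lemma cella_ge0 j : 0 <= cella N j.
Proof. by rewrite divr_ge0 ?exprn_ge0 ?ler0n. Qed.

Lemma cella_le i j : (i <= j)%N -> cella N i <= cella N j.
Proof.
by move=> ij; rewrite ler_pM2r ?invr_gt0// lerXn2r ?nnegrE ?ler0n// ler_nat.
Qed.

Lemma cella_lt i j : (i < j)%N -> cella N i < cella N j.
Proof.
by move=> ij; rewrite ltr_pM2r ?invr_gt0// ltrXn2r ?nnegrE ?ler0n// ltr_nat.
Qed.

Lemma cella_N : cella N N = N%:R.
Proof. by rewrite /cella expr2 mulfK// gt_eqF. Qed.

Lemma cell_inj i j x : cell N i x -> cell N j x -> i = j.
Proof.
rewrite /cell => /andP[a1 b1] /andP[a2 b2]; apply/eqP; rewrite eqn_leq [(i <= j)%N]leqNgt [(j <= i)%N]leqNgt.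
apply/andP; split; apply/negP => /cella_le H.
  by have := lt_le_trans b2 (le_trans H a1); rewrite ltxx.
by have := lt_le_trans b1 (le_trans H a2); rewrite ltxx.
Qed.

Lemma cell_ex x : 0 <= x -> x < N%:R -> exists2 j, (j < N)%N & cell N j x.
Proof.
move=> x0 xN; have ex : exists j, x < cella N j.+1 by exists N.-1; rewrite prednK// cella_N.
have := ex_minnP ex; case=> j xj min_j; exists j.
  by rewrite -(prednK N0) ltnS min_j// prednK// cella_N.
rewrite /cell xj andbT; case: j xj min_j => [|j] xj min_j.
  by rewrite /cella expr0n mul0r.
by rewrite leNgt; apply/negP => /min_j; rewrite ltnn.
Qed.

Lemma cell_lt j x : (j < N)%N -> cell N j x -> 0 <= x < N%:R.
Proof.
rewrite /cell => jN /andP[a1 b1]; rewrite (le_trans (cella_ge0 _) a1)/= (lt_le_trans b1)//.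
by rewrite -cella_N cella_le.
Qed.

Lemma t01 l : (l < r)%N -> 0 < l.+1%:R / r.+1%:R :> R /\ l.+1%:R / r.+1%:R < 1 :> R.
Proof.
move=> lr; rewrite divr_gt0 ?ltr0n//; split=> //.
by rewrite ltr_pdivrMr ?ltr0n// mul1r ltr_nat ltnS.
Qed.

Lemma node_cell j l : (l < r)%N -> cella N j < node N j l < cella N j.+1.
Proof.
move=> lr; have [t0 t1] := t01 lr; have h : 0 < cella N j.+1 - cella N j by rewrite subr_gt0 cella_lt.
rewrite /node ltrDl mulr_gt0//= addrC -ltrBrDr.
by rewrite gtr_pMr.
Qed.

Lemma node_inj j : injective (node N j).
Proof.
move=> l m /addrI; have h : cella N j.+1 - cella N j != 0 by rewrite gt_eqF// subr_gt0 cella_lt.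
move=> /(mulfI h) /(mulIf _) H; have : l.+1%:R == m.+1%:R :> R by apply/eqP/H; rewrite invr_eq0 pnatr_eq0.
by rewrite eqr_nat eqSS => /eqP.
Qed.

Lemma node_dist j l m : l != m -> (cella N j.+1 - cella N j) / r.+1%:R <= `|node N j l - node N j m|.
Proof.
move=> lm; have h : 0 < cella N j.+1 - cella N j by rewrite subr_gt0 cella_lt.
have -> : node N j l - node N j m = (cella N j.+1 - cella N j) * ((l.+1%:R - m.+1%:R) / r.+1%:R).
  rewrite /node; move: (l.+1%:R : R) (m.+1%:R : R) (cella N j) (cella N j.+1) => *; ring.
rewrite normrM gtr0_norm// ler_pM2l// normrM.
rewrite (ger0_norm (_ : 0 <= r.+1%:R^-1)) ?invr_ge0// ler_peMl ?invr_ge0//.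
wlog ml : l m lm / (m < l)%N => [H|].
  have [ml|lm'] := ltnP m l; first exact: H.
  by rewrite distrC H 1?eq_sym// ltn_neqAle lm.
have -> : l.+1%:R - m.+1%:R = (l - m)%:R :> R.
  by rewrite -natrB ?subSS// ltnS ltnW.
by rewrite normr_nat ler1n subn_gt0.
Qed.

(** Every factor of the Lagrange polynomial is at most the cell width divided by the smallest node
    distance, hence at most [r + 1], and there are at most [r] factors. *)
Lemma lag_bound j l x : cell N j x -> `|lag N j l x| <= r.+1%:R ^+ r.
Proof.
move=> xj; have r0 : (0 < r)%N by case: (r) l => // -[].
have h : 0 < cella N j.+1 - cella N j by rewrite subr_gt0 cella_lt.
rewrite /lag lagrangeE//; last exact: node_inj.
rewrite hornerM hornerC !horner_prod -prodfV -big_split /= normr_prod.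
apply: (@le_trans _ _ (\prod_(i < r | i != l) r.+1%:R)); last first.
  rewrite prodr_const.
  by apply: ler_weXn2l; rewrite ?ler1n// (leq_trans (max_card _))// card_ord.
apply: ler_prod => i il; rewrite normr_ge0/= !hornerE normrM normfV mulrC.
have D : (cella N j.+1 - cella N j) / r.+1%:R <= `|node N j l - node N j i|.
  by apply: node_dist; rewrite eq_sym.
have D0 : 0 < `|node N j l - node N j i| by rewrite (lt_le_trans _ D)// divr_gt0// ltr0n.
rewrite ler_pdivrMr//; apply: (@le_trans _ _ (cella N j.+1 - cella N j)).
  have /andP[n1 n2] := node_cell j (ltn_ord i); move: xj; rewrite /cell => /andP[x1 x2].
  move: (cella N j) (cella N j.+1) (node N j i) x1 x2 n1 n2 => ? ? ? ? ? ? ?.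
  by rewrite ler_norml; lra.
by move: D; rewrite ler_pdivrMr ?ltr0n// mulrC.
Qed.

Lemma lag_exact j x (P : {poly R}) : (0 < r)%N -> (size P <= r)%N ->
  P.[x] = \sum_(l < r) lag N j l x * P.[node N j l].
Proof.
move=> r0 sP; rewrite {1}(lagrange_gen r0 (@node_inj j) sP) horner_sum.
by apply: eq_bigr => l _; rewrite hornerM hornerC mulrC.
Qed.
End fixN.
End cells.

(** * Kernels of the one-dimensional errors *)

Section kernels.
Context {R : realType} (r : nat) (U : set R) (K : R).
Hypothesis r1 : (1 <= r)%N.
Hypothesis U0 : forall x, 0 < x -> U x.
Hypothesis iU : forall a b c : R, U a -> U b -> a <= c <= b -> U c.
Hypothesis K0 : 0 < K.
Hypothesis RepK : forall p, 0 <= p -> `[p, p + 1] `<=` U ->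
  Rep U r [:: (1, p)] (fun y => if p <= y <= p + 1 then K else 0).
Implicit Types (x y : R) (N j : nat).
Local Notation Lam := (@Lam R r).

Definition Efun (P : seq ((R -> R) * R)) x : seq (R * R) := (1, x) :: [seq (- b.1 x, b.2) | b <- P].

(** Dominates the Peano kernel of the error at [x], which lives in the cell of [x]. The condition
    [x / r.+1 <= y] records where its support can start; it controls the integral in [x] over the
    first cell as [y] tends to [0]. *)
Definition kcell N x y := \sum_(j < N) if [&& cell N j x, cell N j y & x / r.+1%:R <= y]
  then Lam * (3 * Num.sqrt (y / N%:R)) ^+ r.-1 else 0.
(** Beyond [N] nothing is interpolated, and the error is the evaluation at [x], represented on the
    unit interval to its right. *)
Definition ktail N x y := if (N%:R <= x) && (x <= y <= x + 1) then K else 0.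
(** Kernel of the one-cell interpolant, represented through its nodes: these lie between [1/(r+1)]
    and [1], and each point kernel reaches one unit further to the right. Small [y] are avoided. *)
Definition kone x y := if (x < 1) && (r.+1%:R^-1 <= y <= 2) then Lam * K else 0.

Let Lam0 : 0 <= Lam.
Proof. by rewrite addr_ge0// mulr_ge0 ?exprn_ge0 ?ler0n. Qed.

Lemma kcell_ge0 N x y : 0 <= kcell N x y.
Proof.
apply: sumr_ge0 => j _; case: ifP => // _.
by rewrite mulr_ge0// exprn_ge0// mulr_ge0// sqrtr_ge0.
Qed.

Lemma ktail_ge0 N x y : 0 <= ktail N x y.
Proof. by rewrite /ktail; case: ifP => // _; exact: ltW. Qed.

Lemma kone_ge0 x y : 0 <= kone x y.
Proof. by rewrite /kone; case: ifP => // _; rewrite mulr_ge0// ltW. Qed.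

Lemma U_ge x y : U x -> 0 <= x -> x <= y -> U y.
Proof.
move=> Ux x0; rewrite le_eqVlt => /predU1P[<-//|xy]; apply: U0; exact: le_lt_trans xy.
Qed.

Lemma bsum_cat (e : R) L1 L2 y : bsum e (L1 ++ L2) y = bsum e L1 y + bsum e L2 y.
Proof. by rewrite /bsum big_cat. Qed.

Lemma bsum_cons (e : R) p L y : bsum e (p :: L) y = p.1 * moll e p.2 y + bsum e L y.
Proof. by rewrite /bsum big_cons. Qed.

Lemma bsum_lev (e : R) N c x y : bsum e [seq (c * b.1 x, b.2) | b <- lev r N] y =
  \sum_(j < N) \sum_(l < r) c * basis N j l x * moll e (node r N j l) y.
Proof.
have -> : lev r N = [seq (basis N j l, node r N j l) | j <- index_iota 0 N, l <- enum 'I_r].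
  by rewrite /index_iota subn0.
rewrite /bsum big_map big_allpairs_dep /= big_mkord.
by apply: eq_bigr => j _; rewrite big_enum.
Qed.

Lemma bsum_lev_in (e : R) N c x y j : (0 < N)%N -> (j < N)%N -> cell N j x ->
  bsum e [seq (c * b.1 x, b.2) | b <- lev r N] y = bsum e [seq (c * lag N j l x, node r N j l) | l <- enum 'I_r] y.
Proof.
move=> N0 jN xj; rewrite bsum_lev (bigD1 (Ordinal jN))//= [X in _ + X]big1 ?addr0 => [|i ij]; last first.
  apply: big1 => l _; rewrite /basis ifF ?mulr0 ?mul0r//; apply/negbTE/negP => xi.
  by move: ij; rewrite -val_eqE /= (cell_inj N0 xi xj) eqxx.
rewrite /bsum big_map big_enum /=; apply: eq_bigr => l _.
by rewrite /basis xj.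
Qed.

Lemma bsum_lev_out (e : R) N c x y : (0 < N)%N -> N%:R <= x ->
  bsum e [seq (c * b.1 x, b.2) | b <- lev r N] y = 0.
Proof.
move=> N0 xN; rewrite bsum_lev big1// => j _; apply: big1 => l _.
rewrite /basis ifF ?mulr0 ?mul0r//; apply/negbTE/negP => xj.
by have /andP[_] := cell_lt N0 (ltn_ord j) xj; rewrite ltNge xN.
Qed.

Lemma Efun_bsum (e : R) P x y : bsum e (Efun P x) y = moll e x y + bsum e [seq (-1 * b.1 x, b.2) | b <- P] y.
Proof.
rewrite /Efun bsum_cons mul1r; congr (_ + _); congr (bsum _ _ _).
by apply: eq_map => b; rewrite mulN1r.
Qed.

(** Put [s = sqrt (y / N)]. A point [y] of cell [j] satisfies [j <= s N], and the width
    [(2j + 1) / N] is at most [3j / N <= 3s] when [j >= 1]. In cell [0], [y N <= 1] gives [y <= s]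
    outright. *)
Lemma cell_width N j y x a : (0 < N)%N -> cell N j x -> cell N j y -> 0 <= a -> cella N j <= a \/ j = 0%N -> 
   a <= y -> y - a <= 3 * Num.sqrt (y / N%:R).
Proof.
move=> N0 xj yj a0 aj ay.
have NR : (0 : R) < N%:R by rewrite ltr0n.
have y0 : 0 <= y by exact: le_trans ay.
have yN0 : 0 <= y / N%:R by rewrite divr_ge0// ltW.
set s := Num.sqrt _; have s0 : 0 <= s by exact: sqrtr_ge0.
have ss : s * s = y / N%:R by rewrite -expr2 sqr_sqrtr.
have ssN : s * s * N%:R = y by rewrite ss divfK// gt_eqF.
move: yj; rewrite /cell /cella ler_pdivrMr// ltr_pdivlMr// => /andP[y1 y2].
have js : j%:R <= s * N%:R.
  rewrite -(@ler_pXn2r _ 2)// ?nnegrE ?mulr_ge0 ?ler0n// exprMn.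
  by rewrite (expr2 s) (expr2 (N%:R)) mulrA ssN.
case: aj => [aj|j0]; last first.
  have yle : y * N%:R <= 1 by move: y2; rewrite j0 expr1n => /ltW.
  have sN1 : s * N%:R <= 1.
    by rewrite -(@ler_pXn2r _ 2)// ?nnegrE ?mulr_ge0 ?ler0n// exprMn expr1n (expr2 s) (expr2 (N%:R)) mulrA ssN.
  have : y <= s by rewrite -ssN -mulrA; nra.
  by lra.
have [j0|j0] := posnP j.
  have yle : y * N%:R <= 1 by move: y2; rewrite j0 expr1n => /ltW.
  have sN1 : s * N%:R <= 1.
    by rewrite -(@ler_pXn2r _ 2)// ?nnegrE ?mulr_ge0 ?ler0n// exprMn expr1n (expr2 s) (expr2 (N%:R)) mulrA ssN.
  have : y <= s by rewrite -ssN -mulrA; nra.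
  by lra.
have j1 : (1 : R) <= j%:R by rewrite ler1n.
move: aj; rewrite /cella ler_pdivrMr// => aj.
rewrite -(@ler_pM2r _ N%:R)// mulrBl.
move: y2; rewrite -natr1; nra.
Qed.

Lemma Rep_level N x : (0 < N)%N -> 0 <= x -> U x ->
  Rep U r (Efun (lev r N) x) (fun y => kcell N x y + ktail N x y).
Proof.
move=> N0 x0 Ux; have [xN|xN] := ltP x N%:R; last first.
  apply: (@Rep_mono _ _ _ _ (fun y => if x <= y <= x + 1 then K else 0)).
    by move=> y; rewrite /ktail xN /= lerDr kcell_ge0.
  apply: (@Rep_ext _ _ _ [:: (1, x)]).
    by move=> e y; rewrite Efun_bsum bsum_lev_out// addr0 bsum_cons mul1r /bsum big_nil addr0.
  apply: RepK => // z /=; rewrite in_itv/= => /andP[xz _]; exact: U_ge xz.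
have [j jN xj] := cell_ex N0 x0 xN.
have /andP[n1 n2] := @node_cell R r N N0 j 0 r1.
(* The left end of the functional: the evaluation point or the first node, whichever comes first. *)
pose a := Num.min x (node r N j 0).
have ca : cella N j <= a by rewrite le_min (ltW n1) andbT; move: xj; rewrite /cell => /andP[].
have a0 : 0 <= a by rewrite (le_trans _ ca)// cella_ge0.
have ab : a < cella N j.+1 by rewrite gt_min n2 orbT.
have Ua : U a by rewrite /a /Order.min; case: ifP => // _; apply: U0; rewrite (le_lt_trans _ n1)// cella_ge0.
(* The first node lies the fraction [1/(r+1)] into its cell, so [r + 1] times it is at least the
   right end of the cell. *)
have xa : x / r.+1%:R <= a.
  rewrite le_min; apply/andP; split; first by rewrite ler_pdivrMr ?ltr0n// ler_peMr// ler1n.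
  move: xj; rewrite /cell => /andP[x1 x2].
  rewrite /node mul1r ler_pdivrMr ?ltr0n// mulrDl divfK ?pnatr_eq0//.
  apply: (le_trans (ltW x2)); rewrite -lerBlDr opprB addrC subrK.
  by rewrite ler_peMr ?cella_ge0// ler1n.
apply: (@Rep_ext _ _ _ ((1, x) :: [seq (-1 * lag N j l x, node r N j l) | l <- enum 'I_r])).
  by move=> e y; rewrite Efun_bsum bsum_cons mul1r (bsum_lev_in _ _ _ N0 jN xj).
pose Lc := (1, x) :: [seq (-1 * lag N j l x, node r N j l) | l <- enum 'I_r].
have LamE : \sum_(q <- Lc) `|q.1| <= Lam.
  rewrite /Lc big_cons normr1 lerD2l big_map big_enum /=.
  apply: (@le_trans _ _ (\sum_(l < r) r.+1%:R ^+ r)).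
    by apply: ler_sum => l _; rewrite mulN1r normrN lag_bound.
  by rewrite sumr_const card_ord mulr_natl.
apply: (@Rep_mono _ _ _ _ (fun y => if a <= y < cella N j.+1 then (\sum_(q <- Lc) `|q.1|) * (y - a) ^+ r.-1 else 0)).
  move=> y; case: ifP => [/andP[ay yb]|_]; last by rewrite addr_ge0 ?kcell_ge0 ?ktail_ge0.
  have yj : cell N j y by rewrite /cell yb (le_trans ca).
  rewrite -[leLHS]addr0 lerD ?ktail_ge0//.
  rewrite /kcell (bigD1 (Ordinal jN))//= xj yj (le_trans xa ay)/=.
  rewrite -[leLHS]addr0 lerD//; last first.
    apply: sumr_ge0 => i _; case: ifP => // _.
    by rewrite mulr_ge0// exprn_ge0// mulr_ge0// sqrtr_ge0.
  rewrite ler_pM ?sumr_ge0 ?exprn_ge0 ?subr_ge0//.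
  apply: lerXn2r; rewrite ?nnegrE ?subr_ge0// ?mulr_ge0 ?sqrtr_ge0//.
  by apply: (cell_width N0 xj yj a0 _ ay); left.
apply: Rep_poly => //.
- by move=> z /=; rewrite in_itv/= => /andP[az _]; exact: U_ge az.
- move=> q; rewrite inE => /predU1P[->|/mapP[l _ ->]] /=.
    by rewrite ge_min lexx/=; move: xj; rewrite /cell => /andP[].
  have /andP[m1 m2] := @node_cell R r N N0 j l (ltn_ord l); rewrite m2 andbT ge_min; apply/orP; right.
  rewrite /node lerD2l ler_wpM2l ?subr_ge0 ?cella_le// ler_pM2r ?invr_gt0 ?ltr0n//.
  by rewrite ler_nat.
- move=> P sP; rewrite big_cons mul1r big_map big_enum /= (lag_exact N0 j x r1 sP).
  by rewrite -big_split /= big1// => l _; rewrite mulN1r mulNr subrr.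
Qed.
End kernels.

(** * Weighted integrals of the kernels in the evaluation point *)

Section kernel_integrals.
Context {R : realType} (r : nat) (K alpha : R).
Local Notation mR := (measurableTypeR R).
Local Notation Dp := (`]0%R, +oo[%classic : set mR).
Hypothesis r1 : (1 <= r)%N.
Hypothesis K0 : 0 < K.
Hypothesis a1 : -1 < alpha.
Implicit Types (x y : R) (N j : nat).
Local Notation Lam := (@Lam R r).
Local Notation w0 := (w1 alpha 0).

Lemma int_bound (D : set mR) (F : mR -> R) B a b : 0 <= B -> a <= b ->
  (forall x, D x -> F x <= if a <= x <= b then B else 0) ->
  (\int[leb]_(x in D) (F x)%:E <= (B * (b - a))%:E)%E.
Proof.
move=> B0 ab H.
apply: (@le_trans _ _ (\int[leb]_(x in `[a, b]) B%:E)%E).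
  rewrite integral_mkcond [leRHS]integral_mkcond; apply: integral_mono => x _.
  rewrite /patch; case: ifPn => [/set_mem Dx|_]; last by case: ifP; rewrite lee_fin.
  have := H x Dx; case: ifPn => xab Fx; case: ifPn => /=; rewrite ?lee_fin//.
    by rewrite notin_setE /= in_itv/= xab.
  by move=> _; exact: le_trans Fx B0.
rewrite integral_cst//= lebesgue_measure_itv/= lte_fin.
move: ab; rewrite le_eqVlt => /predU1P[->|ab]; first by rewrite ltxx mule0 subrr mulr0.
by rewrite ab -EFinD -EFinM.
Qed.

Lemma int_bound_powR (D : set mR) (F : mR -> R) B c : 0 <= B -> 0 < c ->
  (forall x, D x -> F x <= if 0 < x <= c then B * x `^ alpha else 0) ->
  (\int[leb]_(x in D) (F x)%:E <= (B * ((alpha + 1)^-1 * c `^ (alpha + 1)))%:E)%E.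
Proof.
move=> B0 c0 H.
apply: (@le_trans _ _ (\int[leb]_(x in `]0%R, c]) (B%:E * (x `^ alpha)%:E))%E).
  rewrite integral_mkcond [leRHS]integral_mkcond; apply: integral_mono => x _.
  rewrite /patch; case: ifPn => [/set_mem Dx|_]; last first.
    by case: ifP => _; rewrite -?EFinM lee_fin// mulr_ge0// powR_ge0.
  have := H x Dx; case: ifPn => xab Fx; case: ifPn => /=; rewrite -?EFinM ?lee_fin//.
    by rewrite notin_setE /= in_itv/= xab.
  by move=> _; rewrite (le_trans Fx)// mulr_ge0// powR_ge0.
rewrite ge0_integralZl//; last 2 first.
- by apply/measurable_EFinP/measurable_funTS; exact: measurable_powR.
- by move=> x _; rewrite lee_fin powR_ge0.
by rewrite EFinM lee_wpmul2l ?lee_fin// integral_powR.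
Qed.

Lemma sqrt_divN N y : 0 <= y -> Num.sqrt (y / N%:R) = Num.sqrt y * (Num.sqrt N%:R)^-1.
Proof. by move=> y0; rewrite sqrtrM// sqrtrV// ler0n. Qed.

Lemma measurable_cell N j : measurable_fun [set: mR] (cell N j : mR -> bool).
Proof.
apply: measurable_and; first by apply: measurable_fun_ler; [exact: measurable_cst|exact: measurable_id].
by apply: measurable_fun_ltr; [exact: measurable_id|exact: measurable_cst].
Qed.

(** The target is the cell width times [w_0 y]. In a cell with [j >= 1] the ends have ratio at most
    [4] and distance at most [2], so [w_0] is comparable across it. Cell [0] contains the
    singularity: there [x <= (r+1) y] bounds the integral by a multiple of [y^(alpha + 1)], and
    [y <= sqrt (y / N)]. *)
Lemma cell_weight : exists2 C, 0 < C & forall N j y, (0 < N)%N -> (j < N)%N -> 0 < y -> cell N j y ->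
  (\int[leb]_(x in Dp) ((if cell N j x && (x / r.+1%:R <= y) then 1 else 0) * w0 x)%:E <=
   (C * Num.sqrt (y / N%:R) * w0 y)%:E)%E.
Proof.
have a10 : 0 < alpha + 1 by rewrite -ltrBlDr sub0r.
pose C1 := (alpha + 1)^-1 * r.+1%:R `^ (alpha + 1) * expR 1.
have C10 : 0 <= C1 by rewrite !mulr_ge0 ?powR_ge0 ?expR_ge0// invr_ge0 ltW.
pose C2 : R := 4 `^ `|alpha| * expR 2 * 3.
have C20 : 0 <= C2 by rewrite !mulr_ge0 ?powR_ge0 ?expR_ge0.
exists (C1 + C2 + 1); first by rewrite ltr_wpDl// addr_ge0.
move=> N j y N0 jN y0 yj.
have NR : (0 : R) < N%:R by rewrite ltr0n.
have N1 : (1 : R) <= N%:R by rewrite ler1n.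
have yN0 : 0 <= y / N%:R by rewrite divr_ge0// ltW.
have wy0 : 0 <= w0 y by exact: w1_ge0.
have [s0 ss] : 0 <= Num.sqrt (y / N%:R) /\ Num.sqrt (y / N%:R) * Num.sqrt (y / N%:R) = y / N%:R.
  by split; [exact: sqrtr_ge0|rewrite -expr2 sqr_sqrtr].
move: (Num.sqrt _) s0 ss => s s0 ss.
have ssN : s * s * N%:R = y by rewrite ss divfK// gt_eqF.
have fin C' : 0 <= C' -> C' <= C1 + C2 + 1 -> ((C' * s * w0 y)%:E <= ((C1 + C2 + 1) * s * w0 y)%:E)%E.
  by move=> C'0 C'C; rewrite lee_fin ler_wpM2r// ler_wpM2r.
have [j0|j0] := posnP j.
  apply: le_trans (fin C1 C10 _); last by lra.
  move: yj; rewrite j0 /cell /cella expr1n => /andP[_]; rewrite ltr_pdivlMr// => yN.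
  have sN1 : s * N%:R <= 1.
    rewrite -(@ler_pXn2r _ 2)// ?nnegrE ?mulr_ge0 ?ler0n// exprMn expr1n.
    by rewrite (expr2 s) (expr2 (N%:R)) mulrA ssN ltW.
  have ys : y <= s by rewrite -ssN -mulrA; nra.
  have y1 : y <= 1 by nra.
  apply: le_trans (@int_bound_powR _ _ 1 (r.+1%:R * y) ler01 _ _) _.
  - by rewrite mulr_gt0// ltr0n.
  - move=> x; rewrite /= in_itv/= andbT => x0; rewrite x0 /=.
    case: ifP => [/andP[_ xr]|_]; last by rewrite mul0r; case: ifP => // _; rewrite mul1r powR_ge0.
    move: xr; rewrite ler_pdivrMr ?ltr0n// mulrC => ->.
    by rewrite !mul1r w1E// expr0 mulr1 ler_piMr ?powR_ge0// -[leRHS]expR0 ler_expR oppr_le0 ltW.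
  rewrite lee_fin mul1r powRM ?ler0n ?(ltW y0)//.
  rewrite w1E// expr0 mulr1 [y `^ (alpha + 1)]powRD; last by rewrite (gt_eqF y0) implybT.
  rewrite powRr1 ?(ltW y0)//.
  have e1 : 1 <= expR 1 * expR (- y) by rewrite -expRD -[leLHS]expR0 ler_expR; lra.
  have A0 : 0 <= (alpha + 1)^-1 * r.+1%:R `^ (alpha + 1) * y `^ alpha.
    by rewrite !mulr_ge0 ?powR_ge0// invr_ge0 ltW.
  rewrite (_ : _ * (_ * (_ * y)) = ((alpha + 1)^-1 * r.+1%:R `^ (alpha + 1) * y `^ alpha) * y); last by ring.
  rewrite (_ : C1 * s * _ = ((alpha + 1)^-1 * r.+1%:R `^ (alpha + 1) * y `^ alpha) * (s * (expR 1 * expR (- y)))); last by rewrite /C1; ring.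
  by rewrite ler_wpM2l// (le_trans ys)// ler_peMr.
apply: le_trans (fin C2 C20 _); last by lra.
have j1 : (1 : R) <= j%:R by rewrite ler1n.
have jr0 : (0 : R) < j%:R by exact: lt_le_trans j1.
have hw : cella N j.+1 - cella N j <= 3 * (s : R).
  have js : j%:R <= s * N%:R.
    rewrite -(@ler_pXn2r _ 2)// ?nnegrE ?mulr_ge0 ?ler0n// exprMn.
    rewrite (expr2 s) (expr2 (N%:R)) mulrA ssN.
    by move: yj; rewrite /cell /cella ler_pdivrMr// => /andP[].
  rewrite /cella -mulrBl ler_pdivrMr// -natr1; nra.
have h2 : cella N j.+1 - cella N j <= (2 : R).
  have : (j.+1%:R : R) <= N%:R by rewrite ler_nat.
  by rewrite -natr1 => jN'; rewrite /cella -mulrBl ler_pdivrMr// -natr1; lra.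
have c4 : cella N j.+1 <= 4 * cella N j :> R.
  by rewrite /cella mulrA ler_pM2r ?invr_gt0// -natr1; nra.
have ca0 : (0 : R) < cella N j by rewrite divr_gt0// exprn_gt0.
have cab : (cella N j : R) <= cella N j.+1 by exact: cella_le.
move: yj; rewrite /cell => /andP[ya yb].
move: (cella N j) (cella N j.+1) hw h2 c4 ca0 cab ya yb => a b hw h2 c4 ca0 cab ya yb.
apply: le_trans (@int_bound _ _ (4 `^ `|alpha| * expR 2 * w0 y) a b _ cab _) _.
- by rewrite !mulr_ge0 ?powR_ge0 ?expR_ge0.
- move=> x _; case: ifP => [/andP[/andP[xa xb] _]|_]; last first.
    by rewrite mul0r; case: ifP => // _; rewrite !mulr_ge0 ?powR_ge0 ?expR_ge0.
  rewrite xa (ltW xb)/= mul1r; apply: w1_compare; lra.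
rewrite lee_fin /C2.
have P0 : 0 <= 4 `^ `|alpha| * expR 2 :> R by rewrite mulr_ge0 ?powR_ge0 ?expR_ge0.
move: (4 `^ _ * expR 2) P0 => P P0.
rewrite (_ : P * 3 * s * w0 y = P * w0 y * (3 * s)); last by ring.
by rewrite ler_wpM2l// mulr_ge0.
Qed.

Let Lam0 : 0 <= Lam.
Proof. by rewrite addr_ge0// mulr_ge0 ?exprn_ge0 ?ler0n. Qed.

(** The kernel supplies [sqrt (y / N)] to the power [r - 1] and [cell_weight] one more factor;
    together with [w_0 y] they make [N^(-r/2) w_r y]. *)
Lemma kcell_int : exists2 C, 0 < C & forall N y, (0 < N)%N -> 0 < y ->
  (\int[leb]_(x in Dp) (kcell r N x y * w0 x)%:E <=
   (C * (Num.sqrt N%:R)^-1 ^+ r * w1 alpha r y)%:E)%E.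
Proof.
have [C C0 HC] := cell_weight.
exists (Lam * 3 ^+ r.-1 * C + 1); first by rewrite ltr_wpDl// !mulr_ge0 ?exprn_ge0// ltW.
move=> N y N0 y0.
have rhs0 : 0 <= (Lam * 3 ^+ r.-1 * C + 1) * (Num.sqrt N%:R)^-1 ^+ r * w1 alpha r y.
  rewrite mulr_ge0 ?w1_ge0// mulr_ge0 ?exprn_ge0 ?invr_ge0 ?sqrtr_ge0//.
  by rewrite addr_ge0// !mulr_ge0 ?exprn_ge0// ltW.
have [yN|yN] := ltP y N%:R; last first.
  rewrite integral0_eq ?lee_fin// => x _.
  rewrite /kcell big1 ?mul0r// => j _; rewrite ifF//; apply/negbTE/and3P => -[_ yj _].
  by have /andP[_] := cell_lt N0 (ltn_ord j) yj; rewrite ltNge yN.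
have [j jN yj] := cell_ex N0 (ltW y0) yN.
have E x : kcell r N x y = (Lam * (3 * Num.sqrt (y / N%:R)) ^+ r.-1) * (if cell N j x && (x / r.+1%:R <= y) then 1 else 0).
  rewrite /kcell (bigD1 (Ordinal jN))//= yj /= big1 ?addr0 => [|i ij].
    by case: ifP => _; rewrite ?mulr1 ?mulr0.
  rewrite ifF//; apply/negbTE/and3P => -[_ yi _].
  by move: ij; rewrite -val_eqE /= (cell_inj N0 yi yj) eqxx.
have M0 : 0 <= Lam * (3 * Num.sqrt (y / N%:R)) ^+ r.-1 by rewrite mulr_ge0// exprn_ge0// mulr_ge0// sqrtr_ge0.
under eq_integral do rewrite E -mulrA EFinM.
rewrite ge0_integralZl//; last 2 first.
- apply/measurable_EFinP/measurable_funTS; apply: measurable_funM; last exact: measurable_w1.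
  apply: measurable_fun_ifT => //; apply: measurable_and; first exact: measurable_cell.
  apply: measurable_fun_ler; last exact: measurable_cst.
  by apply: measurable_funM; [exact: measurable_id|exact: measurable_cst].
- by move=> x _; rewrite lee_fin mulr_ge0 ?w1_ge0//; case: ifP.
apply: le_trans (lee_wpmul2l _ (HC _ _ _ N0 jN y0 yj)) _; first by rewrite lee_fin.
rewrite -EFinM lee_fin w1E// expr0 mulr1 (w1E _ _ y0) sqrt_divN ?(ltW y0)//.
set q := (Num.sqrt N%:R)^-1; set s := Num.sqrt y.
have q0 : 0 <= q by rewrite invr_ge0 sqrtr_ge0.
have s0 : 0 <= s by exact: sqrtr_ge0.
have e0 : 0 <= y `^ alpha * expR (- y) by rewrite mulr_ge0 ?powR_ge0 ?expR_ge0.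
rewrite exprMn (_ : _ * (C * _ * _) = Lam * 3 ^+ r.-1 * C * ((s * q) ^+ r.-1 * (s * q)) * (y `^ alpha * expR (- y))); last by ring.
rewrite -exprSr prednK// exprMn.
rewrite (_ : (_ + 1) * _ * _ = (Lam * 3 ^+ r.-1 * C + 1) * (s ^+ r * q ^+ r) * (y `^ alpha * expR (- y))); last by ring.
by rewrite ler_wpM2r// ler_wpM2r ?mulr_ge0 ?exprn_ge0// lerDl.
Qed.

(** This kernel is not small, but it acts only where [y >= x >= N], and there [w_r] exceeds [w_0] by
    the factor [y^(r/2) >= N^(r/2)]. *)
Lemma ktail_int : exists2 C, 0 < C & forall N y, (0 < N)%N -> 0 < y ->
  (\int[leb]_(x in Dp) (ktail K N x y * w0 x)%:E <=
   (C * (Num.sqrt N%:R)^-1 ^+ r * w1 alpha r y)%:E)%E.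
Proof.
pose P : R := 2 `^ `|alpha| * expR 1.
have P0 : 0 < P by rewrite mulr_gt0 ?expR_gt0 ?powR_gt0.
exists (K * P); first by rewrite mulr_gt0.
move=> N y N0 y0.
have NR : (0 : R) < N%:R by rewrite ltr0n.
have N1 : (1 : R) <= N%:R by rewrite ler1n.
have q0 : 0 < Num.sqrt N%:R :> R by rewrite sqrtr_gt0.
have rhs0 : 0 <= K * P * (Num.sqrt N%:R)^-1 ^+ r * w1 alpha r y.
  by rewrite mulr_ge0 ?w1_ge0// mulr_ge0 ?exprn_ge0 ?invr_ge0 ?sqrtr_ge0// mulr_ge0 ?ltW.
have [yN|yN] := ltP y N%:R.
  rewrite integral0_eq ?lee_fin// => x _.
  rewrite /ktail ifF ?mul0r//; apply/negbTE/and3P => -[Nx xy _].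
  by move: (le_lt_trans xy yN); rewrite ltNge Nx.
apply: le_trans (@int_bound _ _ (K * (P * w0 y)) (y - 1) y _ _ _) _.
- by rewrite !mulr_ge0 ?w1_ge0 ?(ltW K0) ?(ltW P0).
- by lra.
- move=> x _; rewrite /ktail; case: ifP => [/and3P[Nx xy yx]|_]; last first.
    by rewrite mul0r; case: ifP => // _; rewrite !mulr_ge0 ?w1_ge0 ?(ltW K0) ?(ltW P0).
  rewrite ifT; last by rewrite xy andbT; lra.
  by rewrite ler_wpM2l ?(ltW K0)//; apply: w1_compare; lra.
rewrite lee_fin (_ : y - (y - 1) = 1) ?mulr1; last by ring.
rewrite mulrA -[leRHS]mulrA ler_wpM2l ?(ltW (mulr_gt0 _ _))// !w1E// expr0 mulr1.
rewrite (_ : _ ^+ r * (_) = (y `^ alpha * expR (- y)) * (Num.sqrt y / Num.sqrt N%:R) ^+ r); last first.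
  by rewrite exprMn; ring.
rewrite ler_peMr ?mulr_ge0 ?powR_ge0 ?expR_ge0// exprn_ege1// ler_pdivlMr// mul1r.
by rewrite ler_wsqrtr.
Qed.

Lemma kone_int : exists2 C, 0 < C & forall y, 0 < y ->
  (\int[leb]_(x in Dp) (kone r K x y * w0 x)%:E <= (C * w1 alpha r y)%:E)%E.
Proof.
have a10 : 0 < alpha + 1 by rewrite -ltrBlDr sub0r.
pose c : R := 2 * r.+1%:R.
have r0 : (0 : R) < r.+1%:R by rewrite ltr0n.
have r11 : (1 : R) <= r.+1%:R by rewrite ler1n.
have c0 : 0 < c by rewrite mulr_gt0.
(* A lower bound for [w_r] on [[1/(r+1), 2]], the range of [y] where the kernel lives; [c] makes [1]
   and [y] comparable there. *)
pose m := c `^ (- `|alpha|) * Num.sqrt (r.+1%:R^-1) ^+ r * expR (- 2).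
have m0 : 0 < m by rewrite !mulr_gt0 ?powR_gt0 ?expR_gt0// exprn_gt0// sqrtr_gt0 invr_gt0.
have LK0 : 0 <= Lam * K * (alpha + 1)^-1 by rewrite !mulr_ge0 ?(ltW K0)// invr_ge0 ltW.
exists ((Lam * K * (alpha + 1)^-1 + 1) / m); first by rewrite divr_gt0// ltr_wpDl.
move=> y y0.
have rhs0 : 0 <= (Lam * K * (alpha + 1)^-1 + 1) / m * w1 alpha r y.
  by rewrite mulr_ge0 ?w1_ge0// divr_ge0 ?(ltW m0)// addr_ge0.
have [yt|yt] := boolP (r.+1%:R^-1 <= y <= 2); last first.
  by rewrite integral0_eq ?lee_fin// => x _; rewrite /kone (negbTE yt) andbF mul0r.
apply: le_trans (@int_bound_powR _ _ (Lam * K) 1 _ ltr01 _) _.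
- by rewrite mulr_ge0// ltW.
- move=> x; rewrite /= in_itv/= andbT => x0; rewrite /kone yt andbT x0 /=.
  case: ifP => [x1|_]; last by rewrite mul0r; case: ifP => // _; rewrite !mulr_ge0 ?powR_ge0// ltW.
  rewrite (ltW x1) ler_wpM2l ?mulr_ge0 ?(ltW K0)// w1E// expr0 mulr1 ler_piMr ?powR_ge0//.
  by rewrite -[leRHS]expR0 ler_expR oppr_le0 ltW.
rewrite lee_fin powR1 mulr1.
have my : m <= w1 alpha r y.
  move: yt => /andP[ty y2]; rewrite w1E// /m; apply: ler_pM.
  - by rewrite mulr_ge0 ?powR_ge0// exprn_ge0// sqrtr_ge0.
  - exact: expR_ge0.
  - apply: ler_pM; rewrite ?powR_ge0 ?exprn_ge0 ?sqrtr_ge0//.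
      have := @powR_compare _ alpha c 1 y ltr01 y0; rewrite powR1 mulr1 => H.
      rewrite powRN -[leLHS]mul1r ler_pdivrMr ?powR_gt0// mulrC; apply: H.
        by move: ty; rewrite /c -div1r ler_pdivrMr// => ty; rewrite -mulrA; nra.
      by rewrite /c; lra.
    by apply: lerXn2r; rewrite ?nnegrE ?sqrtr_ge0// ler_wsqrtr.
  - by rewrite ler_expR; lra.
rewrite -[leRHS]mulrA; apply: (@le_trans _ _ ((Lam * K * (alpha + 1)^-1 + 1) * 1)).
  by rewrite mulr1 lerDl.
by rewrite ler_wpM2l ?addr_ge0// ler_pdivlMl// mulr1.
Qed.
End kernel_integrals.

(** * Dyadic levels on the half-line *)

Section poslevels.
Context {R : realType} (r : nat) (K alpha : R).
Local Notation mR := (measurableTypeR R).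
Local Notation Dp := (`]0%R, +oo[%classic : set mR).
Hypothesis r1 : (1 <= r)%N.
Hypothesis K0 : 0 < K.
Hypothesis a1 : -1 < alpha.
Implicit Types (x y : R) (N j k : nat).
Local Notation Lam := (@Lam R r).
Local Notation w0 := (w1 alpha 0).

Definition Ppos k : seq ((R -> R) * R) := if k is k'.+1 then lev r (2 ^ k') else [::].
(** At level [0] the error is the evaluation at [x]. Its unit-interval kernel would have an
    [x]-integral of order [y^(alpha + 1)] at small [y], too large against [w_r y] when [r > 2]. The
    evaluation is therefore split into the one-cell interpolant and the one-cell error. *)
Definition Mpos k x y : R := if k is k'.+1 then kcell r (2 ^ k') x y + ktail K (2 ^ k') x y
  else kone r K x y + (kcell r 1 x y + ktail K 1 x y).

Lemma Mpos_ge0 k x y : 0 <= Mpos k x y.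
Proof. by case: k => [|k]; rewrite /Mpos !addr_ge0 ?kone_ge0 ?kcell_ge0 ?ktail_ge0. Qed.

(** Used to join two half-lines: a kernel with positive [x] never reaches the other side, so each
    [y] of the line receives mass from one side only. *)
Lemma Mpos_out k x y : 0 < x -> y <= 0 -> Mpos k x y = 0.
Proof.
move=> x0 y0.
have kc N : kcell r N x y = 0.
  apply: big1 => j _; rewrite ifF//; apply/negbTE/and3P => -[_ _ H].
  by have := le_trans H y0; rewrite leNgt divr_gt0// ltr0n.
have kt N : ktail K N x y = 0.
  by rewrite /ktail ifF//; apply/negbTE/and3P => -[_ H _]; have := lt_le_trans x0 (le_trans H y0); rewrite ltxx.
have ko : kone r K x y = 0.
  by rewrite /kone ifF//; apply/negbTE/and3P => -[_ H _]; have := le_trans H y0; rewrite leNgt invr_gt0 ltr0n.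
by case: k => [|k]; rewrite /Mpos ?ko ?kc ?kt ?addr0.
Qed.

(** The number [2^(-r/2)], the gain in accuracy per level. *)
Definition q : R := (Num.sqrt 2)^-1 ^+ r.

Lemma q_gt0 : 0 < q. Proof. by rewrite exprn_gt0// invr_gt0 sqrtr_gt0. Qed.

Lemma q_level k : (Num.sqrt (2 ^ k)%:R)^-1 ^+ r = q ^+ k :> R.
Proof.
rewrite /q -exprM mulnC exprM; congr (_ ^+ r).
rewrite natrX exprVn; congr (_^-1).
elim: k => [|k IH]; first by rewrite !expr0 sqrtr1.
by rewrite !exprS sqrtrM// IH.
Qed.

Lemma measurable_kcell N : measurable_fun [set: mR * mR] (fun p : mR * mR => kcell r N p.1 p.2).
Proof.
apply: measurable_sum => j.
apply: measurable_fun_ifT; last exact: measurable_cst.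
  apply: measurable_and; first exact: (measurableT_comp (@measurable_cell R N j) (@measurable_fst _ _ mR mR)).
  apply: measurable_and; first exact: (measurableT_comp (@measurable_cell R N j) (@measurable_snd _ _ mR mR)).
  apply: measurable_fun_ler; last exact: measurable_snd.
  by apply: measurable_funM; [exact: measurable_fst|exact: measurable_cst].
apply: measurable_funM; first exact: measurable_cst.
apply: measurable_funX; apply: measurable_funM; first exact: measurable_cst.
apply: (measurableT_comp (@continuous_measurable_fun R _ (@sqrt_continuous R))).
by apply: measurable_funM; [exact: measurable_snd|exact: measurable_cst].
Qed.

Lemma measurable_ktail N : measurable_fun [set: mR * mR] (fun p : mR * mR => ktail K N p.1 p.2).
Proof.
apply: measurable_fun_ifT; [|exact: measurable_cst|exact: measurable_cst].
apply: measurable_and; first by apply: measurable_fun_ler; [exact: measurable_cst|exact: measurable_fst].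
apply: measurable_and; first by apply: measurable_fun_ler; [exact: measurable_fst|exact: measurable_snd].
apply: measurable_fun_ler; first exact: measurable_snd.
by apply: measurable_funD; [exact: measurable_fst|exact: measurable_cst].
Qed.

Lemma measurable_kone : measurable_fun [set: mR * mR] (fun p : mR * mR => kone r K p.1 p.2).
Proof.
apply: measurable_fun_ifT; [|exact: measurable_cst|exact: measurable_cst].
apply: measurable_and; first by apply: measurable_fun_ltr; [exact: measurable_fst|exact: measurable_cst].
apply: measurable_and; apply: measurable_fun_ler; try exact: measurable_cst; exact: measurable_snd.
Qed.

Lemma measurable_Mpos k : measurable_fun [set: mR * mR] (fun p : mR * mR => Mpos k p.1 p.2).
Proof.
case: k => [|k]; rewrite /Mpos.
  apply: measurable_funD; first exact: measurable_kone.
  by apply: measurable_funD; [exact: measurable_kcell|exact: measurable_ktail].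
by apply: measurable_funD; [exact: measurable_kcell|exact: measurable_ktail].
Qed.

Lemma Mpos_int : exists2 C, 0 < C & forall k y, 0 < y ->
  (\int[leb]_(x in Dp) (Mpos k x y * w0 x)%:E <= (C * q ^+ k * w1 alpha r y)%:E)%E.
Proof.
have [C1 C10 H1] := kcell_int r1 a1.
have [C2 C20 H2] := ktail_int r alpha K0.
have [C3 C30 H3] := kone_int r K0 a1.
have q0 := q_gt0.
have mk (F : mR * mR -> R) y : measurable_fun setT F -> measurable_fun Dp (fun x : mR => (F (x, y) * w0 x)%:E).
  move=> mF; apply/measurable_EFinP/measurable_funTS; apply: measurable_funM; last exact: measurable_w1.
  exact: (measurableT_comp mF (pair2_measurable y)).
have pos (F : mR * mR -> R) y : (forall p, 0 <= F p) -> forall x, Dp x -> (0 <= (F (x, y) * w0 x)%:E)%E.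
  by move=> F0 x _; rewrite lee_fin mulr_ge0 ?w1_ge0.
have sum N y : (0 < N)%N -> 0 < y -> (\int[leb]_(x in Dp) ((kcell r N x y + ktail K N x y) * w0 x)%:E <=
    ((C1 + C2) * (Num.sqrt N%:R)^-1 ^+ r * w1 alpha r y)%:E)%E.
  move=> N0 y0; under eq_integral do rewrite mulrDl EFinD.
  rewrite ge0_integralD//; last 4 first.
  - by move=> x Dx; apply: (pos (fun p => kcell r N p.1 p.2)) => // p; exact: kcell_ge0.
  - exact: (mk (fun p => kcell r N p.1 p.2) y (measurable_kcell N)).
  - by move=> x Dx; apply: (pos (fun p => ktail K N p.1 p.2)) => // p; exact: ktail_ge0.
  - exact: (mk (fun p => ktail K N p.1 p.2) y (measurable_ktail N)).
  by rewrite !mulrDl EFinD leeD ?H1 ?H2.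
(* The division by [q] pays for the index shift: level [k] has [N = 2^(k-1)]. The term [C3] serves
   level [0]. *)
exists (C3 + (C1 + C2) / q + (C1 + C2)); first by rewrite !addr_gt0// divr_gt0// addr_gt0.
move=> k y y0; have W := w1_ge0 alpha r y.
case: k => [|k]; rewrite /Mpos.
  under eq_integral do rewrite mulrDl EFinD.
  rewrite ge0_integralD//; last 4 first.
  - by move=> x Dx; apply: (pos (fun p => kone r K p.1 p.2)) => // p; exact: kone_ge0.
  - exact: (mk (fun p => kone r K p.1 p.2) y measurable_kone).
  - move=> x Dx; apply: (pos (fun p => kcell r 1 p.1 p.2 + ktail K 1 p.1 p.2)) => // p.
    by rewrite addr_ge0 ?kcell_ge0 ?ktail_ge0.
  - apply: (mk (fun p => kcell r 1 p.1 p.2 + ktail K 1 p.1 p.2)).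
    by apply: measurable_funD; [exact: measurable_kcell|exact: measurable_ktail].
  apply: le_trans (leeD (H3 y y0) (sum 1%N y isT y0)) _.
  rewrite -EFinD lee_fin sqrtr1 invr1 expr1n mulr1 -mulrDl expr0 mulr1 ler_wpM2r//.
  by rewrite lerD2r lerDl divr_ge0 ?(ltW q0)// addr_ge0 ?ltW.
apply: le_trans (sum (2 ^ k)%N y _ y0) _; first by rewrite expn_gt0.
rewrite q_level lee_fin ler_wpM2r// exprS mulrA ler_wpM2r ?exprn_ge0 ?(ltW q0)//.
have -> : (C3 + (C1 + C2) / q + (C1 + C2)) * q = C1 + C2 + (C3 + (C1 + C2)) * q.
  by field; rewrite gt_eqF.
by rewrite lerDl mulr_ge0 ?(ltW q0)// !addr_ge0 ?(ltW C10) ?(ltW C20) ?(ltW C30).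
Qed.

Lemma basis_bound N j (l : 'I_r) x : (0 < N)%N -> (j < N)%N -> 0 < x ->
  `|basis N j l x * w0 x| <= if 0 < x <= N%:R then r.+1%:R ^+ r * x `^ alpha else 0.
Proof.
move=> N0 jN x0; rewrite /basis x0 /=; case: ifP => [xj|_]; last first.
  by rewrite mul0r normr0; case: ifP => // _; rewrite mulr_ge0 ?powR_ge0// exprn_ge0.
have /andP[_ /ltW ->] := cell_lt N0 jN xj.
rewrite normrM (ger0_norm (w1_ge0 _ _ _)) ler_pM ?w1_ge0 ?(lag_bound N0)//.
by rewrite w1E// expr0 mulr1 ler_piMr ?powR_ge0// -[leRHS]expR0 ler_expR oppr_le0 ltW.
Qed.

Lemma measurable_basis N j (l : 'I_r) : measurable_fun [set: mR] (basis N j l : mR -> R).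
Proof.
apply: measurable_fun_ifT; [exact: measurable_cell| |exact: measurable_cst].
apply: continuous_measurable_fun.
exact: (is_derive_continuous (fun x => is_derive_horner _ x)).
Qed.

Lemma basis_int N j (l : 'I_r) : (0 < N)%N -> (j < N)%N ->
  (\int[leb]_(x in Dp) (`|basis N j l x * w0 x|)%:E < +oo)%E.
Proof.
move=> N0 jN; apply: le_lt_trans (@int_bound_powR _ _ a1 _ _ (r.+1%:R ^+ r) N%:R _ _ _) (ltry _).
- by rewrite exprn_ge0.
- by rewrite ltr0n.
- by move=> x; rewrite /= in_itv/= andbT => x0; exact: basis_bound.
Qed.
End poslevels.

(** * Representation of the errors of all levels *)

Section Rep_pos.
Context {R : realType} (r : nat) (U : set R) (K : R).
Hypothesis r1 : (1 <= r)%N.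
Hypothesis U0 : forall x, 0 < x -> U x.
Hypothesis iU : forall a b c : R, U a -> U b -> a <= c <= b -> U c.
Hypothesis K0 : 0 < K.
Hypothesis RepK : forall p, 0 <= p -> `[p, p + 1] `<=` U ->
  Rep U r [:: (1, p)] (fun y => if p <= y <= p + 1 then K else 0).
Implicit Types (x y : R) (N j : nat).
Local Notation Lam := (@Lam R r).

Lemma Rep_scale c L M : Rep U r L M -> Rep U r [seq (c * q.1, q.2) | q <- L] (fun y => `|c| * M y).
Proof.
move=> [e0 e0p H]; exists e0 => // e ep ee; have [phi [A1 A2 [a [b [ab abU A3]]] A4]] := H e ep ee.
exists (fun k y => c * phi k y); split.
- by move=> k; exact: CooZ.
- by move=> k y; rewrite normrM ler_wpM2l.
- by exists a, b; split=> // k y /A3 ->; rewrite mulr0.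
- move=> y; rewrite /bsum big_map /=.
  under eq_bigr do rewrite -mulrA.
  rewrite -mulr_sumr -/(bsum e L y) A4 mulr_sumr; apply: eq_bigr => k _.
  by rewrite iter_deriveZ// mulrCA.
Qed.

Lemma Rep_nil : Rep U r [::] (fun=> 0).
Proof.
exists 1 => // e ep e1; exists (fun k y => 0); split=> //.
- by move=> k; exact: Coo_cst.
- by move=> k y; rewrite normr0.
- exists 1, 1; split=> // z /=; rewrite in_itv/= => /andP[z1 _]; apply: U0; exact: lt_le_trans z1.
- move=> y; rewrite /bsum big_nil big1// => k _.
  by rewrite iter_derive0 mulr0.
Qed.

Lemma Rep_points L : (forall q, q \in L -> r.+1%:R^-1 <= q.2 <= 1) ->
  Rep U r L (fun y => (\sum_(q <- L) `|q.1|) * (if r.+1%:R^-1 <= y <= 2 then K else 0)).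
Proof.
elim: L => [|[c p] L IH] Lp.
  apply: (Rep_mono _ Rep_nil) => y; by rewrite big_nil mul0r.
have /andP[/= p1 p2] := Lp _ (mem_head _ _).
have t0 : (0 : R) < r.+1%:R^-1 by rewrite invr_gt0 ltr0n.
have p0 : 0 <= p by rewrite (le_trans _ p1)// ltW.
have R1 : Rep U r [:: (1, p)] (fun y => if p <= y <= p + 1 then K else 0).
  apply: RepK => // z /=; rewrite in_itv/= => /andP[pz _]; apply: U0.
  by rewrite (lt_le_trans t0)// (le_trans p1).
have R2 := IH (fun q qL => Lp q (@mem_behead _ (_ :: L) q qL)).
have R3 := Rep_add iU (Rep_scale c R1) R2.
apply: (Rep_mono _ (Rep_ext _ R3)); last by move=> e y; rewrite /= mulr1.
move=> y; rewrite big_cons mulrDl lerD2r ler_wpM2l//.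
case: ifP => [/andP[py yp]|_]; last by case: ifP => // _; exact: ltW.
by rewrite (le_trans p1 py) (le_trans yp)//; lra.
Qed.

Lemma Rep_one x : 0 <= x -> Rep U r [seq (b.1 x, b.2) | b <- lev r 1] (kone r K x).
Proof.
move=> x0.
have E e y : bsum e [seq (b.1 x, b.2) | b <- lev r 1] y = bsum e [seq (1 * b.1 x, b.2) | b <- lev r 1] y.
  by congr (bsum _ _ _); apply: eq_map => b; rewrite mul1r.
have [x1|x1] := ltP x 1; last first.
  apply: (Rep_mono _ (Rep_ext _ Rep_nil)) => [y|e y]; first exact: kone_ge0.
  by rewrite E bsum_lev_out// /bsum big_nil.
have xj : cell 1 0 x by rewrite /cell /cella expr0n expr1n mul0r divr1 x0.
have R1 : Rep U r [seq (1 * lag 1 0 l x, node r 1 0 l) | l <- enum 'I_r] _ := @Rep_points _ _.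
  apply: (Rep_mono _ (Rep_ext _ (R1 _))).
  - move=> y; rewrite /kone x1 /=; case: ifP => _; last by rewrite mulr0.
    rewrite ler_wpM2r ?(ltW K0)// big_map big_enum /= /Lam.
    rewrite -[leLHS]add0r lerD// (@le_trans _ _ (\sum_(l < r) r.+1%:R ^+ r))//.
      by apply: ler_sum => l _; rewrite mul1r lag_bound.
    by rewrite sumr_const card_ord mulr_natl.
  - by move=> e y; rewrite E (@bsum_lev_in R r e 1 1 x y 0 isT isT xj).
  - move=> q /mapP[l _ ->] /=.
    have /andP[_ n2] := @node_cell R r 1 isT 0 l (ltn_ord l).
    move: n2; rewrite /node /cella expr0n expr1n mul0r divr1 subr0 add0r mul1r => n2.
    by rewrite (ltW n2) andbT -[leLHS]mul1r ler_pM2r ?invr_gt0 ?ltr0n// ler1n.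
Qed.

Lemma Rep_Ppos k x : 0 <= x -> U x -> Rep U r (Efun (Ppos r k) x) (Mpos r K k x).
Proof.
move=> x0 Ux; case: k => [|k] /=; last by apply: Rep_level => //; rewrite expn_gt0.
(* Level [0] has no nodes, so its error functional is the evaluation at [x]: the one-cell
   interpolant plus its error, the node terms cancelling. *)
have R2 := Rep_level r1 U0 K0 RepK (isT : (0 < 1)%N) x0 Ux.
apply: (Rep_ext _ (Rep_add iU (Rep_one x0) R2)) => e y.
rewrite bsum_cat !Efun_bsum /= [RHS]addrC /bsum big_nil add0r addrCA -[RHS]addr0; congr (_ + _).
rewrite !big_map -big_split big1//= => b _.
by rewrite mulN1r mulNr subrr.
Qed.
End Rep_pos.

(** * Reflection, and the levels on the line *)

Section twosided.
Context {R : realType}.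
Local Notation mR := (measurableTypeR R).
Local Notation Dp := (`]0%R, +oo[%classic : set mR).
Local Open Scope ereal_scope.

Lemma integral_reflect (F : mR -> \bar R) : measurable_fun setT F -> (forall x, 0 <= F x) ->
  \int[leb]_x F (- x)%R = \int[leb]_x F x.
Proof.
move=> mF F0.
have mo : measurable_fun [set: mR] (-%R : mR -> mR) by exact: oppr_measurable.
pose nu : {measure set mR -> \bar R} :=
  measure_function_pushforward__canonical__measure_function_Measure leb mo.
have -> : \int[leb]_x F x = \int[nu]_x F x.
  apply: eq_measure_integral => A mA _; apply/esym; exact: lebesgue_measureN.
by rewrite (ge0_integral_pushforward mo)// preimage_setT.
Qed.

Lemma integral_twosided (F : mR -> \bar R) : measurable_fun setT F -> (forall x, 0 <= F x) ->
  \int[leb]_x F x = \int[leb]_(x in Dp) F x + \int[leb]_(x in Dp) F (- x)%R.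
Proof.
move=> mF F0.
have mD : measurable Dp by exact: measurable_itv.
have mo : measurable_fun [set: mR] (-%R : mR -> mR) by exact: oppr_measurable.
have mFp : measurable_fun [set: mR] (F \_ Dp) by apply: (measurable_restrictT F mD).1; exact: (measurable_funTS mF).
pose G : mR -> \bar R := F \o (-%R : mR -> mR).
have mG : measurable_fun [set: mR] G by exact: (measurableT_comp mF mo).
have mFn : measurable_fun [set: mR] (G \_ Dp).
  by apply: (measurable_restrictT G mD).1; exact: (measurable_funTS mG).
have Fp0 x : 0 <= (F \_ Dp) x by apply: erestrict_ge0.
have Fn0 x : 0 <= (G \_ Dp) x by apply: erestrict_ge0 => y _; exact: F0.
rewrite [X in X + _]integral_mkcond -[\int[leb]_(x in Dp) F (- x)%R]/(\int[leb]_(x in Dp) G x) [X in _ + X]integral_mkcond.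
rewrite -(integral_reflect mFn Fn0) -ge0_integralD//; last exact: (measurableT_comp mFn mo).
apply: (@integral_ae_eq _ _ _ leb _ _ [set 0%R : mR]).
- exact: measurable_set1.
- exact: lebesgue_measure_set1.
- by apply: emeasurable_funD => //; exact: (measurableT_comp mFn mo).
- move=> x /= x0; rewrite /patch /G /= !mem_setE !in_itv/= !andbT opprK oppr_gt0.
  by case: (ltgtP x 0%R) x0 => //= h _; rewrite ?adde0 ?add0e.
Qed.
End twosided.

Section levels.
Context {R : realType}.
Local Notation mR := (measurableTypeR R).
Local Notation Dp := (`]0%R, +oo[%classic : set mR).
Implicit Types (x y alpha : R) (U : set R).

(** The strict inequality leaves the origin to the unreflected functions, which are defined
    there. *)
Definition refl (P : seq ((R -> R) * R)) : seq ((R -> R) * R) :=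
  [seq (fun x => if x < 0 then b.1 (- x) else 0, - b.2) | b <- P].

Lemma mem_Ppos r k (b : (R -> R) * R) : (1 <= r)%N -> b \in Ppos r k -> exists N j (l : 'I_r), [/\ (0 < N)%N, (j < N)%N & b = (basis N j l, node r N j l)].
Proof.
move=> r1; case: k => // k /allpairsP[[j l] /= [jN _ ->]].
exists (2 ^ k)%N, j, l; split=> //; first by rewrite expn_gt0.
by move: jN; rewrite mem_iota add0n.
Qed.

Lemma basis_neg r N j (l : 'I_r) x : x < 0 -> basis N j l x = 0.
Proof.
move=> x0; rewrite /basis /cell ifF//; apply/negbTE; rewrite negb_and -ltNge.
by rewrite (lt_le_trans x0 (cella_ge0 N j)).
Qed.

Lemma node_gt0 r N j l : (0 < N)%N -> (l < r)%N -> (0 : R) < node r N j l.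
Proof.
by move=> N0 lr; have /andP[n1 _] := @node_cell R r N N0 j l lr; rewrite (le_lt_trans _ n1)// cella_ge0.
Qed.

(** All that the tensor argument needs in one variable, in a form common to the line and the
    half-line. *)
Lemma levels_exist alpha r U : -1 < alpha -> (1 <= r)%N -> (U = setT \/ U = `]0, +oo[%classic) ->
  exists (C : R) (B : nat) (P : nat -> seq ((R -> R) * R)) (M : nat -> R -> R -> R),
  [/\ 0 < C /\ (0 < B)%N, P 0%N = [::] /\ (forall k, (size (P k) <= B * 2 ^ k)%N),
    forall k b, b \in P k -> U b.2 /\ leb.-integrable (U : set mR) (EFin \o (fun x => b.1 x * w1 alpha 0 x)),
    forall k x, U x -> Rep U r (Efun (P k) x) (M k x) &
    [/\ forall k x y, 0 <= M k x y,
      forall k, measurable_fun [set: mR * mR] (fun p : mR * mR => M k p.1 p.2) &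
      forall k y, U y -> (\int[leb]_(x in (U : set mR)) (M k x y * w1 alpha 0 x)%:E <= (C * q r ^+ k * w1 alpha r y)%:E)%E]].
Proof.
move=> a1 r1 HU; have [K K0 HK] := @Rep_point R.
have [C C0 HC] := Mpos_int r1 K0 a1.
have q0 := @q_gt0 R r.
have sP k : (size (Ppos (R := R) r k) <= r * 2 ^ k)%N.
  case: k => [|k] //=; rewrite size_lev mulnC leq_mul2l expnS; apply/orP; right.
  by rewrite leq_pmull.
have mbw N j (l : 'I_r) : measurable_fun [set: mR] (fun x : mR => basis N j l x * w1 alpha 0 x).
  by apply: measurable_funM; [exact: measurable_basis|exact: measurable_w1].
have U0 x : 0 < x -> U x by case: HU => -> //; rewrite /= in_itv/= => ->.
have iU (a b c : R) : U a -> U b -> a <= c <= b -> U c.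
  case: HU => -> //; rewrite /= !in_itv/= !andbT => a0 _ /andP[ac _]; exact: lt_le_trans ac.
have HK' p : 0 <= p -> `[p, p + 1] `<=` U -> Rep U r [:: (1, p)] (fun y => if p <= y <= p + 1 then K else 0).
  by move=> p0 pU; exact: HK.
have RP k x := @Rep_Ppos R r U K r1 U0 iU K0 HK' k x.
have U0' := U0.
case: HU => UE; last first.
  exists C, r, (Ppos r), (Mpos r K); split=> //.
  - move=> k b /(mem_Ppos r1)[N [j [l [N0 jN ->]]]]; split=> /=; first by apply: U0; exact: node_gt0.
    rewrite UE; apply/integrableP; split; first exact/measurable_EFinP/measurable_funTS.
    exact: basis_int.
  - by move=> k x Ux; apply: RP => //; move: Ux; rewrite UE /= in_itv/= andbT => /ltW.
  - split; [by move=> *; exact: Mpos_ge0|by move=> k; exact: measurable_Mpos|].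
    by move=> k y; rewrite UE /= in_itv/= andbT; exact: HC.
(* The evaluation point selects the side; the kernel then lives on that side, so no constant is lost
   in doubling. *)
pose M k x y := if x < 0 then Mpos r K k (- x) (- y) else Mpos r K k x y.
have M0 k x y : 0 <= M k x y by rewrite /M; case: ifP => _; exact: Mpos_ge0.
pose np (p : mR * mR) : mR * mR := (- p.1, - p.2).
have mnp : measurable_fun [set: mR * mR] np.
  apply/measurable_fun_pairP; split.
    exact: (measurableT_comp (@oppr_measurable R setT) (@measurable_fst _ _ mR mR)).
  exact: (measurableT_comp (@oppr_measurable R setT) (@measurable_snd _ _ mR mR)).
have mM k : measurable_fun [set: mR * mR] (fun p : mR * mR => M k p.1 p.2).
  apply: measurable_fun_ifT; last exact: measurable_Mpos.
    by apply: measurable_fun_ltr; [exact: measurable_fst|exact: measurable_cst].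
  exact: (measurableT_comp (@measurable_Mpos R r K k) mnp).
have mN : measurable_fun [set: mR] (-%R : mR -> mR) by exact: oppr_measurable.
exists C, (2 * r)%N, (fun k => Ppos r k ++ refl (Ppos r k)), M; split.
- by split=> //; rewrite muln_gt0.
- split=> // k; rewrite size_cat size_map addnn -mul2n -mulnA leq_mul2l; exact: sP.
- move=> k b; rewrite mem_cat => /orP[/(mem_Ppos r1)|/mapP[b' /(mem_Ppos r1)]] [N [j [l [N0 jN bE]]]].
    rewrite bE UE; split=> //=; apply/integrableP; split; first exact/measurable_EFinP.
    rewrite integral_twosided//; last exact/measurable_abse_comp/measurable_EFinP.
    rewrite [X in (_ + X < _)%E]integral0_eq ?adde0; first exact: basis_int.
    move=> x; rewrite /= in_itv/= andbT => x0.
    by rewrite basis_neg ?oppr_lt0// mul0r normr0.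
  move=> ->; rewrite bE UE; split=> //=.
  have mF : measurable_fun [set: mR] (fun x : mR => (if x < 0 then basis N j l (- x) else 0) * w1 alpha 0 x).
    apply: measurable_funM; last exact: measurable_w1.
    apply: measurable_fun_ifT; last exact: measurable_cst.
      by apply: measurable_fun_ltr; [exact: measurable_id|exact: measurable_cst].
    exact: (measurableT_comp (@measurable_basis R r N j l) mN).
  apply/integrableP; split; first exact/measurable_EFinP.
  rewrite integral_twosided//; last exact/measurable_abse_comp/measurable_EFinP.
  rewrite [X in (X + _ < _)%E]integral0_eq ?add0e; last first.
    by move=> x; rewrite /= in_itv/= andbT => x0; rewrite ltNge (ltW x0)/= mul0r normr0.
  apply: le_lt_trans (@basis_int R r alpha a1 N j l N0 jN).
  apply: integral_mono => x; rewrite /= in_itv/= andbT => x0.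
  by rewrite oppr_lt0 x0 opprK w1N.
- move=> k x _.
  have EE e y : bsum e (Efun (Ppos r k ++ refl (Ppos r k)) x) y = moll e x y +
      (bsum e [seq (-1 * b.1 x, b.2) | b <- Ppos r k] y +
      \sum_(b <- Ppos r k) (-1 * (if x < 0 then b.1 (- x) else 0)) * moll e (- b.2) y).
    by rewrite Efun_bsum map_cat bsum_cat {2}/bsum /refl -map_comp big_map.
  have [x0|x0] := ltP x 0; last first.
    have Ux : U x by rewrite UE.
    apply: (Rep_mono _ (Rep_ext _ (RP k x x0 Ux))) => [y|e y]; first by rewrite /M ltNge x0.
    rewrite EE Efun_bsum [X in _ + (_ + X)]big1 ?addr0// => b _.
    by rewrite ltNge x0 mulr0 mul0r.
  have xN0 : 0 < - x by rewrite oppr_gt0.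
  have UxN : U (- x) by rewrite UE.
  have Lpos p : p \in Efun (Ppos r k) (- x) -> 0 < p.2.
    rewrite inE => /predU1P[->//|/mapP[b /(mem_Ppos r1)[N [j [l [N0 jN ->]]]] ->]] /=.
    exact: node_gt0.
  have RR := Rep_reflect Lpos (RP k (- x) (ltW xN0) UxN).
  have US : [set z | U (- z)] = U by rewrite UE; apply/seteqP; split.
  rewrite US in RR.
  apply: (Rep_mono _ (Rep_ext _ RR)) => [y|e y]; first by rewrite /M x0.
  rewrite EE [X in _ = _ + (X + _)](_ : _ = 0); last first.
    rewrite /bsum big_map big_seq big1// => b /(mem_Ppos r1)[N [j [l [N0 jN ->]]]] /=.
    by rewrite basis_neg// mulr0 mul0r.
  rewrite add0r /Efun /= bsum_cons mul1r opprK; congr (_ + _).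
  rewrite /bsum -map_comp big_map; apply: eq_bigr => b _ /=.
  by rewrite x0 mulN1r.
- split=> // k y _.
  have mF : measurable_fun [set: mR] (fun x : mR => (M k x y * w1 alpha 0 x)%:E).
    apply/measurable_EFinP; apply: measurable_funM; last exact: measurable_w1.
    exact: (measurableT_comp (mM k) (pair2_measurable y)).
  rewrite UE integral_twosided//; last by move=> x; rewrite lee_fin mulr_ge0 ?w1_ge0.
  have E1 : (\int[leb]_(x in Dp) (M k x y * w1 alpha 0 x)%:E = \int[leb]_(x in Dp) (Mpos r K k x y * w1 alpha 0 x)%:E)%E.
    apply: eq_integral => x; rewrite inE /= in_itv/= andbT => x0.
    by rewrite /M ltNge (ltW x0).
  have E2 : (\int[leb]_(x in Dp) (M k (- x) y * w1 alpha 0 (- x))%:E = \int[leb]_(x in Dp) (Mpos r K k x (- y) * w1 alpha 0 x)%:E)%E.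
    apply: eq_integral => x; rewrite inE /= in_itv/= andbT => x0.
    by rewrite /M oppr_lt0 x0 opprK w1N.
  (* The half of the integral whose side does not contain [y] vanishes; at [y = 0] both halves
     do. *)
  have Z z : z <= 0 -> (\int[leb]_(x in Dp) (Mpos r K k x z * w1 alpha 0 x)%:E = 0)%E.
    move=> z0; apply: integral0_eq => x; rewrite /= in_itv/= andbT => x0.
    by rewrite Mpos_out// mul0r.
  rewrite E1 E2; have [y0|y0|->] := ltgtP y 0.
  + rewrite (Z y (ltW y0)) add0e -(w1N alpha r y); apply: HC; by rewrite oppr_gt0.
  + by rewrite (Z (- y)) ?oppr_le0 ?(ltW y0)// adde0 HC.
  + rewrite oppr0 Z// adde0 lee_fin mulr_ge0 ?w1_ge0// mulr_ge0 ?(ltW C0)//.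
    by rewrite exprn_ge0// ltW.
Qed.
End levels.

(** * Combinatorics of the Smolyak construction *)

Section smolyak.
Context {R : realType}.
Variable P : nat -> seq ((R -> R) * R).
Hypothesis P0 : P 0%N = [::].
Implicit Types (x : R) (k m d : nat).

Definition Dq k : seq ((R -> R) * R) := P k.+1 ++ [seq (fun x => - b.1 x, b.2) | b <- P k].

(* [(k, true)] stands for the detail functional of level [k], [(k, false)] for
   the interpolation error of level [k]; the error of level [0] is the identity. *)
Definition term_fun (c : nat * bool) x : seq (R * R) :=
  if c.2 then [seq (b.1 x, b.2) | b <- Dq c.1] else Efun (P c.1) x.

Definition pcons T d (x : T) (t : d.-tuple T) : d.+1.-tuple T := [tuple of x :: t].

Lemma pcons0 T d (x : T) (t : d.-tuple T) : tnth (pcons x t) ord0 = x.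
Proof. by rewrite /pcons tnth0. Qed.
Lemma pconsS T d (x : T) (t : d.-tuple T) i : tnth (pcons x t) (lift ord0 i) = tnth t i.
Proof. by rewrite /pcons tnthS. Qed.

Lemma tcons0 d (p : R * d.-tuple R) : tnth (tcons p) ord0 = p.1.
Proof. by rewrite /tcons tnth0. Qed.
Lemma tconsS d (p : R * d.-tuple R) i : tnth (tcons p) (lift ord0 i) = tnth p.2 i.
Proof. by rewrite /tcons tnthS. Qed.

(** The Smolyak operator by recursion on dimension, [S(d+1, m)] being the sum over [k < m] of the
    detail of level [k] tensored with [S(d, m - k)]. It is kept before integration: each entry pairs
    coefficient functions with a node, so the pointwise error can be studied. *)
Fixpoint Smol d m : seq (d.-tuple (R -> R) * d.-tuple R) :=
  match d with
  | 0 => [:: ([tuple], [tuple])]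
  | d'.+1 => flatten [seq [seq (pcons b.1 s.1, tcons (b.2, s.2)) | b <- Dq k, s <- Smol d' (m - k)] | k <- iota 0 m]
  end.

(** Labels of the error terms. The padding [(0, false)] stands for the identity, since level [0] has
    no nodes. *)
Fixpoint Terms d m : seq (d.-tuple (nat * bool)) :=
  match d with
  | 0 => [::]
  | d'.+1 => flatten [seq [seq pcons (k, true) t | t <- Terms d' (m - k)] | k <- iota 0 m]
     ++ [:: pcons (m, false) [tuple (0%N, false) | i < d']]
  end.

Definition Sev d m (x : d.-tuple R) (f : d.-tuple R -> R) :=
  \sum_(s <- Smol d m) tprod (tnth s.1) x * f s.2.

Definition tev d (L : 'I_d -> seq (R * R)) (f : d.-tuple R -> R) := \sum_(p <- tensor L) p.1 * f p.2.

Lemma tevS d (L : 'I_d.+1 -> seq (R * R)) f :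
  tev L f = \sum_(a <- L ord0) a.1 * tev (fun i => L (lift ord0 i)) (fun t => f (tcons (a.2, t))).
Proof.
rewrite /tev /= big_allpairs_dep /=; apply: eq_bigr => a _.
by rewrite mulr_sumr; apply: eq_bigr => p _; rewrite mulrA.
Qed.

Lemma tev_ext d (L L' : 'I_d -> seq (R * R)) f : L =1 L' -> tev L f = tev L' f.
Proof. by move=> /funext ->. Qed.

Lemma telescope_levels m x (h : R -> R) :
  h x = \sum_(k <- iota 0 m) \sum_(b <- Dq k) b.1 x * h b.2 + \sum_(a <- Efun (P m) x) a.1 * h a.2.
Proof.
have PE k : \sum_(b <- Dq k) b.1 x * h b.2 = \sum_(b <- P k.+1) b.1 x * h b.2 - \sum_(b <- P k) b.1 x * h b.2.
  rewrite /Dq big_cat big_map /= -sumrN; congr (_ + _); apply: eq_bigr => b _.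
  by rewrite mulNr.
rewrite /Efun big_cons mul1r big_map /=.
rewrite (eq_bigr (fun b => - (b.1 x * h b.2))); last by move=> b _; rewrite mulNr.
rewrite sumrN (eq_bigr _ (fun k _ => PE k)).
rewrite (_ : iota 0 m = index_iota 0 m); last by rewrite /index_iota subn0.
rewrite telescope_sumr// P0 big_nil subr0; ring.
Qed.

Lemma tev_delta d (x : d.-tuple R) f :
  tev (fun i => term_fun (0%N, false) (tnth x i)) f = f x.
Proof.
elim: d x f => [|d IH] x f.
  by rewrite /tev big_seq1 mul1r; congr f; apply/esym/tuple0.
rewrite -(unconsK x); move: (uncons x) => [x0 x'].
rewrite tevS tcons0 /term_fun /= P0 /Efun big_seq1 /= mul1r.
rewrite -[RHS](IH x' (fun t => f (tcons (x0, t)))).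
by apply: tev_ext => i; rewrite /term_fun /= P0 tconsS.
Qed.

(** In the first variable the identity is the sum of the details below [m] plus the error of level
    [m]. Subtracting the recursion for the Smolyak operator leaves each detail tensored with a
    lower-dimensional Smolyak error, plus the level-[m] error tensored with the identity. *)
Lemma smol_error_terms d m (x : d.-tuple R) f :
  f x - Sev m x f = \sum_(t <- Terms d m) tev (fun i => term_fun (tnth t i) (tnth x i)) f.
Proof.
elim: d m x f => [|d IH] m x f.
  by rewrite /Sev /= big_seq1 big_nil /tprod big_ord0 mul1r tuple0 subrr.
rewrite -(unconsK x); move: (uncons x) => [x0 x'].
rewrite {1}(telescope_levels m x0 (fun y => f (tcons (y, x')))) /=.
rewrite /Sev /= big_flatten big_map /= big_cat big_seq1 /= addrAC; congr (_ + _).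
  rewrite -sumrB big_flatten big_map /=; apply: eq_bigr => k _.
  rewrite big_allpairs_dep /= big_map -sumrB.
  transitivity (\sum_(b <- Dq k) b.1 x0 * (f (tcons (b.2, x')) - Sev (m - k) x' (fun t => f (tcons (b.2, t))))).
    apply: eq_bigr => b _; rewrite mulrBr /Sev mulr_sumr; congr (_ - _).
    apply: eq_bigr => s _; rewrite mulrA; congr (_ * _).
    by rewrite /tprod big_ord_recl pcons0 tcons0; under eq_bigr do rewrite pconsS tconsS.
  rewrite (eq_bigr (fun b => \sum_(t <- Terms d (m - k)) b.1 x0 *
    tev (fun i => term_fun (tnth t i) (tnth x' i)) (fun u => f (tcons (b.2, u))))); last first.
    by move=> b _; rewrite -mulr_sumr -(IH (m - k)%N x' (fun u => f (tcons (b.2, u)))).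
  rewrite exchange_big /=; apply: eq_bigr => t _.
  rewrite tevS pcons0 tcons0 /term_fun /= big_map; apply: eq_bigr => b _ /=.
  congr (_ * _); apply: tev_ext => i; by rewrite pconsS tconsS.
rewrite tevS pcons0 tcons0 /term_fun /=; apply: eq_bigr => a _.
congr (_ * _); rewrite -[LHS](tev_delta x' (fun t => f (tcons (a.2, t)))).
by apply: tev_ext => i; rewrite pconsS tconsS tnth_mktuple.
Qed.

(** This makes all error terms equally small: a term is bounded by [q] to its total level, whichever
    way the levels are distributed. *)
Lemma mem_Terms d m t : t \in Terms d m -> (\sum_(i < d) (tnth t i).1)%N = m.
Proof.
elim: d m t => [|d IH] m t //=; rewrite mem_cat => /orP[/flatten_mapP[k km /mapP[t' /IH Ht ->]]|].
  rewrite big_ord_recl pcons0; under eq_bigr do rewrite pconsS.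
  by rewrite Ht subnKC//; move: km; rewrite mem_iota add0n => /ltnW.
rewrite inE => /eqP ->; rewrite big_ord_recl pcons0 big1 ?addn0// => i _.
by rewrite pconsS tnth_mktuple.
Qed.

Lemma size_flatten_iota T (F : nat -> seq T) m :
  size (flatten [seq F k | k <- iota 0 m]) = (\sum_(k < m) size (F k))%N.
Proof.
rewrite size_flatten /shape -map_comp sumnE big_map.
by rewrite (_ : iota 0 m = index_iota 0 m) ?big_mkord// /index_iota subn0.
Qed.

Lemma size_Terms d m : (size (Terms d.+1 m) <= d.+1 * m.+1 ^ d)%N.
Proof.
elim: d m => [|d IH] m.
  by rewrite /= size_cat size_flatten_iota /= big1 ?add0n ?muln1.
have -> : Terms d.+2 m = flatten [seq [seq pcons (k, true) t | t <- Terms d.+1 (m - k)] | k <- iota 0 m]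
     ++ [:: pcons (m, false) [tuple (0%N, false) | i < d.+1]] by [].
rewrite size_cat size_flatten_iota /= addn1.
apply: (@leq_ltn_trans (\sum_(k < m) d.+1 * m.+1 ^ d)).
  apply: leq_sum => k _; rewrite size_map; apply: leq_trans (IH _) _.
  have H : ((m - k).+1 ^ d <= m.+1 ^ d)%N by case: (d) => // d'; rewrite leq_exp2r// ltnS leq_subr.
  by rewrite leq_mul2l H orbT.
rewrite sum_nat_const card_ord expnS mulnCA [(d.+2 * _)%N]mulSn.
have : (0 < m.+1 * m.+1 ^ d)%N by rewrite muln_gt0 expn_gt0.
nia.
Qed.

(** A split of [m] into [k] and [m - k] always costs [2^k 2^(m-k) = 2^m], so every further variable
    contributes a factor [m]. The innermost variable is a geometric sum and contributes none. *)
Lemma size_Smol B d m : (forall k, size (P k) <= B * 2 ^ k)%N ->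
  (size (Smol d.+1 m) <= (3 * B) ^ d.+1 * m ^ d * 2 ^ m)%N.
Proof.
move=> PB.
(* A detail joins levels [k + 1] and [k]: [2B] plus [B] times [2^k]. *)
have DB k : (size (Dq k) <= 3 * B * 2 ^ k)%N.
  rewrite size_cat size_map; have := PB k; have := PB k.+1; rewrite expnS.
  by move: (size (P k)) (size (P k.+1)) (2 ^ k)%N => a b z; nia.
have sumpow n : (\sum_(k < n) 2 ^ k <= 2 ^ n)%N.
  by elim: n => [|n IHn]; rewrite ?big_ord0// big_ord_recr expnS mul2n -addnn leq_add2r.
elim: d m => [|d IH] m.
  have -> : Smol 1 m = flatten [seq [seq (pcons b.1 s.1, tcons (b.2, s.2)) | b <- Dq k, s <- Smol 0 (m - k)] | k <- iota 0 m] by [].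
  rewrite size_flatten_iota expn0 muln1 expn1.
  apply: (@leq_trans (\sum_(k < m) (3 * B) * 2 ^ k)).
    by apply: leq_sum => k _; rewrite size_allpairs muln1.
  by rewrite -big_distrr /= leq_mul2l sumpow orbT.
have -> : Smol d.+2 m = flatten [seq [seq (pcons b.1 s.1, tcons (b.2, s.2)) | b <- Dq k, s <- Smol d.+1 (m - k)] | k <- iota 0 m] by [].
rewrite size_flatten_iota.
apply: (@leq_trans (\sum_(k < m) (3 * B) ^ d.+2 * m ^ d * 2 ^ m)).
  apply: leq_sum => k _; rewrite size_allpairs.
  apply: leq_trans (leq_mul (DB k) (IH _)) _.
  have -> : (2 ^ m = 2 ^ k * 2 ^ (m - k))%N by rewrite -expnD subnKC// ltnW.
  have H : ((m - k) ^ d <= m ^ d)%N by case: (d) => // d'; rewrite leq_exp2r// leq_subr.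
  rewrite (expnS (3 * B) d.+1).
  have -> : (3 * B * 2 ^ k * ((3 * B) ^ d.+1 * (m - k) ^ d * 2 ^ (m - k)) = 3 * B * (3 * B) ^ d.+1 * (2 ^ k * 2 ^ (m - k)) * (m - k) ^ d)%N by ring.
  have -> : (3 * B * (3 * B) ^ d.+1 * m ^ d * (2 ^ k * 2 ^ (m - k)) = 3 * B * (3 * B) ^ d.+1 * (2 ^ k * 2 ^ (m - k)) * m ^ d)%N by ring.
  by rewrite leq_mul2l H orbT.
rewrite sum_nat_const card_ord (expnS m d).
by apply: eq_leq; ring.
Qed.

Lemma mem_Smol d m s : s \in Smol d m -> forall i, exists k b, b \in Dq k /\ tnth s.1 i = b.1 /\ tnth s.2 i = b.2.
Proof.
elim: d m s => [|d IH] m s; first by move=> _ [].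
move=> /flatten_mapP[k _ /allpairsP[[b s'] /= [bD s'S ->]]] i /=.
case: (unliftP ord0 i) => [j ->|->]; last by exists k, b; rewrite pcons0 tcons0.
by have [k' [b' [H1 [H2 H3]]]] := IH _ _ s'S j; exists k', b'; rewrite pconsS tconsS.
Qed.
End smolyak.

(** * The Smolyak quadrature and its error *)

Section quadrature.
Context {R : realType} (r : nat) (U : set R) (alpha C : R).
Variables (P : nat -> seq ((R -> R) * R)) (M : nat -> R -> R -> R).
Local Notation mR := (measurableTypeR R).
Local Notation w0 := (w1 alpha 0).
Local Notation q := (@q R r).
Hypothesis oU : open U.
Hypothesis iU : forall a b c : R, U a -> U b -> a <= c <= b -> U c.
Hypothesis C0 : 0 < C.
Hypothesis P0 : P 0%N = [::].
Hypothesis PU : forall k b, b \in P k -> U b.2 /\ leb.-integrable (U : set mR) (EFin \o (fun x => b.1 x * w0 x)).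
Hypothesis RP : forall k x, U x -> Rep U r (Efun (P k) x) (M k x).
Hypothesis M0 : forall k x y, 0 <= M k x y.
Hypothesis mM : forall k, measurable_fun [set: mR * mR] (fun p : mR * mR => M k p.1 p.2).
Hypothesis MI : forall k y, U y ->
  (\int[leb]_(x in (U : set mR)) (M k x y * w0 x)%:E <= (C * q ^+ k * w1 alpha r y)%:E)%E.

Let mU : measurable (U : set mR). Proof. exact: open_measurable. Qed.

Definition term_ker (c : nat * bool) x y := if c.2 then M c.1 x y + M c.1.+1 x y else M c.1 x y.

Lemma term_ker_ge0 c x y : 0 <= term_ker c x y.
Proof. by rewrite /term_ker; case: ifP => _; rewrite ?addr_ge0. Qed.

Lemma measurable_term_ker c : measurable_fun [set: mR * mR] (fun p : mR * mR => term_ker c p.1 p.2).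
Proof. by rewrite /term_ker; case: c.2 => //; apply: measurable_funD. Qed.

Lemma q_le1 : q <= 1.
Proof.
rewrite /q exprn_ile1// ?invr_ge0 ?sqrtr_ge0// invf_le1 ?sqrtr_gt0//.
by rewrite -[leLHS]sqrtr1 ler_wsqrtr// ler1n.
Qed.

(** A detail is the difference of two consecutive errors; the evaluation at [x] occurs in both with
    the same mollifier and cancels. *)
Lemma term_rep c x : U x -> Rep U r (term_fun P c x) (term_ker c x).
Proof.
move=> Ux; rewrite /term_fun /term_ker; case: c => k [] /=; last exact: RP.
apply: (Rep_ext _ (Rep_add iU (RP k Ux) (Rep_opp (RP k.+1 Ux)))) => e y.
rewrite bsum_cat /Efun /bsum !big_cons !big_map /Dq big_cat big_map /= !mul1r !mulN1r.
rewrite [in X in _ + X](eq_bigr (fun b => b.1 x * moll e b.2 y)); last by move=> b _; rewrite opprK.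
ring.
Qed.

Lemma term_points c x p : U x -> p \in term_fun P c x -> U p.2.
Proof.
move=> Ux; rewrite /term_fun; case: c => k [] /=.
  rewrite /Dq => /mapP[b]; rewrite mem_cat => /orP[/PU[Ub _] ->//|/mapP[b' /PU[Ub _] ->] ->//].
by rewrite inE => /predU1P[->//|/mapP[b /PU[Ub _] ->]].
Qed.

Lemma term_int c y : U y ->
  (\int[leb]_(x in (U : set mR)) (term_ker c x y * w0 x)%:E <= (2 * C * q ^+ c.1 * w1 alpha r y)%:E)%E.
Proof.
move=> Uy; have q0 : 0 < q by exact: q_gt0.
have W := w1_ge0 alpha r y.
have A k : 0 <= C * q ^+ k * w1 alpha r y by rewrite !mulr_ge0 ?exprn_ge0 ?(ltW C0) ?(ltW q0).
have E k : 2 * C * q ^+ k * w1 alpha r y = C * q ^+ k * w1 alpha r y + C * q ^+ k * w1 alpha r y by ring.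
rewrite E /term_ker; case: c => k [] /=; last first.
  by apply: le_trans (MI k Uy) _; rewrite lee_fin lerDl.
have mk k' : measurable_fun (U : set mR) (fun x => (M k' x y * w0 x)%:E).
  apply/measurable_EFinP/measurable_funTS; apply: measurable_funM; last exact: measurable_w1.
  exact: (measurableT_comp (@mM k') (pair2_measurable y)).
under eq_integral do rewrite mulrDl EFinD.
rewrite ge0_integralD//; [|by move=> x _; rewrite lee_fin mulr_ge0 ?w1_ge0..].
rewrite EFinD leeD ?MI//; apply: le_trans (MI _ Uy) _.
rewrite lee_fin exprS ler_wpM2r// ler_wpM2l ?(ltW C0)// ler_piMl ?exprn_ge0 ?(ltW q0)//.
exact: q_le1.
Qed.

Section fixd.
Variables (d : nat) (t : d.-tuple (nat * bool)) (h : d.-tuple mR -> R).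
Hypothesis mh : measurable_fun [set: d.-tuple mR] h.
Hypothesis h0 : forall y, 0 <= h y.
Hypothesis hU : forall y, ~ cube d U y -> h y = 0.

(** Both [h], which will be the absolute value of a weak derivative, and the weight are cut off
    outside [U], so that Tonelli applies on the full product of tuples. *)
Definition term_joint (p : d.-tuple mR * d.-tuple mR) : \bar R :=
  (h p.2 * \prod_(i < d) (term_ker (tnth t i) (tnth p.1 i) (tnth p.2 i) * (w0 \_ U) (tnth p.1 i)))%:E.
Local Notation H := term_joint.

Let wU0 x : 0 <= (w0 \_ U) x.
Proof. by rewrite /patch; case: ifP => // _; exact: w1_ge0. Qed.

Let mwU : measurable_fun [set: mR] (w0 \_ U : mR -> R).
Proof. by apply: (measurable_restrictT _ mU).1; apply: measurable_funTS; exact: measurable_w1. Qed.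

Let H0 p : (0 <= H p)%E.
Proof. by rewrite lee_fin mulr_ge0// prodr_ge0// => i _; rewrite mulr_ge0 ?term_ker_ge0. Qed.

Let mH : measurable_fun setT H.
Proof.
apply/measurable_EFinP; apply: measurable_funM; first exact: (measurableT_comp mh measurable_snd).
apply: measurable_prod => i _.
have m1 : measurable_fun [set: d.-tuple mR * d.-tuple mR] (fun p : d.-tuple mR * d.-tuple mR => tnth p.1 i : mR).
  exact: (measurableT_comp (measurable_tnth i) measurable_fst).
have m2 : measurable_fun [set: d.-tuple mR * d.-tuple mR] (fun p : d.-tuple mR * d.-tuple mR => tnth p.2 i : mR).
  exact: (measurableT_comp (measurable_tnth i) measurable_snd).
apply: measurable_funM; last exact: (measurableT_comp mwU m1).
pose pr (p : d.-tuple mR * d.-tuple mR) : mR * mR := (tnth p.1 i, tnth p.2 i).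
have mpr : measurable_fun setT pr by apply/measurable_fun_pairP; split.
exact: (measurableT_comp (measurable_term_ker (tnth t i)) mpr).
Qed.

(** After the exchange the integral over [x] factors into one-dimensional ones, each bounded by
    [term_int]. Their product yields the weight of the Sobolev norm in [y]. *)
Lemma term_tonelli :
  measurable_fun [set: d.-tuple mR] (fun x => \int[muT d]_y H (x, y))%E /\
  (\int[muT d]_x \int[muT d]_y H (x, y) <=
   ((2 * C) ^+ d * q ^+ (\sum_(i < d) (tnth t i).1))%:E * \int[muT d]_y (h y * wd alpha r y)%:E)%E.
Proof.
split; first exact: (measurable_fun_fubini_tonelli_F H mH H0).
rewrite (fubini_tonelli H mH H0).
have c0 : 0 <= (2 * C) ^+ d * q ^+ (\sum_(i < d) (tnth t i).1).
  by rewrite mulr_ge0 ?exprn_ge0 ?mulr_ge0 ?(ltW C0) ?(ltW (q_gt0 r)).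
have wd0 y : 0 <= wd alpha r y by apply: prodr_ge0 => i _; exact: w1_ge0.
have mwd : measurable_fun [set: d.-tuple mR] (wd alpha r : d.-tuple mR -> R).
  exact: (measurable_tprod (F := fun _ => w1 alpha r) (fun=> measurable_w1 alpha r)).
rewrite -ge0_integralZl//; last 2 first.
- by apply/measurable_EFinP; exact: measurable_funM.
- by move=> y _; rewrite lee_fin mulr_ge0.
apply: integral_mono => y _.
(* The one-dimensional bounds hold only for coordinates in [U]; elsewhere [h] makes both sides
   zero. *)
have [Uy|/hU hy] := pselect (cube d U y); last first.
  rewrite /fubini_G integral0_eq; last by move=> x _; rewrite /term_joint /= hy mul0r.
  by rewrite hy mul0r mule0.
pose F i x := term_ker (tnth t i) x (tnth y i) * (w0 \_ U) x.
have mF i : measurable_fun [set: mR] (F i).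
  apply: measurable_funM => //.
  exact: (measurableT_comp (measurable_term_ker (tnth t i)) (pair2_measurable _)).
have F0 i x : 0 <= F i x by rewrite mulr_ge0 ?term_ker_ge0.
have FE i : (\int[leb]_x (F i x)%:E = \int[leb]_(x in (U : set mR)) (term_ker (tnth t i) x (tnth y i) * w0 x)%:E)%E.
  rewrite [RHS]integral_mkcond; apply: eq_integral => x _.
  by rewrite /F /patch; case: ifP => _; rewrite ?mulr0.
have Fb i : (\int[leb]_x (F i x)%:E <= (2 * C * q ^+ (tnth t i).1 * w1 alpha r (tnth y i))%:E)%E.
  by rewrite FE; exact: term_int.
have iF i : leb.-integrable setT (EFin \o F i).
  apply/integrableP; split; first exact/measurable_EFinP.
  apply: le_lt_trans (le_lt_trans (Fb i) (ltry _)).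
  by apply: integral_mono => x _ /=; rewrite ger0_norm.
have [iP EP] := integral_tprodT iF.
rewrite /fubini_G /term_joint /=; under eq_integral do rewrite EFinM.
rewrite integralZl//.
rewrite [X in (_ * X <= _)%E]EP -!EFinM lee_fin mulrCA ler_wpM2l//.
apply: (@le_trans _ _ (\prod_(i < d) (2 * C * q ^+ (tnth t i).1 * w1 alpha r (tnth y i)))).
  apply: ler_prod => i _; apply/andP; split; first by apply: Rintegral_ge0.
  rewrite -lee_fin /Rintegral fineK//; exact: (integrable_fin_num measurableT (iF i)).
by rewrite big_split /= big_split /= prodr_const card_ord prodrXr.
Qed.

Lemma term_pointwise (g : d.-tuple R -> R) x : measurable_fun (cube d U : set (d.-tuple mR)) g ->
  h = (fun y => `|g y|) \_ (cube d U) -> cube d U x ->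
  ((wd alpha 0 x)%:E * intD U (fun y => (`|g y| * \prod_(i < d) term_ker (tnth t i) (tnth x i) (tnth y i))%:E) =
   \int[muT d]_y H (x, y))%E.
Proof.
move=> mg hE Ux.
have mC : measurable (cube d U : set (d.-tuple mR)) by exact: measurable_cube.
have mF : measurable_fun (cube d U : set (d.-tuple mR))
    (fun y => (`|g y| * \prod_(i < d) term_ker (tnth t i) (tnth x i) (tnth y i))%:E).
  apply/measurable_EFinP; apply: measurable_funM; first exact: measurableT_comp.
  apply: measurable_funTS.
  apply: (measurable_tprod (F := fun i => term_ker (tnth t i) (tnth x i))) => i.
  exact: (measurableT_comp (measurable_term_ker (tnth t i)) (pair1_measurable _)).
have F0 y : (0 <= (`|g y| * \prod_(i < d) term_ker (tnth t i) (tnth x i) (tnth y i))%:E)%E.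
  by rewrite lee_fin mulr_ge0// prodr_ge0// => i _; exact: term_ker_ge0.
rewrite intD_ge0E// -ge0_integralZl//; last first.
  by rewrite lee_fin prodr_ge0// => i _; exact: w1_ge0.
rewrite integral_mkcond; apply: eq_integral => y _.
rewrite /patch /term_joint /= hE /patch; case: ifP => _; last by rewrite mul0r.
rewrite -EFinM; congr EFin; rewrite /wd mulrCA -big_split; congr (_ * _).
by apply: eq_bigr => i _ /=; rewrite mulrC mem_set//; exact: Ux.
Qed.
End fixd.

Definition smol_quad d m : seq (R * d.-tuple R) :=
  [seq (\prod_(i < d) \int[leb]_(x in (U : set mR)) (tnth s.1 i x * w0 x), s.2) | s <- Smol P d m].

Lemma smol_quad_nodes d m p : p \in smol_quad d m -> cube d U p.2.
Proof.
move=> /mapP[s /mem_Smol sS ->] i /=; have [k [b [bD [_ ->]]]] := sS i.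
by move: bD; rewrite mem_cat => /orP[/PU[]//|/mapP[b' /PU[Ub _] ->]].
Qed.

Lemma smol_quad_integral d m f :
  (muT d).-integrable (cube d U) (EFin \o (fun x => Sev P m x f * wd alpha 0 x)) /\
  \int[muT d]_(x in cube d U) (Sev P m x f * wd alpha 0 x) = \sum_(p <- smol_quad d m) p.1 * f p.2.
Proof.
have mC : measurable (cube d U : set (d.-tuple mR)) by exact: measurable_cube.
pose F (s : d.-tuple (R -> R) * d.-tuple R) x := \prod_(i < d) (tnth s.1 i (tnth x i) * w0 (tnth x i)).
have iF s : s \in Smol P d m -> (muT d).-integrable (cube d U) (EFin \o F s) /\
    \int[muT d]_(x in cube d U) F s x = \prod_(i < d) \int[leb]_(x in (U : set mR)) (tnth s.1 i x * w0 x).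
  move=> /mem_Smol sS.
  have [|i1 i2] := @integral_tprod R d U (fun i x => tnth s.1 i x * w0 x) mU.
    move=> i; have [k [b [bD [-> _]]]] := sS i; move: bD.
    rewrite mem_cat => /orP[/PU[]//|/mapP[b' /PU[_ ib] ->]] /=.
    have := integrableN ib; congr (_.-integrable _ _); apply/funext => x /=.
    by rewrite mulNr.
  by split=> //; rewrite /Rintegral i2.
have E x : Sev P m x f * wd alpha 0 x = \sum_(s <- Smol P d m) f s.2 * F s x.
  rewrite /Sev mulr_suml; apply: eq_bigr => s _.
  by rewrite /F big_split /= /tprod /wd; ring.
under eq_fun do rewrite E.
have [|H1 H2] := @Rintegral_lin _ _ _ (muT d) (cube d U) mC _ (Smol P d m) (fun s => f s.2) F.
  by move=> s /iF[].
split=> //; rewrite [LHS]H2 /smol_quad big_map big_seq [RHS]big_seq.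
by apply: eq_bigr => s /iF[_ ->]; rewrite mulrC.
Qed.

Lemma smol_quad_error d m f : sobolev_ball d.+1 U alpha r f ->
  (`|intD U (fun t => (f t * wd alpha 0 t)%:E) - (\sum_(p <- smol_quad d.+1 m) p.1 * f p.2)%:E| <=
   ((size (Terms d.+1 m))%:R * ((2 * C) ^+ d.+1 * q ^+ m))%:E)%E.
Proof.
move=> [cf [g [wg gn]]].
have mC : measurable (cube d.+1 U : set (d.+1.-tuple mR)) by exact: measurable_cube.
have wd0 n y : 0 <= @wd R d.+1 alpha n y by apply: prodr_ge0 => i _; exact: w1_ge0.
have mwd n : measurable_fun [set: d.+1.-tuple mR] (wd alpha n : d.+1.-tuple mR -> R).
  exact: (measurable_tprod (F := fun _ => w1 alpha n) (fun=> measurable_w1 alpha n)).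
pose h k : d.+1.-tuple mR -> R := (fun y => `|g k y|) \_ (cube d.+1 U).
have mg k : measurable_fun (cube d.+1 U : set (d.+1.-tuple mR)) (g k) by have [] := wg k.
have mh k : measurable_fun [set: d.+1.-tuple mR] (h k).
  by apply: (measurable_restrictT _ mC).1; exact: (measurableT_comp _ (mg k)).
have h0 k y : 0 <= h k y by rewrite /h /patch; case: ifP.
have hU k y : ~ cube d.+1 U y -> h k y = 0 by move=> Uy; rewrite /h /patch memNset.
have hI : (\sum_(k : {ffun 'I_d.+1 -> 'I_r.+1}) \int[muT d.+1]_y (h k y * wd alpha r y)%:E <= 1)%E.
  apply: le_trans gn; rewrite le_eqVlt; apply/orP; left; apply/eqP; apply: eq_bigr => k _.
  rewrite intD_ge0E//.
  - rewrite [RHS]integral_mkcond; apply: eq_integral => y _.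
    by rewrite /h /patch; case: ifP => _ //; rewrite mul0r.
  - apply/measurable_EFinP; apply: measurable_funM; first exact: (measurableT_comp _ (mg k)).
    exact: (measurable_funTS (mwd r)).
  - by move=> y _; rewrite lee_fin mulr_ge0.
pose D x := (f x - Sev P m x f) * wd alpha 0 x.
pose G x := (\sum_(t <- Terms d.+1 m) \sum_(k : {ffun 'I_d.+1 -> 'I_r.+1})
  \int[muT d.+1]_y term_joint t (h k) (x, y))%E.
have J0 (t : d.+1.-tuple (nat * bool)) k x : (0 <= \int[muT d.+1]_y term_joint t (h k) (x, y))%E.
  apply: integral_ge0 => y _; rewrite lee_fin mulr_ge0// prodr_ge0// => i _.
  by rewrite mulr_ge0 ?term_ker_ge0// /patch; case: ifP => // _; exact: w1_ge0.
have JT (t : d.+1.-tuple (nat * bool)) k := term_tonelli t (mh k) (h0 k) (hU k).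
have ptw x : cube d.+1 U x -> (`|(D x)%:E| <= G x)%E.
  move=> Ux; rewrite /D EFinM abseM (gee0_abs (x := (wd alpha 0 x)%:E)) ?lee_fin ?wd0 //; rewrite (smol_error_terms P0).
  rewrite muleC abse_EFin; apply: (@le_trans _ _ ((wd alpha 0 x)%:E *
     \sum_(t <- Terms d.+1 m) \sum_(k : {ffun 'I_d.+1 -> 'I_r.+1}) intD U
       (fun y => (`|g k y| * \prod_(i < d.+1) term_ker (tnth t i) (tnth x i) (tnth y i))%:E))%E).
    have w0 : (0 <= (wd alpha 0 x)%:E)%E by rewrite lee_fin.
    apply: (lee_wpmul2l w0); apply: (@le_trans _ _ (\sum_(t <- Terms d.+1 m)
       `|tev (fun i => term_fun P (tnth t i) (tnth x i)) f|%:E)%E).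
      by rewrite sumEFin lee_fin; exact: ler_norm_sum.
    apply: lee_sum => t _; apply: (tensor_estimate oU iU (L := fun i => term_fun P (tnth t i) (tnth x i)) (M := fun i => term_ker (tnth t i) (tnth x i))) => //.
      by move=> i; apply: term_rep; exact: Ux.
    by move=> i p; apply: term_points; exact: Ux.
  rewrite ge0_sume_distrr; last first.
    move=> t _; apply: sume_ge0 => k _; apply: intD_ge0 => y _.
    by rewrite lee_fin mulr_ge0// prodr_ge0// => i _; exact: term_ker_ge0.
  apply: lee_sum => t _; rewrite ge0_sume_distrr; last first.
    move=> k _; apply: intD_ge0 => y _.
    by rewrite lee_fin mulr_ge0// prodr_ge0// => i _; exact: term_ker_ge0.
  by apply: lee_sum => k _; rewrite (term_pointwise t (mg k) erefl Ux).
have [iS ES] := smol_quad_integral m f.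
have mf : measurable_fun (cube d.+1 U : set (d.+1.-tuple mR)) f by exact: contOn_measurable.
have DE : EFin \o D = (fun x => (f x * wd alpha 0 x)%:E - (Sev P m x f * wd alpha 0 x)%:E)%E.
  by apply/funext => x; rewrite /= /D mulrBl EFinB.
have mD : measurable_fun (cube d.+1 U : set (d.+1.-tuple mR)) (EFin \o D).
  rewrite DE; apply: emeasurable_funB; last exact: (measurable_int _ iS).
  by apply/measurable_EFinP; apply: measurable_funM => //; exact: (measurable_funTS (mwd 0%N)).
have c0 : 0 <= (2 * C) ^+ d.+1 * q ^+ m.
  by rewrite mulr_ge0 ?exprn_ge0 ?mulr_ge0 ?(ltW C0) ?(ltW (q_gt0 r)).
have ID : (\int[muT d.+1]_(x in cube d.+1 U) `|(EFin \o D) x| <=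
   ((size (Terms d.+1 m))%:R * ((2 * C) ^+ d.+1 * q ^+ m))%:E)%E.
  apply: (@le_trans _ _ (\int[muT d.+1]_x G x)%E).
    rewrite integral_mkcond; apply: integral_mono => x _; rewrite /patch.
    case: ifP => [/set_mem Ux|_]; first exact: ptw.
    by apply: sume_ge0 => t _; apply: sume_ge0 => k _; exact: J0.
  rewrite /G ge0_integral_sum//; last 2 first.
  - by move=> t; apply: emeasurable_sum => k; have [] := JT t k.
  - by move=> t x _; apply: sume_ge0 => k _; exact: J0.
  apply: (@le_trans _ _ (\sum_(t <- Terms d.+1 m) ((2 * C) ^+ d.+1 * q ^+ m)%:E)%E); last first.
    by rewrite sumEFin lee_fin big_const_seq count_predT iter_addr_0 [leRHS]mulr_natl.
  rewrite big_seq [leRHS]big_seq; apply: lee_sum => t /mem_Terms tm.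
  rewrite ge0_integral_sum//; last by move=> k; have [] := JT t k.
  rewrite -[leRHS]mule1; have c0E : (0 <= ((2 * C) ^+ d.+1 * q ^+ m)%:E)%E by rewrite lee_fin.
  apply: le_trans (lee_wpmul2l c0E hI).
  rewrite ge0_sume_distrr; last first.
    by move=> k _; apply: integral_ge0 => y _; rewrite lee_fin mulr_ge0.
  by apply: lee_sum => k _; have [_] := JT t k; rewrite tm.
(* Membership in the ball controls [f] against [w_r], not [w_0]. Integrability against [w_0] is
   obtained here as a by-product: the pointwise error is dominated and the Smolyak operator produces
   an integrable function. *)
have iD : (muT d.+1).-integrable (cube d.+1 U) (EFin \o D).
  by apply/integrableP; split=> //; exact: le_lt_trans ID (ltry _).
have fE : (fun x => (f x * wd alpha 0 x)%:E) = (EFin \o D) \+ (EFin \o (fun x => Sev P m x f * wd alpha 0 x)).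
  by apply/funext => x; rewrite /= -EFinD /D; congr EFin; ring.
have ifw : (muT d.+1).-integrable (cube d.+1 U) (fun x => (f x * wd alpha 0 x)%:E).
  by rewrite fE; exact: integrableD.
rewrite intD_integrableE// fE integralD//.
rewrite -ES fineK; last exact: (integrable_fin_num mC iS).
rewrite addeK; last exact: (integrable_fin_num mC iS).
by apply: le_trans ID; exact: le_abse_integral.
Qed.
End quadrature.

(** * Integrals of partial derivatives with support in a box *)

Section integration_by_parts.
Context {R : realType}.
Local Notation mR := (measurableTypeR R).
Local Notation D1 := (@derive1 R R).

Definition box_supp d (a b : R) (g : d.-tuple R -> R) :=
  forall t, (exists i : 'I_d, ~ (a <= tnth t i <= b)) -> g t = 0.

Lemma contOn_continuous d (g : d.-tuple R -> R) : contOn setT g -> continuous (g \o @tupv R d).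
Proof.
move=> cg v; apply/(@cvgrPdist_lt _ _ _ _ (nbhs_filter v)) => e e0; have [del d0 H] := cg (tupv v) I _ e0.
apply/nbhs_ballP; exists del => // w /= [_ vw].
rewrite distrC; apply: H => // i.
by rewrite !tnth_mktuple distrC; exact: vw.
Qed.

Lemma contOnD d (f g : d.-tuple R -> R) : contOn setT f -> contOn setT g -> contOn setT (fun t => f t + g t).
Proof.
move=> /contOn_continuous cf /contOn_continuous cg; apply: continuous_contOn => v.
exact: (cvgD (cf v) (cg v)).
Qed.

Lemma contOnM d (f g : d.-tuple R -> R) : contOn setT f -> contOn setT g -> contOn setT (fun t => f t * g t).
Proof.
move=> /contOn_continuous cf /contOn_continuous cg; apply: continuous_contOn => v.
exact: (cvgM (cf v) (cg v)).
Qed.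

Lemma contOn_tcons d (g : d.+1.-tuple R -> R) x : contOn setT g -> contOn setT (fun t => g (tcons (x, t))).
Proof.
move=> cg t _ e e0; have [del d0 H] := cg (tcons (x, t)) I _ e0.
exists del => // s _ st; apply: H => // i.
case: (unliftP ord0 i) => [j ->|->]; first by rewrite !tconsS; exact: st.
by rewrite !tcons0 subrr normr0.
Qed.

Lemma continuous_head d (g : d.+1.-tuple R -> R) t : contOn setT g -> continuous (fun x : R => g (tcons (x, t))).
Proof.
move=> cg x; apply/cvgrPdist_lt => e e0; have [del d0 H] := cg (tcons (x, t)) I _ e0.
apply/nbhs_ballP; exists del => // y /= xy.
rewrite distrC; apply: H => // i.
case: (unliftP ord0 i) => [j ->|->]; first by rewrite !tconsS subrr normr0.
by rewrite !tcons0 distrC.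
Qed.

Lemma shift_tconsS d (x : R) (t : d.-tuple R) i h : shift (tcons (x, t)) (lift ord0 i) h = tcons (x, shift t i h).
Proof.
apply: eq_from_tnth => j; rewrite tnth_shift.
case: (unliftP ord0 j) => [k ->|->]; last by rewrite !tcons0 addr0.
by rewrite !tconsS tnth_shift (inj_eq lift_inj).
Qed.

Lemma shift_tcons0 d (x : R) (t : d.-tuple R) h : shift (tcons (x, t)) ord0 h = tcons (x + h, t).
Proof.
apply: eq_from_tnth => j; rewrite tnth_shift.
by case: (unliftP ord0 j) => [k ->|->]; rewrite ?tconsS ?tcons0 ?addr0.
Qed.

Lemma pd_tconsS d (g : d.+1.-tuple R -> R) x i t :
  pd (fun t => g (tcons (x, t))) i t = pd g (lift ord0 i) (tcons (x, t)).
Proof. by rewrite /pd; congr (derive1 _ 0); apply/funext => h; rewrite shift_tconsS. Qed.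

Lemma box_supp_pd d a b (g : d.-tuple R -> R) i : box_supp a b g -> box_supp a b (pd g i).
Proof.
move=> g0 t [j tj].
have far : \forall h \near (0 : R), g (shift t i h) = 0.
  pose u h : R := tnth t j + (if j == i then h else 0).
  have cu : {for 0, continuous u}.
    rewrite /u; case: eqP => _; last exact: cst_continuous.
    by apply: continuousD; [exact: cst_continuous|exact: cvg_id].
  have oC : open (~` `[a, b]%classic) by rewrite openC; exact: itv_closed.
  have u0 : (~` `[a, b]%classic) (u 0).
    by rewrite /u; case: ifP => _; rewrite addr0 /= in_itv.
  have H : nbhs (0 : R) (u @^-1` (~` `[a, b]%classic)) := cu _ (open_nbhs_nbhs (conj oC u0)).
  apply: filterS H => h uh.
  by apply: g0; exists j; rewrite tnth_shift; move: uh; rewrite /= in_itv.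
rewrite /pd derive1E; have : is_derive (0 : R) 1 (fun h => g (shift t i h)) 0.
  by apply: (@near_eq_is_derive _ _ _ (fun=> 0)); apply: filterS far => w ->.
by case.
Qed.

Lemma integrable_box_supp d a b (g : d.-tuple R -> R) : contOn setT g -> box_supp a b g ->
  (muT d).-integrable [set: d.-tuple mR] (EFin \o g).
Proof.
move=> cg g0.
have mab : measurable (`[a, b]%classic : set mR) by exact: measurable_itv.
have mC : measurable (cube d `[a, b] : set (d.-tuple mR)) by exact: measurable_cube.
have [K K0 gK] := contOn_bounded_box (contOnS (subsetT (cube d `[a, b])) cg).
have mg : measurable_fun [set: d.-tuple mR] g.
  rewrite (_ : setT = cube d setT); last by apply/seteqP; split.
  by apply: contOn_measurable; [exact: openT|exact: contOnS cg].
have E : (EFin \o g) = (EFin \o g) \_ (cube d `[a, b]).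
  apply/funext => t; rewrite /patch; case: ifPn => //; rewrite notin_setE => /existsNP[i /= ti].
  by rewrite /= g0//; exists i; move: ti; rewrite in_itv.
rewrite E -(@integrable_mkcond _ _ _ (muT d))//.
have i1 : leb.-integrable (`[a, b]%classic : set mR) (EFin \o (fun=> 1 : R)).
  by apply: continuous_compact_integrable; [exact: segment_compact|apply: continuous_subspaceT; exact: cst_continuous].
have [ip _] := @integral_tprod R d `[a, b]%classic (fun _ _ => 1) mab (fun=> i1).
apply: (le_integrable mC (g := fun t => (K * \prod_(i < d) 1)%:E)).
- by apply/measurable_EFinP; exact: measurable_funTS.
- by move=> t Ct /=; rewrite lee_fin big1// mulr1 (gtr0_norm K0) gK.
- exact: (integrableZl mC K ip).
Qed.

Lemma intD_pd0 d a b (G : d.-tuple R -> R) i :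
  (forall t, derivable (fun h => G (shift t i h)) 0 1) -> contOn setT (pd G i) -> box_supp a b G ->
  intD setT (fun t => (pd G i t)%:E) = 0%E.
Proof.
elim: d G i => [G []//|d IH] G i dG cG G0.
case: (unliftP ord0 i) dG cG => [j ->|->] dG cG.
  rewrite intDS integral0_eq// => x _.
  under eq_fun do rewrite -pd_tconsS; apply: IH.
  - by move=> t; have := dG (tcons (x, t)); under eq_fun do rewrite shift_tconsS.
  - rewrite (_ : pd _ j = fun t => pd G (lift ord0 j) (tcons (x, t))); first exact: contOn_tcons.
    by apply/funext => t; rewrite pd_tconsS.
  - move=> t [k tk]; apply: G0; exists (lift ord0 k); by rewrite tconsS.
have iG := integrable_box_supp cG (box_supp_pd ord0 G0).
rewrite intDT_integrableE//.
(* The first variable is outermost in the iterated integral; Fubini moves it inside, where the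
   fundamental theorem of calculus applies. *)
rewrite (_ : \int[_]_t _ = \int[leb \x muT d]_p (pd G ord0 (tcons p))%:E)%E; last first.
  rewrite /= /mucons integral_pushforward//.
  - exact: measurable_tcons.
  - exact: measurable_int iG.
  - by rewrite preimage_setT; exact: integrable_mucons.
rewrite -integral21_prod_meas1; last exact: (integrable_mucons iG).
rewrite integral0_eq// => t _; rewrite /fubini_G.
have Gx x : is_derive x (1 : R) (fun x => G (tcons (x, t))) (pd G ord0 (tcons (x, t))).
  have := dG (tcons (x, t)); under eq_fun do rewrite shift_tcons0.
  move=> /is_derive1E H.
  rewrite /pd; under [X in derive1 X]eq_fun do rewrite shift_tcons0.
  have K := @is_derive_affine _ (fun h => G (tcons (x + h, t))) 1 (- x) x _.
  rewrite mul1r subrr in K; have := K _ H.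
  by under eq_fun do rewrite mul1r addrCA subrr addr0; rewrite mul1r.
(* [a <= b] is not assumed; [m - 1] and [b + 1] are ordered and lie off the support in either
   case. *)
set m := Num.min a b; have ma : m <= a by rewrite ge_min lexx.
have mb : m <= b by rewrite ge_min lexx orbT.
have Gb : G (tcons (b + 1, t)) = 0 by apply: G0; exists ord0; rewrite tcons0 /= => /andP[_ bb]; lra.
have Ga : G (tcons (m - 1, t)) = 0 by apply: G0; exists ord0; rewrite tcons0 /= => /andP[am _]; lra.
rewrite (@integral_primitive _ (fun x => pd G ord0 (tcons (x, t))) _ setT (m - 1) (b + 1) _ _ Gx)//.
- by rewrite Ga Gb subrr.
- by lra.
- exact: continuous_head.
- move=> x xab; apply: (box_supp_pd ord0 G0); exists ord0; rewrite tcons0 => /andP[/= ax xb].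
  by move/negP: xab; apply; lra.
Qed.
End integration_by_parts.

(** * Classical derivatives of products are weak derivatives *)

Section weak_derivatives.
Context {R : realType} (U : set R).
Local Notation mR := (measurableTypeR R).
Local Notation D1 := (@derive1 R R).
Hypothesis oU : open U.

Let mU : measurable (U : set mR). Proof. exact: open_measurable. Qed.

Lemma smooth_pd d (g : d.-tuple R -> R) i : smooth g -> smooth (pd g i).
Proof. by move=> sg s; have := sg (rcons s i); rewrite foldr_rcons. Qed.

Lemma intD_box_supp d a b (g : d.-tuple R -> R) : `[a, b] `<=` U -> box_supp a b g ->
  intD U (fun t => (g t)%:E) = intD setT (fun t => (g t)%:E).
Proof.
move=> abU g0; rewrite intD_mkcond; congr intD; apply/funext => t.
rewrite /patch; case: ifPn => //; rewrite notin_setE => /existsNP[i ti].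
by rewrite g0//; exists i => ab; apply/ti/abU; rewrite /= in_itv.
Qed.

Section fixd.
Variables (d : nat) (a b : R).
Hypothesis abU : `[a, b] `<=` U.

Lemma box_supp_tprod (phi : 'I_d -> R -> R) :
  (forall i y, ~~ (a <= y <= b) -> phi i y = 0) -> box_supp a b (tprod phi).
Proof. by move=> p0 t [i /negP ti]; rewrite /tprod (bigD1 i)//= p0// mul0r. Qed.

Lemma box_suppM (f g : d.-tuple R -> R) : box_supp a b f -> box_supp a b (fun t => f t * g t).
Proof. by move=> f0 t /f0 ->; rewrite mul0r. Qed.

Let adm (phi : 'I_d -> R -> R) := (forall i, Coo (phi i)) /\ (forall i y, ~~ (a <= y <= b) -> phi i y = 0).

Let adm_upd phi i n : adm phi -> adm (upd phi i (iter n D1 (phi i))).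
Proof.
move=> [p1 p2]; split=> j; rewrite /upd; case: eqP => _.
- exact/Coo_iter/p1.
- exact: p1.
- by move=> y; apply: iter_derive_supp; exact: p2.
- exact: p2.
Qed.

Let contOn_adm phi : adm phi -> contOn setT (tprod phi).
Proof. by move=> [p1 p2]; apply: contOn_tprod => i; exact: Coo_continuous. Qed.

(** The derivative of the product integrates to zero by [intD_pd0]. The support in a box comes from
    [phi] alone, so [chi] may be any smooth function. *)
Lemma by_parts phi chi i : adm phi -> smooth chi ->
  intD U (fun t => (tprod phi t * pd chi i t)%:E) =
  (- intD U (fun t => (tprod (upd phi i (D1 (phi i))) t * chi t)%:E))%E.
Proof.
move=> ap sc; have [p1 p2] := ap; have ap' := adm_upd i 1 ap.
have c1 := (sc [::]).2; have c2 := (sc [:: i]).2; rewrite /= in c1 c2.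
have dc t := (sc [::]).1 i t; rewrite /= in dc.
have dG t : is_derive (0 : R) (1 : R) (fun h => tprod phi (shift t i h) * chi (shift t i h))
    (tprod (upd phi i (D1 (phi i))) t * chi t + tprod phi t * pd chi i t).
  have s0 : shift t i 0 = t.
    by apply: eq_from_tnth => j; rewrite tnth_shift; case: ifP; rewrite addr0.
  have H := is_deriveM (is_derive_tprod t (p1 i)) (is_derive1E (dc t)).
  by apply: (is_derive_eq H); rewrite /= s0 /GRing.scale /= addrC [chi t * _]mulrC.
pose G t := tprod phi t * chi t.
have pG : pd G i = fun t => tprod (upd phi i (D1 (phi i))) t * chi t + tprod phi t * pd chi i t.
  by apply/funext => t; rewrite /pd derive1E; have := dG t => H; exact: derive_val.
have b1 : box_supp a b (fun t => tprod (upd phi i (D1 (phi i))) t * chi t).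
  by apply: box_suppM; apply: box_supp_tprod; case: ap'.
have b2 : box_supp a b (fun t => tprod phi t * pd chi i t).
  by apply: box_suppM; apply: box_supp_tprod.
have k1 : contOn setT (fun t => tprod (upd phi i (D1 (phi i))) t * chi t).
  by apply: contOnM => //; exact: contOn_adm.
have k2 : contOn setT (fun t => tprod phi t * pd chi i t).
  by apply: contOnM => //; exact: contOn_adm.
have i1 := integrable_box_supp k1 b1; have i2 := integrable_box_supp k2 b2.
have I0 : intD setT (fun t => (pd G i t)%:E) = 0%E.
  apply: (@intD_pd0 _ d a b).
  - by move=> t; exact: is_derive_derivable (dG t).
  - by rewrite pG; exact: contOnD.
  - exact/box_suppM/box_supp_tprod.
have i12 := integrableD measurableT i1 i2.
have I12 := integralD measurableT i1 i2.
rewrite pG intDT_integrableE// in I0;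
rewrite !(intD_box_supp abU)// !intDT_integrableE//.
have f1 := integrable_fin_num measurableT i1; have f2 := integrable_fin_num measurableT i2.
have := etrans (esym I12) I0.
move: f1 f2; case: (\int[_]_t _)%E => [x| |]//; case: (\int[_]_t _)%E => [y| |]// _ _.
by rewrite -EFinD => -[] /eqP; rewrite addr_eq0 => /eqP ->; rewrite EFinN oppeK.
Qed.

Lemma by_parts_iter phi chi i n : adm phi -> smooth chi ->
  intD U (fun t => (tprod phi t * iter n (fun g => pd g i) chi t)%:E) =
  ((-1) ^+ n * intD U (fun t => (tprod (upd phi i (iter n D1 (phi i))) t * chi t)%:E))%E.
Proof.
elim: n chi => [|n IH] chi ap sc.
  by rewrite expe0 mul1e /= upd_id.
under eq_fun do rewrite iterSr; rewrite IH//; last exact: smooth_pd.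
rewrite by_parts//; last exact: adm_upd.
rewrite expeS muleN -mulNe mulN1e; congr (_ * intD _ _)%E.
apply/funext => t; congr ((tprod _ _ * _)%:E).
by apply/funext => j; rewrite /upd eqxx; case: eqP.
Qed.

Lemma by_parts_Dk phi chi (k : 'I_d -> nat) : adm phi -> smooth chi ->
  intD U (fun t => (tprod phi t * Dk k chi t)%:E) =
  ((-1) ^+ (\sum_(i < d) k i) * intD U (fun t => (tprod (fun i => iter (k i) D1 (phi i)) t * chi t)%:E))%E.
Proof.
move=> ap sc; rewrite /Dk.
suff H s psi : uniq s -> adm psi ->
    intD U (fun t => (tprod psi t * foldr (fun i g => iter (k i) (fun g => pd g i) g) chi s t)%:E) =
    ((-1) ^+ (\sum_(i <- s) k i) *
    intD U (fun t => (tprod (fun i => if i \in s then iter (k i) D1 (psi i) else psi i) t * chi t)%:E))%E.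
  rewrite H ?enum_uniq// big_enum /=; congr (_ * intD _ _)%E.
  by apply/funext => t; congr ((tprod _ _ * _)%:E); apply/funext => i; rewrite mem_enum.
elim: s psi => [|i s IH] psi /=.
  by move=> _ _; rewrite big_nil expe0 mul1e.
move=> /andP[si us] apsi.
have sf : smooth (foldr (fun i g => iter (k i) (fun g => pd g i) g) chi s).
  elim: s {IH si us} => //= j s; elim: (k j) => //= n IH2 IH; apply: smooth_pd; exact: IH2.
rewrite by_parts_iter// IH//; last exact: adm_upd.
rewrite big_cons muleA; congr *%E; last congr intD.
  have sE n : ((-1) ^+ n = ((-1) ^+ n : R)%:E)%E by rewrite EFin_expe.
  by rewrite !sE -EFinM exprD.
apply/funext => t; congr ((tprod _ _ * _)%:E).
apply/funext => j; rewrite /upd in_cons; case: eqP => //= ->.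
by rewrite (negbTE si).
Qed.

Lemma weak_deriv_tprod phi (k : 'I_d -> nat) :
  (forall i, Coo (phi i)) -> (forall i y, ~~ (a <= y <= b) -> phi i y = 0) ->
  weak_deriv U k (tprod phi) (tprod (fun i => iter (k i) D1 (phi i))).
Proof.
move=> p1 p2; have ap : adm phi by split.
have ck i : continuous (iter (k i) D1 (phi i)) by apply/Coo_continuous/Coo_iter.
have cg : contOn setT (tprod (fun i => iter (k i) D1 (phi i))) by exact: contOn_tprod.
split; first by apply: contOn_measurable => //; exact: contOnS cg.
split; last by move=> chi [sc _]; exact: by_parts_Dk.
move=> a' b' _.
have b0 : box_supp a b (tprod (fun i => iter (k i) D1 (phi i))).
  by apply: box_supp_tprod => i y; apply: iter_derive_supp; exact: p2.
have ig := integrable_box_supp cg b0.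
have mab : measurable (`[a', b']%classic : set mR) by exact: measurable_itv.
have mC : measurable (cube d `[a', b'] : set (d.-tuple mR)) by exact: measurable_cube.
have /integrableP[mg Ig] : (muT d).-integrable (cube d `[a', b']) (EFin \o tprod (fun i => iter (k i) D1 (phi i))).
  exact: integrableS ig.
rewrite intD_ge0E//.
by apply/measurable_EFinP; apply: measurableT_comp => //; exact/measurable_EFinP.
Qed.
End fixd.
End weak_derivatives.

(** * Fooling functions and the lower bound *)

Section lower_bound.
Context {R : realType} (alpha : R) (r : nat) (U : set R).
Local Notation mR := (measurableTypeR R).
Local Notation D1 := (@derive1 R R).
Hypothesis oU : open U.
Hypothesis posU : `]0, +oo[ `<=` U.

Let mU : measurable (U : set mR). Proof. exact: open_measurable. Qed.

(** The norm of a product is a sum of products over [(r+1)^d] multi-indices, so a bound [1/(r+1)]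
    per factor and order is what brings it down to [1]. *)
Lemma sobolev_ball_tprod d (phi : 'I_d -> R -> R) a b : `[a, b] `<=` U ->
  (forall i, Coo (phi i)) -> (forall i y, ~~ (a <= y <= b) -> phi i y = 0) ->
  (forall i n, (n <= r)%N ->
    (\int[leb]_(x in (U : set mR)) (`|iter n D1 (phi i) x| * w1 alpha r x)%:E <= (r.+1%:R^-1)%:E)%E) ->
  sobolev_ball d U alpha r (tprod phi).
Proof.
move=> abU p1 p2 pN.
have mC : measurable (cube d U : set (d.-tuple mR)) by exact: measurable_cube.
split; first by apply: contOnS (contOn_tprod (fun i => Coo_continuous (p1 i))).
exists (fun (k : {ffun 'I_d -> 'I_r.+1}) => tprod (fun i => iter (k i) D1 (phi i))).
split; first by move=> k; exact: (weak_deriv_tprod oU abU).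
apply: (@le_trans _ _ (\sum_(k : {ffun 'I_d -> 'I_r.+1}) ((r.+1%:R^-1) ^+ d)%:E)%E); last first.
  rewrite sumEFin sumr_const card_ffun !card_ord lee_fin -[leLHS]mulr_natl natrX -exprMn.
  by rewrite divff ?expr1n// pnatr_eq0.
apply: lee_sum => k _.
pose F i x := `|iter (k i) D1 (phi i) x| * w1 alpha r x.
have mF i : measurable_fun [set: mR] (F i).
  apply: measurable_funM; last exact: measurable_w1.
  apply: (measurableT_comp (@normr_measurable R setT)).
  by apply: continuous_measurable_fun; apply/Coo_continuous/Coo_iter.
have F0 i x : 0 <= F i x by rewrite mulr_ge0 ?w1_ge0.
have Fb i : (\int[leb]_(x in (U : set mR)) (F i x)%:E <= (r.+1%:R^-1)%:E)%E.
  by apply: pN; rewrite -ltnS.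
have iF i : leb.-integrable (U : set mR) (EFin \o F i).
  apply/integrableP; split; first exact/measurable_EFinP/measurable_funTS.
  apply: le_lt_trans (le_lt_trans (Fb i) (ltry _)).
  by apply: integral_mono => x _ /=; rewrite ger0_norm.
have [iP EP] := integral_tprod mU iF.
rewrite (_ : intD _ _ = intD U (fun t => (\prod_(i < d) F i (tnth t i))%:E)); last first.
  congr intD; apply/funext => t; congr EFin.
  by rewrite /F big_split /tprod normr_prod.
rewrite intD_integrableE// EP lee_fin -[X in _ ^+ X]card_ord -prodr_const.
apply: ler_prod => i _; rewrite Rintegral_ge0//=.
by rewrite -lee_fin /Rintegral fineK//; exact: (integrable_fin_num mU (iF i)).
Qed.

Lemma iter_rho_bounded n : exists2 B, 0 < B & forall m, (m <= n)%N -> forall x, `|iter m D1 (@rho R) x| <= B.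
Proof.
have [cr _ _ rz _] := @rhoP R.
have one m : exists2 B, 0 < B & forall x, `|iter m D1 (@rho R) x| <= B.
  have cm : continuous (fun x => `|iter m D1 (@rho R) x|).
    by move=> x; apply: continuous_comp; [exact/Coo_continuous/Coo_iter|exact: norm_continuous].
  have [c _ Hc] := @EVT_max _ _ 0 1 ler01 (continuous_subspaceT cm).
  exists (`|iter m D1 rho c| + 1); first by rewrite ltr_wpDl.
  move=> x; have [x01|x01] := boolP (0 <= x <= 1).
    by rewrite ler_wpDr// Hc// in_itv.
  rewrite (iter_derive_supp (a := 0) (b := 1))// ?normr0 ?addr_ge0// => y y01.
  by apply: rz; apply: contra y01 => /andP[/ltW -> /ltW ->].
elim: n => [|n [B B0 HB]].
  by have [B B0 HB] := one 0%N; exists B => // m; rewrite leqn0 => /eqP ->.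
have [B' B'0 HB'] := one n.+1; exists (B + B'); first exact: addr_gt0.
move=> m; rewrite leq_eqVlt => /predU1P[->|/HB Hm] x.
  by rewrite (le_trans (HB' x))// lerDr ltW.
by rewrite (le_trans (Hm x))// lerDl ltW.
Qed.

(** A shifted bump on [(s, s + 1)], scaled down by the size of [w_r] there, keeps a [w_0]-integral
    of order [w_0 s / w_r s = s^(-r/2)]: far from the origin the norm is expensive relative to the
    integral. *)
Lemma weighted_bump : exists2 c, 0 < c & forall s, 1 <= s -> exists phi : R -> R,
  [/\ Coo phi, forall x, 0 <= phi x, forall x, ~~ (s < x < s + 1) -> phi x = 0,
    forall n, (n <= r)%N ->
      (\int[leb]_(x in (U : set mR)) (`|iter n D1 phi x| * w1 alpha r x)%:E <= (r.+1%:R^-1)%:E)%E &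
    ((c * (Num.sqrt s)^-1 ^+ r)%:E <= \int[leb]_(x in (U : set mR)) (phi x * w1 alpha 0 x)%:E)%E].
Proof.
have [cr ds r0 rz [s0 s1]] := @rhoP R.
have [B B0 HB] := iter_rho_bounded r.
(* For [s >= 1], points of [[s, s + 1]] differ by a ratio of at most [2] and a distance of at most
   [1]; [K a] is the resulting loss for a weight of exponent [a]. *)
pose K (a : R) := 2 `^ `|a| * expR 1 : R.
have K0 a : 0 < K a by rewrite mulr_gt0 ?powR_gt0 ?expR_gt0.
pose Kr := K (alpha + r%:R / 2).
have wr x : w1 alpha r x = w1 (alpha + r%:R / 2) 0 x by rewrite /w1 mul0r addr0.
exists ((r.+1%:R * B * Kr * K alpha)^-1); first by rewrite invr_gt0 !mulr_gt0.
move=> s s1'; have s_gt0 : 0 < s by lra.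
have ws := w1_gt0 alpha r s_gt0.
pose A := (r.+1%:R * (B * (Kr * w1 alpha r s)))^-1.
have A0 : 0 < A by rewrite invr_gt0 mulr_gt0 ?ltr0n ?(mulr_gt0 B0) ?(mulr_gt0 (K0 _) ws).
pose phi x := A * rho (1 * x + - s).
have phi0 x : ~~ (s < x < s + 1) -> phi x = 0.
  move=> H; rewrite /phi rz ?mulr0//; apply: contra H; rewrite mul1r subr_gt0 => /andP[-> /=].
  by rewrite ltrBlDl.
have subU x : s <= x -> U x by move=> sx; apply: posU; rewrite /= in_itv/= andbT; lra.
exists phi; split=> //.
- by apply: CooZ; exact: Coo_affine.
- by move=> x; rewrite mulr_ge0 ?(ltW A0).
- move=> n nr; have -> : (r.+1%:R)^-1 = A * (B * (Kr * w1 alpha r s)) * (s + 1 - s).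
    have X0 : 0 < B * (Kr * w1 alpha r s) by rewrite (mulr_gt0 B0) ?(mulr_gt0 (K0 _) ws).
    by rewrite [s + 1]addrC addrK mulr1 /A invfM -mulrA mulVf ?mulr1// gt_eqF.
  apply: int_bound; [by rewrite !mulr_ge0// ltW|lra|].
  move=> x Ux; case: ifPn => [/andP[sx xs]|xs]; last first.
    by rewrite (iter_derive_supp (a := s) (b := s + 1)) ?normr0 ?mul0r// => y ys;
      apply: phi0; apply: contra ys => /andP[/ltW -> /ltW ->].
  rewrite iter_deriveZ; last exact: Coo_affine.
  rewrite iter_derive_affine// expr1n mul1r normrM (gtr0_norm A0) -!mulrA ler_wpM2l ?(ltW A0)//.
  rewrite ler_pM ?w1_ge0// ?HB// !wr.
  by rewrite /Kr /K mulrA; apply: w1_compare; lra.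
- have -> : (r.+1%:R * B * Kr * K alpha)^-1 * (Num.sqrt s)^-1 ^+ r = A * (K alpha)^-1 * w1 alpha 0 s.
    have alg (u v w z p t e : R) : u != 0 -> v != 0 -> w != 0 -> z != 0 -> p != 0 -> t != 0 -> e != 0 ->
        (u * v * w * z)^-1 * t^-1 = (u * (v * (w * (p * t * e))))^-1 * z^-1 * (p * e).
      by move=> *; field; do !(apply/andP; split).
    rewrite /A !w1E// expr0 mulr1 exprVn; apply: alg; rewrite ?pnatr_eq0//.
    - by rewrite gt_eqF.
    - by rewrite /Kr gt_eqF.
    - by rewrite gt_eqF.
    - by rewrite gt_eqF ?powR_gt0.
    - by rewrite gt_eqF ?exprn_gt0 ?sqrtr_gt0.
    - by rewrite gt_eqF ?expR_gt0.
  apply: (@le_trans _ _ (\int[leb]_(x in (U : set mR)) ((K alpha)^-1 * w1 alpha 0 s * phi x)%:E)%E); last first.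
    apply: integral_mono => x Ux; rewrite lee_fin mulrC.
    have [/andP[sx xs]|/phi0 ->] := boolP (s < x < s + 1); last by rewrite !mul0r.
    rewrite ler_wpM2l ?mulr_ge0 ?(ltW A0)//.
    by rewrite mulrC ler_pdivrMr// mulrC /K; apply: w1_compare; lra.
  pose P x := (K alpha)^-1 * w1 alpha 0 s * (A * step (1 * x + - s)).
  have dP (x : R) : is_derive x (1 : R) P ((K alpha)^-1 * w1 alpha 0 s * phi x).
    have H := is_derive_affine (a := 1) (ds (1 * x + - s)).
    have H2 := is_deriveZ ((K alpha)^-1 * w1 alpha 0 s) (is_deriveZ A H).
    by apply: (is_derive_eq H2); rewrite mul1r.
  have ss : s <= s + 1 by lra.
  have cP : continuous (fun x => (K alpha)^-1 * w1 alpha 0 s * phi x).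
    by apply/Coo_continuous/CooZ/CooZ/Coo_affine.
  rewrite (integral_primitive ss cP dP).
  + have e1 : step (1 * (s + 1) + - s) = 1 by rewrite s1//; lra.
    have e0 : step (1 * s + - s) = 0 by rewrite s0//; lra.
    by rewrite /P e1 e0 lee_fin; lra.
  + by move=> x /=; rewrite in_itv/= => /andP[sx _]; exact: subU.
  + by move=> x xs; rewrite phi0 ?mulr0//; apply: contra xs => /andP[/ltW -> /ltW ->].
Qed.

(** Pigeonhole: a point can spoil only the index equal to its integer part, and there are more
    indices than points. *)
Lemma missed_level n (s : seq R) : (size s <= n)%N -> exists j : nat,
  (1 <= j <= n.+1)%N /\ forall x, x \in s -> ~~ (j%:R < x < j%:R + 1).
Proof.
move=> sn; apply: contrapT => H.
suff : {subset iota 1 n.+1 <= [seq Num.truncn x | x <- s]}.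
  by move=> /(uniq_leq_size (iota_uniq _ _)); rewrite size_iota size_map => /leq_trans/(_ sn); rewrite ltnn.
move=> j; rewrite mem_iota add1n ltnS => jn; apply: contrapT => /negP js; apply: H; exists j; split=> // x xs.
apply: contra js => /andP[jx xj]; apply/mapP; exists x => //; apply/esym/truncn_def.
by rewrite (ltW jx) -natr1.
Qed.

Lemma Int_n_lower d : exists2 c, 0 < c & forall n,
  ((c * (Num.sqrt n.+1%:R)^-1 ^+ r)%:E <= Int_n d.+1 U alpha n (sobolev_ball d.+1 U alpha r))%E.
Proof.
have [c c0 Hc] := weighted_bump; exists (c ^+ d.+1); first exact: exprn_gt0.
move=> n; apply/ereal_infP => _ [Q [Qn _] <-].
have [|j [/andP[j1 jn] jQ]] := @missed_level n [seq tnth p.2 ord0 | p <- Q]; first by rewrite size_map.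
have j1R : 1 <= j%:R :> R by rewrite ler1n.
have [phi0 [a1 a2 a3 a4 a5]] := Hc _ j1R.
have [phi1 [b1 b2 b3 b4 b5]] := Hc _ (lexx 1).
pose phi (i : 'I_d.+1) := if i == ord0 then phi0 else phi1.
have Cphi i : Coo (phi i) by rewrite /phi; case: ifP.
have phi_ge0 i x : 0 <= phi i x by rewrite /phi; case: ifP.
have jnR : j%:R <= n%:R + 1 :> R by rewrite natr1 ler_nat.
have n0 : 0 <= n%:R :> R by [].
have supp i x : ~~ (1 <= x <= n%:R + 2) -> phi i x = 0.
  by move=> H; rewrite /phi; case: ifP => _; [apply: a3|apply: b3]; apply: contra H; lra.
have small i m : (m <= r)%N ->
    (\int[leb]_(x in (U : set mR)) (`|iter m D1 (phi i) x| * w1 alpha r x)%:E <= (r.+1%:R^-1)%:E)%E.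
  by rewrite /phi; case: ifP => _; [exact: a4|exact: b4].
have subU : `[1, n%:R + 2] `<=` U.
  by move=> x /=; rewrite in_itv/= => /andP[x1 _]; apply: posU; rewrite /= in_itv/= andbT; lra.
have ball : sobolev_ball d.+1 U alpha r (tprod phi) := sobolev_ball_tprod subU Cphi supp small.
apply: le_trans (ereal_sup_ubound _); last by exists (tprod phi) => //; exact: ball.
have Q0 : \sum_(p <- Q) p.1 * tprod phi p.2 = 0.
  rewrite big_seq big1// => p pQ; rewrite /tprod big_ord_recl /phi eqxx a3 ?mul0r ?mulr0//.
  by apply: jQ; apply/mapP; exists p.
rewrite Q0 sube0; apply: le_trans (lee_abs _).
pose F i x := phi i x * w1 alpha 0 x.
have iF i : leb.-integrable (U : set mR) (EFin \o F i).
  apply/integrableP; split.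
    apply/measurable_EFinP/measurable_funTS; apply: measurable_funM; last exact: measurable_w1.
    exact: continuous_measurable_fun (Coo_continuous (Cphi i)).
  (* The bump lives on [x >= 1], where [w_0 <= w_r], so the norm bound of order [0] gives
     integrability against [w_0]. *)
  apply: le_lt_trans (le_lt_trans (small i 0%N (leq0n r)) (ltry _)).
  apply: integral_mono => x _; rewrite /= lee_fin ger0_norm ?mulr_ge0 ?w1_ge0// ger0_norm// /F.
  have [/andP[x1 _]|/(supp i) ->] := boolP (1 <= x <= n%:R + 2); last by rewrite !mul0r.
  rewrite ler_wpM2l// !w1E; [|lra..].
  rewrite ler_wpM2r ?expR_ge0// ler_wpM2l ?powR_ge0// expr0 exprn_ege1//.
  by rewrite -[leLHS]sqrtr1 ler_wsqrtr.
have [iP EP] := integral_tprod mU iF.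
rewrite (_ : intD _ _ = intD U (fun t => (\prod_(i < d.+1) F i (tnth t i))%:E)); last first.
  by congr intD; apply/funext => t; congr EFin; rewrite big_split.
rewrite intD_integrableE// EP lee_fin.
have lowF i s : (s%:E <= \int[leb]_(x in (U : set mR)) (F i x)%:E)%E -> s <= \int[leb]_(x in (U : set mR)) F i x.
  by move=> H; rewrite -lee_fin /Rintegral fineK//; exact: (integrable_fin_num mU (iF i)).
have low i : c * (if i == ord0 then (Num.sqrt n.+1%:R)^-1 ^+ r else 1) <= \int[leb]_(x in (U : set mR)) F i x.
  apply: lowF; rewrite /F /phi; case: ifP => _.
    apply: le_trans a5; rewrite lee_fin ler_wpM2l ?(ltW c0)//.
    rewrite lerXn2r ?nnegrE ?invr_ge0 ?sqrtr_ge0// lef_pV2 ?posrE ?sqrtr_gt0 ?ltr0n//.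
    by rewrite ler_wsqrtr// ler_nat.
  by apply: le_trans b5; rewrite sqrtr1 invr1 expr1n.
apply: (@le_trans _ _ (\prod_(i < d.+1) (c * (if i == ord0 then (Num.sqrt n.+1%:R)^-1 ^+ r else 1)))).
  by rewrite big_split /= prodr_const card_ord big_ord_recl eqxx big1 ?mulr1.
apply: ler_prod => i _; rewrite low andbT mulr_ge0 ?(ltW c0)//.
by case: ifP; rewrite ?exprn_ge0 ?invr_ge0 ?sqrtr_ge0.
Qed.
End lower_bound.

(** * Conversion of levels into powers of [n] and of the logarithm *)

Section asymptotics.
Context {R : realType}.
Implicit Types (a b x y : R).

(** The inequality [ln y <= y] at [y = x^(b/a)], raised to the power [a]. *)
Lemma ln_powR_le a b x : 0 < a -> 0 < b -> 1 <= x -> ln x `^ a <= (a / b) `^ a * x `^ b.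
Proof.
move=> a0 b0 x1; have x0 : 0 < x by lra.
have ab0 : 0 < a / b by rewrite divr_gt0.
have lnE : ln x = a / b * ln (x `^ (b / a)).
  by rewrite ln_powR; field; apply/andP; split; rewrite gt_eqF.
have le1 : ln (x `^ (b / a)) <= x `^ (b / a).
  by rewrite ltW// ln_sublinear ?powR_gt0.
have -> : x `^ b = (x `^ (b / a)) `^ a by rewrite -powRrM divfK// gt_eqF.
rewrite -powRM ?powR_ge0 ?(ltW ab0)// ge0_ler_powR ?nnegrE ?(ltW a0) ?ln_ge0//.
  by rewrite mulr_ge0 ?powR_ge0 ?(ltW ab0).
by rewrite lnE ler_wpM2l ?(ltW ab0).
Qed.

Lemma max_level (A D n : nat) : (0 < A)%N -> (0 < D)%N -> exists m : nat,
  (A * m ^ D * 2 ^ m <= n < A * m.+1 ^ D * 2 ^ m.+1)%N.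
Proof.
move=> A0 D0; have exm : exists m, (A * m ^ D * 2 ^ m <= n)%N.
  (* Positivity of [D] makes the cost of level [0] vanish, so some level always fits into the budget
     [n]. *)
  by exists 0%N; rewrite exp0n// muln0.
have ub m : (A * m ^ D * 2 ^ m <= n)%N -> (m <= n)%N.
  case: m => // m; apply: leq_trans; apply: leq_trans (ltnW (ltn_expl _ (isT : 1 < 2)%N)) _.
  by rewrite leq_pmull// muln_gt0 A0 expn_gt0.
case: (ex_maxnP exm ub) => m Hm mm; exists m; rewrite Hm ltnNge.
by apply/negP => /mm; rewrite ltnn.
Qed.

(** Since the next level does not fit, [2^(-m r/2)] is at most [(2A (m+1)^D / n)^(r/2)]. Its factor
    [(m+1)^(D r/2)] joins the [(m+1)^D] already present, whence the exponent [(r/2 + 1) D] once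
    [m + 1] is replaced by a multiple of [ln n]. *)
Lemma smolyak_rate r (A D : nat) : (0 < A)%N -> exists2 c : R, 0 < c & forall n m : nat,
  (2 <= n)%N -> (A * m ^ D * 2 ^ m <= n < A * m.+1 ^ D * 2 ^ m.+1)%N -> (0 < D)%N ->
  m.+1%:R ^+ D * q r ^+ m <= c * n%:R `^ (- (r%:R / 2)) * ln n%:R `^ ((r%:R / 2 + 1) * D%:R).
Proof.
move=> A0; set s : R := r%:R / 2.
have s0 : 0 <= s by rewrite divr_ge0.
have ln2 : 0 < ln 2 :> R by rewrite ln_gt0// ltr1n.
exists ((2 * A%:R) `^ s * (2 / ln 2) `^ ((s + 1) * D%:R)).
  by rewrite mulr_gt0 ?powR_gt0 ?mulr_gt0 ?invr_gt0 ?ltr0n.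
move=> n m n2 /andP[nA An] D0.
have N0 : 0 < n%:R :> R by rewrite ltr0n; lia.
have X0 : 0 < m.+1%:R :> R by rewrite ltr0n.
have Y0 : 0 < (2 ^ m)%:R :> R by rewrite ltr0n expn_gt0.
have K0 : 0 < 2 * A%:R :> R by rewrite mulr_gt0 ?ltr0n.
have Lge : ln 2 <= ln n%:R :> R by rewrite ler_ln ?posrE// ler_nat.
(* For [m > 0] the budget gives [2^m <= n]; for [m = 0] it gives nothing. In both cases the extra
   [1] is covered by [ln 2 <= ln n]. *)
have XL : m.+1%:R <= 2 / ln 2 * ln n%:R :> R.
  rewrite mulrAC ler_pdivlMr// -natr1 mulrDl mul1r mulr_natl mulrDl mul1r lerD//.
  case: (posnP m) => [->|m0]; first by rewrite mulr0n (le_trans (ltW ln2)).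
  rewrite -lnXn// ler_ln ?posrE ?exprn_gt0//. rewrite -natrX ler_nat.
  by apply: leq_trans nA; rewrite leq_pmull// muln_gt0 A0 expn_gt0 m0.
have NK : n%:R <= 2 * A%:R * m.+1%:R ^+ D * (2 ^ m)%:R :> R.
  have -> : 2 * A%:R * m.+1%:R ^+ D * (2 ^ m)%:R = (2 * A * m.+1 ^ D * 2 ^ m)%:R :> R.
    by rewrite !natrM [in RHS]natrX.
  by rewrite ler_nat (leq_trans (ltnW An))// expnS; apply: eq_leq; ring.
rewrite -q_level exprVn -powR_half ?ler0n// -/s; clearbody s.
have NY : n%:R `^ s <= (2 * A%:R) `^ s * m.+1%:R `^ (s * D%:R) * (2 ^ m)%:R `^ s :> R.
  rewrite [s * _]mulrC powRrM powR_mulrn ?ler0n// -!powRM ?mulr_ge0 ?exprn_ge0 ?ler0n//.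
  by apply: ge0_ler_powR NK => //; rewrite nnegrE ?mulr_ge0 ?exprn_ge0 ?ler0n ?(ltW K0).
have Ns0 : 0 < n%:R `^ s :> R by rewrite powR_gt0.
have Ys0 : 0 < (2 ^ m)%:R `^ s :> R by rewrite powR_gt0.
rewrite powRN; apply: (@le_trans _ _ ((2 * A%:R) `^ s * m.+1%:R `^ ((s + 1) * D%:R) * (n%:R `^ s)^-1)).
  rewrite ler_pdivrMr// mulrAC ler_pdivlMr//. rewrite [(s + 1) * _]mulrDl mul1r powRD; last first.
    by rewrite (gt_eqF X0) implybT.
  rewrite (@powR_mulrn _ _ D) ?ler0n//.
  have : 0 <= m.+1%:R ^+ D :> R by rewrite exprn_ge0.
  move=> /ler_wpM2l/(_ _ _ NY)/le_trans; apply.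
  by rewrite le_eqVlt; apply/predU1P; left; ring.
rewrite [leRHS]mulrAC ler_wpM2r ?invr_ge0 ?powR_ge0// -mulrA ler_wpM2l ?powR_ge0//.
have L0 : 0 <= ln n%:R :> R by exact: le_trans (ltW ln2) Lge.
have B0 : 0 <= 2 / ln 2 :> R by rewrite divr_ge0// ltW.
rewrite -powRM//; apply: ge0_ler_powR XL; rewrite ?nnegrE ?mulr_ge0 ?addr_ge0 ?invr_ge0 ?(ltW ln2)//.
Qed.

(** Split [3r/4] as [r/2 + r/4]: the spare [n^(-r/4)] absorbs the power of the logarithm, and
    [n + 1 <= 2n] costs [2^(r/2)]. *)
Lemma log_power_rate r D : (0 < r)%N -> (0 < D)%N -> exists2 c : R, 0 < c & forall n : nat, (2 <= n)%N ->
  c * n%:R `^ (- (3 * r%:R / 4)) * ln n%:R `^ (3 * r%:R * D%:R / 4) <= (Num.sqrt n.+1%:R)^-1 ^+ r.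
Proof.
move=> r0 D0; set a : R := 3 * r%:R * D%:R / 4; set b : R := r%:R / 4; set s : R := r%:R / 2.
have rR : 0 < r%:R :> R by rewrite ltr0n.
have DR : 0 < D%:R :> R by rewrite ltr0n.
have a0 : 0 < a by rewrite !mulr_gt0.
have b0 : 0 < b by rewrite !mulr_gt0.
have s0 : 0 < s by rewrite !mulr_gt0.
exists (((a / b) `^ a)^-1 * (2 `^ s)^-1).
  by rewrite mulr_gt0// invr_gt0 powR_gt0// divr_gt0.
move=> n n2; have n1 : 1 <= n%:R :> R by rewrite ler1n (leq_trans _ n2).
have n0 : 0 < n%:R :> R by exact: lt_le_trans n1.
have ab0 : 0 < (a / b) `^ a by rewrite powR_gt0// divr_gt0.
have [ns0 nb0] : 0 < n%:R `^ s /\ 0 < n%:R `^ b by split; rewrite powR_gt0.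
have t0 : 0 < 2 `^ s :> R by rewrite powR_gt0.
rewrite exprVn -powR_half ?ler0n// -/s.
have -> : 3 * r%:R / 4 = s + b by rewrite /s /b; field.
rewrite powRN powRD; last by rewrite (gt_eqF n0) implybT.
apply: (@le_trans _ _ ((2 `^ s * n%:R `^ s)^-1)).
  apply: le_trans (ler_wpM2l _ (ln_powR_le a0 b0 n1)) _.
    by rewrite !mulr_ge0 ?invr_ge0 ?mulr_ge0 ?powR_ge0.
  by rewrite le_eqVlt; apply/predU1P; left; field; rewrite !gt_eqF.
rewrite -powRM// lef_pV2 ?posrE ?powR_gt0 ?mulr_gt0//.
apply: ge0_ler_powR; rewrite ?nnegrE ?mulr_ge0 ?(ltW s0)//.
by rewrite -natrM ler_nat; lia.
Qed.
End asymptotics.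

(** * Choice of the level and assembly of both bounds *)

Lemma Int_n_upper (R : realType) (alpha : R) r U D : -1 < alpha -> (1 <= r)%N -> (0 < D)%N ->
  (U = setT \/ U = `]0, +oo[%classic) ->
  exists2 c : R, 0 < c & forall n : nat, (2 <= n)%N ->
    (Int_n D.+1 U alpha n (sobolev_ball D.+1 U alpha r) <=
     (c * n%:R `^ (- (r%:R / 2)) * ln n%:R `^ ((r%:R / 2 + 1) * D%:R))%:E)%E.
Proof.
move=> a1 r1 D0 HU; have oU : open U by case: HU => ->; [exact: openT|exact: interval_open].
have iU (a b c : R) : U a -> U b -> a <= c <= b -> U c.
  case: HU => -> //; rewrite /= !in_itv/= !andbT => a0 _ /andP[ac _]; exact: lt_le_trans ac.
have [C [B [P [M [[C0 B0] [P0 Psize] PU RP [M0 mM MI]]]]]] := levels_exist a1 r1 HU.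
have A0 : (0 < (3 * B) ^ D.+1)%N by rewrite expn_gt0 muln_gt0 B0.
have [c c0 Hc] := @smolyak_rate R r _ D A0.
exists (D.+1%:R * (2 * C) ^+ D.+1 * c); first by rewrite !mulr_gt0 ?ltr0n ?exprn_gt0 ?mulr_gt0.
move=> n n2; have [m mn] := max_level n A0 D0; have /andP[nA _] := mn.
apply: (@le_trans _ _ (quad_err U alpha (sobolev_ball D.+1 U alpha r) (smol_quad U alpha P D.+1 m))).
  apply: ereal_inf_lbound; exists (smol_quad U alpha P D.+1 m) => //; split.
    by rewrite size_map (leq_trans (size_Smol _ _ Psize)).
  by move=> p; exact: (smol_quad_nodes PU).
apply: ge_ereal_sup => _ [f fball <-].
apply: le_trans (smol_quad_error oU iU C0 P0 PU RP M0 mM MI m fball) _.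
rewrite lee_fin; apply: (@le_trans _ _ (D.+1%:R * (2 * C) ^+ D.+1 * (m.+1%:R ^+ D * q r ^+ m))).
  have -> (x y z t : R) : x * y * (z * t) = x * z * (y * t) by ring.
  rewrite ler_wpM2r ?mulr_ge0 ?exprn_ge0 ?mulr_ge0 ?(ltW C0) ?(ltW (q_gt0 r))//.
  by rewrite -natrX -natrM ler_nat size_Terms.
rewrite -!mulrA ler_wpM2l// ler_wpM2l ?exprn_ge0 ?mulr_ge0 ?(ltW C0)// !mulrA.
exact: Hc mn D0.
Qed.

Theorem theorem3p2 (R : realType) (d : nat) (alpha : R) (r : nat) (U : set R) :
  (2 <= d)%N -> -1 < alpha -> (1 <= r)%N ->
  (U = setT \/ U = `]0, +oo[%classic) ->
  exists C1 C2 : R, 0 < C1 /\ 0 < C2 /\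
    forall n : nat, (2 <= n)%N ->
      ((C1 * n%:R `^ (- (3 * r%:R / 4)) * ln n%:R `^ (3 * r%:R * d.-1%:R / 4))%:E
         <= Int_n d U alpha n (sobolev_ball d U alpha r))%E /\
      (Int_n d U alpha n (sobolev_ball d U alpha r)
         <= (C2 * n%:R `^ (- (r%:R / 2)) * ln n%:R `^ ((r%:R / 2 + 1) * d.-1%:R))%:E)%E.
Proof.
case: d => [|[|D]] // _ a1 r1 HU.
have oU : open U by case: HU => ->; [exact: openT|exact: interval_open].
have posU : `]0, +oo[ `<=` U by case: HU => ->.
have [c2 c20 H2] := Int_n_upper (D := D.+1) a1 r1 isT HU.
have [c c0 H1] := Int_n_lower alpha r oU posU D.+1.
have [e e0 He] := @log_power_rate R r D.+1 r1 isT.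
exists (c * e), c2; split; [exact: mulr_gt0|split=> // n n2; split; last exact: H2].
apply: le_trans (H1 n); rewrite lee_fin -!mulrA ler_wpM2l ?(ltW c0)// !mulrA.
exact: He.
Qed.
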